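(* Let $\nu,\kappa:\mathbb{R}\to\mathbb{R}$ satisfy, for some positive constants $\nu_*,\nu^*,\nu_{\rm lip},\kappa_*,\kappa^*,\kappa_{\rm lip}$, $\nu_*\le\nu(x)\le\nu^*$, $|\nu(y)-\nu(z)|\le\nu_{\rm lip}|y-z|$, $\kappa_*\le\kappa(x)\le\kappa^*$, $|\kappa(y)-\kappa(z)|\le\kappa_{\rm lip}|y-z|$ for all $x,y,z\in\mathbb{R}$. Let $\boldsymbol f\in L^2(\Omega)^2$ and $g\in L^2(\Omega)$. Consider the problem: find $(\boldsymbol u,\mathsf p,T)\in\mathbf V_0\times L^2_0(\Omega)\times H_0^1(\Omega)$ such that $$\int_\Omega\nu(T)\boldsymbol u\cdot\boldsymbol v-\int_\Omega\mathsf p\,\mathrm{div}\,\boldsymbol v=\int_\Omega\boldsymbol f\cdot\boldsymbol v\quad\forall\boldsymbol v\in\mathbf V_0,$$ $$\int_\Omega\mathsf q\,\mathrm{div}\,\boldsymbol u=0\quad\forall\mathsf q\in L_0^2(\Omega),$$ $$\int_\Omega\kappa(T)\nabla T\cdot\nabla S+\int_\Omega(\boldsymbol u\cdot\nabla T)S=\int_\Omega gS\quad\forall S\in H_0^1(\Omega)\cap L^\infty(\Omega).$$ Assume that this problem has a solution $(\boldsymbol u_1,\mathsf p_1,T_1)\in\mathbf V_0\times L^2_0(\Omega)\times H_0^1(\Omega)$ such that $T_1\in W^{1,\infty}(\Omega)$, $\boldsymbol u_1\in L^r(\Omega)^2$ for some $r>2$, and $$\frac{\kappa_*-\mathsf C_2\kappa_{\rm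 lip}\|\nabla T_1\|_{L^\infty(\Omega)^2}}{\nu_*^{-1}\,\mathsf C_{\frac{2r}{r-2}}\,\nu_{\rm lip}\,\|\boldsymbol u_1\|_{L^r(\Omega)^2}\|T_1\|_{L^\infty(\Omega)}}>1.$$ Then $(\boldsymbol u_1,\mathsf p_1,T_1)$ is the unique solution of the problem in $\mathbf V_0\times L^2_0(\Omega)\times H_0^1(\Omega)$.
   Context: $\Omega\subset\mathbb{R}^2$ is a simply connected, bounded, open polygonal domain with Lipschitz boundary $\Gamma$ and outward unit normal $\boldsymbol n$. $L_0^2(\Omega)=\{\mathsf q\in L^2(\Omega):\int_\Omega\mathsf q=0\}$ and $\mathbf V_0=\{\boldsymbol v\in H(\mathrm{div},\Omega):\boldsymbol v\cdot\boldsymbol n|_\Gamma=0\}$. $\mathsf C_2>0$ is the constant of the Poincaré inequality $\|S\|_{L^2(\Omega)}\le\mathsf C_2\|\nabla S\|_{L^2(\Omega)^2}$ for $S\in H_0^1(\Omega)$, and $\mathsf C_{\frac{2r}{r-2}}>0$ is the best constant of the Sobolev embedding $H_0^1(\Omega)\hookrightarrow L^{\frac{2r}{r-2}}(\Omega)$, i.e. $\|S\|_{L^{2r/(r-2)}(\Omega)}\le\mathsf C_{\frac{2r}{r-2}}\|\nabla S\|_{L^2(\Omega)^2}$. *)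

(* Defs.v *)
From HB Require Import structures.
From mathcomp Require Import all_boot all_order all_algebra.
From mathcomp Require Import all_classical all_reals all_analysis.

Set Implicit Arguments.
Unset Strict Implicit.
Unset Printing Implicit Defensive.
Import Order.TTheory GRing.Theory Num.Theory.
Import numFieldNormedType.Exports.

Local Open Scope classical_set_scope.
Local Open Scope ring_scope.

Section Plane.
Context {R : realType}.
Local Notation plane := (R * R)%type.
Implicit Types (A Om : set plane) (f g : plane -> R) (u v : plane -> plane).

Definition leb2 : {measure set (measurableTypeR R * measurableTypeR R) -> \bar R} :=
  (@lebesgue_measure R \x @lebesgue_measure R)%E.

(* The topological product [R * R] carries the max norm: Euclidean quantities
   are therefore spelled out. *)
Definition dot (x y : plane) : R := x.1 * y.1 + x.2 * y.2.
Definition enorm (x : plane) : R := Num.sqrt (dot x x).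

Definition frontier A : set plane := closure A `\` A°.

Definition unit_itv : set R := [set` `[(0 : R), 1]].

Definition segment (a b : plane) : set plane :=
  [set (1 - t) *: a + t *: b | t in unit_itv].

Definition polygonal_boundary Om :=
  exists s : seq (plane * plane),
    frontier Om = [set x | exists2 e, e \in s & segment e.1 e.2 x].

(* Near each boundary point, in some rotated Cartesian frame centred there,
   [Om] is the strict hypograph of a Lipschitz function. *)
Definition lipschitz_boundary Om :=
  forall x0, frontier Om x0 ->
  exists (t : plane) (d h L : R) (phi : R -> R),
    [/\ dot t t = 1, 0 < d, 0 < h,
        (forall a b, `|phi a - phi b| <= L * `|a - b|) &
        forall a b, `|a| < d -> `|b| < h ->
          Om (x0 + a *: t + b *: (- t.2, t.1)) <-> b < phi a].

Definition path_connected A :=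
  forall x y, A x -> A y -> exists c : R -> plane,
    [/\ {within unit_itv, continuous c}, c @` unit_itv `<=` A,
        c 0 = x & c 1 = y].

Definition simply_connected A :=
  path_connected A /\
  forall c : R -> plane,
    {within unit_itv, continuous c} -> c @` unit_itv `<=` A -> c 0 = c 1 ->
  exists H : plane -> plane,
    [/\ {within unit_itv `*` unit_itv, continuous H},
        H @` (unit_itv `*` unit_itv) `<=` A,
        (forall t, unit_itv t -> H (t, 0) = c t /\ H (t, 1) = c 0) &
        forall s, unit_itv s -> H (0, s) = c 0 /\ H (1, s) = c 0].

Definition lipschitz_polygonal_domain Om :=
  [/\ Om !=set0, open Om, connected Om, bounded_set Om &
      polygonal_boundary Om /\ lipschitz_boundary Om].

Definition ebase (i : bool) : plane := if i then (0, 1) else (1, 0).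

Definition partial (i : bool) f : plane -> R := fun x => 'D_(ebase i) f x.

Definition grad f : plane -> plane :=
  fun x => (partial false f x, partial true f x).

(* C^oo: every iterated partial derivative exists and is continuous. *)
Definition smooth f :=
  forall s : seq bool, let h := foldr partial f s in
    continuous h /\ forall i x, derivable h x (ebase i).

Definition test_fun Om f :=
  let supp := closure [set x | f x != 0] in
  [/\ smooth f, compact supp & supp `<=` Om].

(* Elements of L^p(Om) are represented by functions on the whole plane, only
   their values on [Om] being relevant; [\_ Om] extends by zero. *)
Definition Lpnorm Om (p : \bar R) f : \bar R :=
  ('N[leb2]_p[EFin \o (f \_ Om)])%E.

Definition Lp Om (p : \bar R) f := f \_ Om \in Lfun leb2 p.

Definition Lpnorm2 Om (p : \bar R) u : \bar R := Lpnorm Om p (enorm \o u).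

Definition Lp2 Om (p : \bar R) u := Lp Om p (fst \o u) /\ Lp Om p (snd \o u).

Definition integ Om f : R := (\int[leb2]_(x in Om) f x)%R.

Definition L20 Om f := Lp Om 2%:E f /\ integ Om f = 0.

Definition ae_eq_on (T : Type) Om (f g : plane -> T) :=
  {ae leb2, forall x, Om x -> f x = g x}.

Definition locally_integrable2 Om f :=
  measurable_fun Om (f : measurableTypeR R * measurableTypeR R -> R) /\
  forall K : set plane, compact K -> K `<=` Om ->
    (\int[leb2]_(x in K) `|f x|%:E < +oo)%E.

Definition is_weak_grad Om f u :=
  [/\ locally_integrable2 Om f,
      locally_integrable2 Om (fst \o u), locally_integrable2 Om (snd \o u) &
      forall phi, test_fun Om phi -> forall i : bool,
        integ Om (fun x => f x * partial i phi x) =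
        - integ Om (fun x => dot (u x) (ebase i) * phi x)].

Definition is_weak_div Om u f :=
  [/\ locally_integrable2 Om (fst \o u), locally_integrable2 Om (snd \o u),
      locally_integrable2 Om f &
      forall phi, test_fun Om phi ->
        integ Om (fun x => dot (u x) (grad phi x)) =
        - integ Om (fun x => f x * phi x)].

(* Weak derivatives are unique up to a null set; a representative is chosen,
   and it is zero when there is none. *)
Definition wgrad Om f : plane -> plane := xget (cst 0) [set u | is_weak_grad Om f u].
Definition wdiv Om u : plane -> R := xget (cst 0) [set f | is_weak_div Om u f].

Definition W1p Om (p : \bar R) f :=
  [/\ Lp Om p f, (exists u, is_weak_grad Om f u) & Lp2 Om p (wgrad Om f)].

Definition H1 Om f := W1p Om 2%:E f.

(* Closure of the test functions in H^1(Om). *)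
Definition H10 Om f :=
  H1 Om f /\ forall e : R, 0 < e -> exists phi,
    [/\ test_fun Om phi, (Lpnorm Om 2%:E (fun x => f x - phi x)%R < e%:E)%E &
        (Lpnorm2 Om 2%:E (fun x => wgrad Om f x - grad phi x)%R < e%:E)%E].

Definition Hdiv Om u :=
  [/\ Lp2 Om 2%:E u, (exists f, is_weak_div Om u f) & Lp Om 2%:E (wdiv Om u)].

(* The normal trace of [u] in H(div, Om) is the element of H^{-1/2} given by
   Green's formula: its duality pairing with the boundary trace of [phi] in
   H^1(Om). *)
Definition normal_trace Om u phi : R :=
  integ Om (fun x => dot (u x) (wgrad Om phi x)) +
  integ Om (fun x => wdiv Om u x * phi x).

Definition V0 Om u := Hdiv Om u /\ forall phi, H1 Om phi -> normal_trace Om u phi = 0.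

Definition embedding_constant Om (p : \bar R) (C : R) :=
  forall S, H10 Om S ->
    (Lpnorm Om p S <= C%:E * Lpnorm2 Om 2%:E (wgrad Om S))%E.

Definition best_embedding_constant Om (p : \bar R) (C : R) :=
  embedding_constant Om p C /\
  forall C', embedding_constant Om p C' -> C <= C'.

Definition is_solution Om (nu kappa : R -> R) (f : plane -> plane)
    (g : plane -> R) (u : plane -> plane) (p T : plane -> R) :=
  [/\ [/\ V0 Om u, L20 Om p & H10 Om T],
      (forall v, V0 Om v ->
        integ Om (fun x => nu (T x) * dot (u x) (v x)) -
        integ Om (fun x => p x * wdiv Om v x) =
        integ Om (fun x => dot (f x) (v x))),
      (forall q, L20 Om q -> integ Om (fun x => q x * wdiv Om u x) = 0) &
      forall S, H10 Om S -> Lp Om +oo%E S ->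
        integ Om (fun x => kappa (T x) * dot (wgrad Om T x) (wgrad Om S x)) +
        integ Om (fun x => dot (u x) (wgrad Om T x) * S x) =
        integ Om (fun x => g x * S x)].

End Plane.

(* Main.v *)
Require Import Defs.
From HB Require Import structures.
From mathcomp Require Import all_boot all_order all_algebra.
From mathcomp Require Import ring lra measurable_realfun ess_sup_inf.
From mathcomp Require Import all_classical all_reals all_analysis.
Import Order.TTheory GRing.Theory Num.Theory.
Import numFieldNormedType.Exports.
Local Open Scope classical_set_scope.
Local Open Scope ring_scope.
Set Implicit Arguments.
Unset Strict Implicit.
Unset Printing Implicit Defensive.

(** Let (u, p, T) be another solution, w = u - u1, theta = T - T1 and
    t = |grad theta|_2.  The velocities are divergence free: the normal trace
    tested with the constant 1 shows that div u has mean value 0, so div u is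
    itself an admissible multiplier.
    - Momentum, tested with w, gives by Lipschitz continuity of nu, Hoelder and
      Sobolev: |w|_2 <= nu_*^-1 nu_lip C_{2r/(r-2)} |u1|_r t.
    - Heat.  theta need not be bounded, so the test function is
      S = k sin (phi / k) for a test function phi close to theta in H^1.  The
      bad term drops because S grad phi = grad (k^2 (1 - cos (phi / k))) and
      div u = 0; and (w . grad T1) S is integrated by parts, moving the
      gradient from T1 to S.  Letting phi tend to theta and k to infinity,
      kappa_* t^2 <= (C_2 kappa_lip |grad T1|_oo t + |T1|_oo |w|_2) t.
    The smallness assumption then forces t = 0, hence theta = 0 and w = 0.
    - Pressure.  q = p - p1 is orthogonal to div v for every v in V_0; taking
      for v the compactly supported smooth fields, q has zero weak gradient, so
      it is constant on the connected set Om, and its mean value is 0. *)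

(** * Lebesgue measure on the plane *)

Section PlaneMeasure.
Context {R : realType}.
Local Notation plane := (R * R)%type.
Local Notation mplane := (measurableTypeR R * measurableTypeR R)%type.
Implicit Types (A Om : set plane).

(** The heat equation only admits bounded test functions, because u . grad T is merely integrable;
    this obstacle shapes the proof. The sine is used to truncate since it is smooth: the truncation
    of a test function is again a test function, its gradient cos (phi / k) grad phi comes from the
    classical chain rule, and |cos| <= 1. The price is a defect 1 - cos in the diffusion term. Since
    u is only in L^2 and S only bounded by k, replacing grad theta by grad phi costs k |u|_2 |grad
    (theta - phi)|_2; hence k is fixed before phi.

    The differences are split so that the regular solution carries the extra factor: kappa(T) grad T
    - kappa(T1) grad T1 = kappa(T) grad theta + (kappa(T) - kappa(T1)) grad T1, and u . grad T - u1
    . grad T1 = u . grad theta + w . grad T1. After the integration by parts, the convection term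
    needs no norm of S but that of its gradient, so C_2 enters only together with kappa_lip. The
    exponent 2r/(r-2) comes from Hoelder's inequality, 1/2 = 1/r + (r-2)/(2r). *)

Definition box (a b : plane) : set plane :=
  [set` `]a.1, b.1[] `*` [set` `]a.2, b.2[].

Lemma measurable_box a b : measurable (box a b : set mplane).
Proof. by apply: measurableX; exact: measurable_itv. Qed.

Lemma open_box a b : open (box a b).
Proof.
apply: openI; (apply: open_comp; last exact: interval_open) => x _.
  exact: cvg_fst.
exact: cvg_snd.
Qed.

Lemma boxP a b x : box a b x <->
  [/\ a.1 < x.1, x.1 < b.1, a.2 < x.2 & x.2 < b.2].
Proof.
rewrite /box /= !in_itv /=; split.
  by move=> [] /= /andP[? ?] /andP[].
by move=> [? ? ? ?]; split; apply/andP.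
Qed.

Lemma nbhs_ratbox (x : plane) A : nbhs x A -> exists a b : rat * rat,
  let ra := (ratr a.1, ratr a.2) in let rb := (ratr b.1, ratr b.2) in
  box ra rb x /\ box ra rb `<=` A.
Proof.
move=> /nbhs_ballP[e /= e0 eA].
have lt1 (y : R) : y - e < y by rewrite ltrBlDr ltrDl.
have lt2 (y : R) : y < y + e by rewrite ltrDl.
have [a1] := rat_in_itvoo (lt1 x.1); rewrite in_itv /= => /andP[a11 a12].
have [a2] := rat_in_itvoo (lt1 x.2); rewrite in_itv /= => /andP[a21 a22].
have [b1] := rat_in_itvoo (lt2 x.1); rewrite in_itv /= => /andP[b11 b12].
have [b2] := rat_in_itvoo (lt2 x.2); rewrite in_itv /= => /andP[b21 b22].
exists (a1, a2), (b1, b2) => /=; split; first exact/boxP.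
move=> y /boxP[/= y1 y2 y3 y4]; apply: eA; split => /=;
  rewrite -ball_normE /= ltr_norml; lra.
Qed.

Definition ratbox (q : (rat * rat) * (rat * rat)) : set plane :=
  box (ratr q.1.1, ratr q.1.2) (ratr q.2.1, ratr q.2.2).

(** Stated for any property inherited by small sets, so that one countable cover serves both the
    measurability of open sets and the passage from local to global almost everywhere statements. *)
Lemma open_ratboxes (P : set plane -> Prop) A :
  (forall x, A x -> exists2 U, nbhs x U & forall B, B `<=` U -> P B) ->
  A `<=` \bigcup_(q in [set q | P (ratbox q)]) ratbox q.
Proof.
move=> AP x /AP[U xU PU]; have [a [b [abx abU]]] := nbhs_ratbox xU.
by exists (a, b) => //; exact: PU.
Qed.

(** The sigma-algebra is the product one, generated by rectangles; its link with the topology is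
    that an open set is a countable union of rational boxes. *)
Lemma open_measurable2 A : open A -> measurable (A : set mplane).
Proof.
move=> oA.
have -> : A = \bigcup_q (if `[< ratbox q `<=` A >] then ratbox q else set0).
  apply/seteqP; split => [x Ax|x [q _]]; last by case: asboolP => // + /= => /[apply].
  have [|q /= qA qx] := @open_ratboxes (fun B => B `<=` A) A _ x Ax.
    by move=> y Ay; exists A => //; exact: open_nbhs_nbhs.
  by exists q => //; case: asboolP.
apply: countable_bigcupT_measurable; first exact: countableP.
by move=> q; case: asboolP => // _; exact: measurable_box.
Qed.

Lemma closed_measurable2 A : closed A -> measurable (A : set mplane).
Proof.
by move=> cA; rewrite -(setCK A); apply: measurableC; apply: open_measurable2; exact: closed_openC.
Qed.

Lemma compact_measurable2 A : compact A -> measurable (A : set mplane).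
Proof.
move=> cA; apply: closed_measurable2; exact: compact_closed.
Qed.

Lemma continuous_measurable_fun2 (D : set mplane) (f : plane -> R) :
  continuous f -> measurable_fun D (f : mplane -> R).
Proof.
move=> /continuousP cf mD; apply: (measurability _ (RGenOpens.measurableE R)) => //.
move=> _ [_ [a [b ->] <-]]; apply: measurableI => //.
by apply: open_measurable2; exact/cf/interval_open.
Qed.

Lemma leb2_box a b : a.1 <= b.1 -> a.2 <= b.2 ->
  leb2 (box a b : set mplane) = ((b.1 - a.1) * (b.2 - a.2))%:E.
Proof.
move=> ab1 ab2.
transitivity (lebesgue_measure ([set` `]a.1, b.1[] : set (measurableTypeR R)) *
    lebesgue_measure ([set` `]a.2, b.2[] : set (measurableTypeR R)))%E.
  by apply: product_measure1E; exact: measurable_itv.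
rewrite !lebesgue_measure_itv /= !lte_fin.
case: ltP => h1; case: ltP => h2; rewrite -?EFinB -?EFinM ?mul0e ?mule0 //; congr _%:E.
- by rewrite (_ : b.2 = a.2) ?subrr ?mulr0//; apply/eqP; rewrite eq_le h2.
- by rewrite (_ : b.1 = a.1) ?subrr ?mul0r//; apply/eqP; rewrite eq_le h1.
- by rewrite (_ : b.1 = a.1) ?subrr ?mul0r//; apply/eqP; rewrite eq_le h1.
Qed.

Lemma bounded_box A : bounded_set A ->
  exists2 M : R, 0 < M & A `<=` box (- M, - M) (M, M).
Proof.
move=> [M [_ AM]]; exists (`|M| + 2); first by rewrite ltr_wpDl.
move=> x /(AM (`|M| + 1)).
rewrite (@le_lt_trans _ _ `|M|) ?ler_norm ?ltrDl// => /(_ isT) /= xM.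
have {xM} : `|x| <= `|M| + 1 by exact: xM.
rewrite prod_normE /= ge_max => /andP[x1 x2].
have := ler_norm M.
by move: x1 x2; rewrite !ler_norml => /andP[? ?] /andP[? ?] ?; apply/boxP => /=; split; lra.
Qed.

Lemma bounded_leb2_fin A : bounded_set A -> measurable (A : set mplane) ->
  (leb2 (A : set mplane) < +oo)%E.
Proof.
move=> /bounded_box[M M0 AM] mA.
apply: (@le_lt_trans _ _ (leb2 (box (- M, - M) (M, M)))).
  by apply: le_measure => //; rewrite inE //; exact: measurable_box.
by rewrite leb2_box ?ltry //=; lra.
Qed.

End PlaneMeasure.

(** * Smooth functions and test functions *)

Section DirectionalSmoothness.
Context {R : realType} {V : normedModType R} {I : Type} (e : I -> V).
Implicit Types (f g h : V -> R).

(** Counterpart of [smooth] with an order n and arbitrary directions [e]: one calculus then serves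
    both the line (single direction 1) and the plane ([ebase]). Peeling off the innermost derivative
    lets the sum, product and chain rules be proved by induction on n. *)
Fixpoint cdiff n f : Prop :=
  if n is m.+1 then continuous f /\ forall i,
    (forall x, derivable f x (e i)) /\ cdiff m (fun x => 'D_(e i) f x)
  else continuous f.

Definition cinfty f := forall n, cdiff n f.

Lemma cdiff_continuous n f : cdiff n f -> continuous f.
Proof. by case: n => [|n] // []. Qed.

Lemma cdiffW n f : cdiff n.+1 f -> cdiff n f.
Proof.
elim: n f => [|n IH] f; first by case.
by move=> [cf df]; split => // i; have [dfi /IH cdi] := df i.
Qed.

Lemma cdiffD n f g : cdiff n f -> cdiff n g -> cdiff n (fun x => f x + g x).
Proof.
elim: n f g => [|n IH] f g; first by move=> cf cg x; apply: cvgD; [exact: cf|exact: cg].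
move=> [cf df] [cg dg]; split; first by move=> x; apply: cvgD; [exact: cf|exact: cg].
move=> i; have [dfi cfi] := df i; have [dgi cgi] := dg i.
split; first by move=> x; exact: derivableD.
rewrite (_ : (fun x => _) = (fun x => 'D_(e i) f x + 'D_(e i) g x)); first exact: IH.
by apply/funext => x; rewrite -deriveD.
Qed.

Lemma cdiffM n f g : cdiff n f -> cdiff n g -> cdiff n (fun x => f x * g x).
Proof.
elim: n f g => [|n IH] f g; first by move=> cf cg x; apply: cvgM; [exact: cf|exact: cg].
move=> hf hg; have [/cdiffW hf' /cdiffW hg'] := (hf, hg).
move: hf hg => [cf df] [cg dg]; split; first by move=> x; apply: cvgM; [exact: cf|exact: cg].
move=> i; have [dfi cfi] := df i; have [dgi cgi] := dg i.
split; first by move=> x; exact: derivableM.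
rewrite (_ : (fun x => _) = (fun x => f x * 'D_(e i) g x + g x * 'D_(e i) f x)).
  by apply: cdiffD; apply: IH.
by apply/funext => x; rewrite (@deriveM _ _ f g).
Qed.

Lemma cdiff_cst n (c : R) : cdiff n (fun=> c).
Proof.
elim: n c => [|n IH] c; first by move=> x; exact: cvg_cst.
split; first by move=> x; exact: cvg_cst.
move=> i; split => [x|]; first exact: derivable_cst.
have -> : (fun x : V => 'D_(e i) (fun=> c) x) = (fun=> 0 : R).
  by apply/funext => x; exact: derive_cst.
exact: IH.
Qed.

Lemma cdiffZ n (c : R) f : cdiff n f -> cdiff n (fun x => c * f x).
Proof. by move=> hf; apply: cdiffM => //; exact: cdiff_cst. Qed.

Lemma cinfty_derive f i : cinfty f -> cinfty (fun x => 'D_(e i) f x).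
Proof. by move=> cf n; have [_ /(_ i)[]] := cf n.+1. Qed.

Lemma cinfty_derivable f i x : cinfty f -> derivable f x (e i).
Proof. by move=> /(_ 1%N)[_ /(_ i)[]]. Qed.

Lemma is_derive_comp_dir (F : R -> R) f (x v : V) (a b : R) :
  is_derive (f x) 1 F a -> is_derive x v f b ->
  is_derive x v (F \o f) (a * b).
Proof.
move=> dF [df <-].
pose k (t : R) := f (t *: v + x).
have k0 : k 0 = f x by rewrite /k scale0r add0r.
have dk : is_derive (0 : R) 1 k ('D_v f x).
  split; first exact: (iffLR (derivable1P f x v) df).
  rewrite /derive (_ : (fun h : R => _) = (fun h : R => h^-1 *: ((f \o shift x) (h *: v) - f x))) //.
  by apply/funext => t /=; rewrite addr0 k0 /k /GRing.scale /= mulr1.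
rewrite -k0 in dF; have [dFk DFk] := is_derive1_comp dF dk.
split; first exact: (iffRL (derivable1P (F \o f) x v) dFk).
rewrite -DFk /derive.
rewrite (_ : (fun h : R => _) = (fun h : R => h^-1 *: ((F \o k \o shift 0) (h *: 1) - (F \o k) 0))) //.
by apply/funext => t /=; rewrite addr0 k0 /k /GRing.scale /= mulr1.
Qed.

(* [P] is any class of one-variable functions closed under differentiation. *)
Lemma cdiff_comp (P : (R -> R) -> Prop) n F f :
  (forall G, P G -> exists2 G', P G' & forall x : R, is_derive x 1 G (G' x)) ->
  P F -> cdiff n f -> cdiff n (fun x => F (f x)).
Proof.
move=> PD; have cP G : P G -> continuous G.
  move=> /PD[G' _ dG] x; apply/differentiable_continuous/derivable1_diffP.
  by have [] := dG x.
have cc G g : P G -> continuous g -> continuous (fun x => G (g x)).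
  move=> /cP cG cg x; exact: (continuous_comp (cg x) (cG _)).
elim: n F f => [|n IH] F f PF; first exact: cc.
move=> hf; have hf' := cdiffW hf; move: hf => [cf df].
split; first exact: cc.
have [F' PF' dF] := PD _ PF.
move=> i; have [dfi cfi] := df i.
have dc x : is_derive x (e i) (F \o f) (F' (f x) * 'D_(e i) f x).
  by apply: is_derive_comp_dir => //; exact: derivableP.
split; first by move=> x; have [] := dc x.
rewrite (_ : (fun x => _) = (fun x => F' (f x) * 'D_(e i) f x)); last first.
  by apply/funext => x; have [] := dc x.
by apply: cdiffM => //; exact: IH.
Qed.

End DirectionalSmoothness.

(** * Smooth functions on the line and on the plane *)

Section Smoothness.
Context {R : realType}.
Local Notation plane := (R * R)%type.
Implicit Types (f g h : plane -> R).

Definition cinfty1 (F : R -> R) := cinfty (fun _ : unit => 1 : R^o) F.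

Lemma cinfty1_comp (F : R -> R) (V : normedModType R) I (e : I -> V) (f : V -> R) :
  cinfty1 F -> cinfty e f -> cinfty e (fun x => F (f x)).
Proof.
move=> cF cf n; apply: (@cdiff_comp _ _ _ _ cinfty1) => // G cG.
exists (fun x => 'D_1 G x); first exact: (cinfty_derive tt cG).
by move=> x; apply: derivableP; exact: (@cinfty_derivable _ _ _ _ G tt x cG).
Qed.

(** [foldr] differentiates along the last letter of the word first, so the innermost derivative,
    which [cdiff] peels off, corresponds to [rcons]. *)
Lemma smoothP f : smooth f <-> cinfty (@ebase R) f.
Proof.
split=> [sf n|].
  elim: n f sf => [|n IH] f sf; first by case: (sf [::]).
  have [cf df] := sf [::]; split=> // i; split; first by move=> x; exact: df.
  apply: IH => s; have := sf (rcons s i).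
  by rewrite -cats1 foldr_cat.
move=> cf s; elim/last_ind: s f cf => [|s i IH] f cf.
  split; first exact: (cdiff_continuous (cf 0%N)).
  by move=> i x; exact: cinfty_derivable.
by rewrite -cats1 foldr_cat /=; apply: IH; exact: cinfty_derive.
Qed.

Lemma smooth_continuous f : smooth f -> continuous f.
Proof. by move=> /(_ [::])[]. Qed.

Lemma smooth_derivable f i x : smooth f -> derivable f x (ebase i).
Proof. by move=> /(_ [::])[_]; exact. Qed.

Lemma smooth_partial f i : smooth f -> smooth (partial i f).
Proof. by move=> /smoothP cf; apply/smoothP; exact: cinfty_derive. Qed.

Lemma smoothD f g : smooth f -> smooth g -> smooth (fun x => f x + g x).
Proof.
by move=> /smoothP cf /smoothP cg; apply/smoothP => n; exact: cdiffD.
Qed.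

Lemma smoothM f g : smooth f -> smooth g -> smooth (fun x => f x * g x).
Proof.
by move=> /smoothP cf /smoothP cg; apply/smoothP => n; exact: cdiffM.
Qed.

Lemma smooth_cst (c : R) : smooth (fun _ : plane => c).
Proof. by apply/smoothP => n; exact: cdiff_cst. Qed.

Lemma smooth_comp (F : R -> R) f :
  cinfty1 F -> smooth f -> smooth (fun x => F (f x)).
Proof. by move=> cF /smoothP cf; apply/smoothP; exact: cinfty1_comp. Qed.

Lemma partialM f g i x : smooth f -> smooth g ->
  partial i (fun x => f x * g x) x = f x * partial i g x + g x * partial i f x.
Proof.
move=> sf sg; rewrite /partial (@deriveM _ _ f g) //; exact: smooth_derivable.
Qed.

Lemma partial_comp (F F' : R -> R) f i x : (forall y : R, is_derive y 1 F (F' y)) ->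
  smooth f -> partial i (fun x => F (f x)) x = F' (f x) * partial i f x.
Proof.
move=> dF sf; have df : is_derive x (ebase i) f (partial i f x).
  by apply: derivableP; exact: smooth_derivable.
by have [] := is_derive_comp_dir (dF (f x)) df.
Qed.

Lemma is_derive_linear (V : normedModType R) (L : V -> R) (x v : V) :
  (forall a y z, L (a *: y + z) = a * L y + L z) -> is_derive x v L (L v).
Proof.
move=> linL.
have lim : (fun h : R => h^-1 *: ((L \o shift x) (h *: v) - L x)) @ 0^' --> L v.
  apply: cvg_near_cst.
  near=> t; rewrite /= linL addrK /GRing.scale /= mulrA mulVf ?mul1r//.
  by near: t; exact: nbhs_dnbhs_neq.
by split; [apply/cvg_ex; exists (L v)|exact/cvg_lim].
Unshelve. all: by end_near. Qed.

Lemma cinfty_linear (V : normedModType R) I (e : I -> V) (L : V -> R) :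
  (forall a y z, L (a *: y + z) = a * L y + L z) -> continuous L -> cinfty e L.
Proof.
move=> linL cL [|n] //; split => // i.
have dL x : is_derive x (e i) L (L (e i)) by exact: is_derive_linear.
split; first by move=> x; have [] := dL x.
rewrite (_ : (fun x => _) = (fun=> L (e i))); first exact: cdiff_cst.
by apply/funext => x; have [] := dL x.
Qed.

Lemma smooth_fst : smooth (fst : plane -> R).
Proof.
by apply/smoothP; apply: cinfty_linear => // x; exact: cvg_fst.
Qed.

Lemma smooth_snd : smooth (snd : plane -> R).
Proof.
by apply/smoothP; apply: cinfty_linear => // x; exact: cvg_snd.
Qed.

Lemma partial_fst i x : partial i (fst : plane -> R) x = (ebase i).1.
Proof. by have [] := @is_derive_linear _ fst x (ebase i) (fun _ _ _ => erefl). Qed.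

Lemma partial_snd i x : partial i (snd : plane -> R) x = (ebase i).2.
Proof. by have [] := @is_derive_linear _ snd x (ebase i) (fun _ _ _ => erefl). Qed.

Lemma cinfty1_affine (a b : R) : cinfty1 (fun x => a * x + b).
Proof.
move=> n; apply: cdiffD; last exact: cdiff_cst.
by apply: cdiffZ; apply: cinfty_linear => // x; exact: cvg_id.
Qed.

(** The span of sin and cos is closed under differentiation, so [cdiff_comp] applies with the
    identity as inner function. *)
Lemma cinfty1_sin : cinfty1 (@sin R).
Proof.
move=> n; pose P (F : R -> R) := exists a b, F = fun x => a * sin x + b * cos x.
apply: (@cdiff_comp _ _ _ _ P _ sin id).
- move=> _ [a [b ->]]; exists (fun x => a * cos x - b * sin x).
    by exists (- b), a; apply/funext => x; ring.
  by move=> x; apply: is_derive_eq; rewrite /GRing.scale /=; ring.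
- by exists 1, 0; apply/funext => x; ring.
- by apply: cinfty_linear => // x; exact: cvg_id.
Qed.

Lemma cinfty1_cos : cinfty1 (@cos R).
Proof.
move=> n; have /(cinfty_derive tt)/(_ n) := cinfty1_sin.
by congr cdiff; apply/funext => x; rewrite (@derive_val _ _ _ _ _ sin).
Qed.

End Smoothness.

(** * Smooth bumps built from e^(-1/x) *)

Section FlatFunctions.
Context {R : realType}.
Implicit Types (p : {poly R}) (F : R -> R).

(* p(1/x) e^(-1/x), extended by 0: a class of functions closed under
   differentiation, which contains functions vanishing on a half-line. *)
Definition flat p (x : R) : R := if 0 < x then p.[x^-1] * expR (- x^-1) else 0.

Lemma expR_ge_monomial n (y : R) : 0 <= y -> y ^+ n <= n`!%:R * expR y.
Proof.
move=> y0; case: n => [|n]; first by rewrite expr0 fact0 mul1r; have := expR_ge1Dx y; lra.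
have := expR_ge1Dxn n y0; set E := expR y; set f := n.+1`!%:R => h.
have f0 : 0 < f by rewrite ltr0n fact_gt0.
rewrite mulrC -ler_pdivrMr//; lra.
Qed.

Lemma horner_le_expR p : exists2 C, 0 <= C & forall y, 0 <= y -> `|p.[y]| <= C * expR y.
Proof.
exists (\sum_(i < size p) `|p`_i| * i`!%:R).
  by apply: sumr_ge0 => i _; rewrite mulr_ge0.
move=> y y0; rewrite horner_coef mulr_suml (le_trans (ler_norm_sum _ _ _))//.
apply: ler_sum => i _; rewrite normrM -mulrA ler_wpM2l// normrX (ger0_norm y0).
exact: expR_ge_monomial.
Qed.

(** The exponential dominates the polynomial y^2 p(y), taken at y = 1/x. The quadratic bound is what
    gives a zero derivative at the junction point 0. *)
Lemma flat_le_sqr p : exists2 C, 0 <= C & forall x, `|flat p x| <= C * x ^+ 2.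
Proof.
have [C C0 pC] := horner_le_expR (p * 'X^2); exists C => // x.
rewrite /flat; case: ifPn => [x0|_]; last by rewrite normr0 mulr_ge0 ?sqr_ge0.
have := pC x^-1; rewrite invr_ge0 ltW// => /(_ isT).
rewrite hornerM hornerXn normrM normrX [`|x^-1|]gtr0_norm ?invr_gt0// => h.
rewrite normrM (gtr0_norm (expR_gt0 _)) expRN.
have E0 := expR_gt0 x^-1.
rewrite ler_pdivrMr// -(ler_pM2r (x := x^-1 ^+ 2)) ?exprn_gt0 ?invr_gt0//.
rewrite (le_trans h)// [leRHS](_ : _ = C * expR x^-1)//.
by field; rewrite ?gt_eqF.
Qed.

Lemma is_derive_le_sqr F C : (forall x, `|F x| <= C * x ^+ 2) -> is_derive (0 : R) 1 F 0.
Proof.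
move=> FC; have F0 : F 0 = 0.
  by apply/eqP; rewrite -normr_le0 (le_trans (FC 0))// expr0n mulr0.
have lim : (fun h : R => h^-1 *: ((F \o shift 0) (h *: 1) - F 0)) @ 0^' --> 0.
  apply/cvgr0Pnorm_lt => e e0; near=> h.
  have h0 : h != 0 by near: h; exact: nbhs_dnbhs_neq.
  rewrite /= F0 subr0 addr0 /GRing.scale /= mulr1 normrM normfV mulrC.
  rewrite ltr_pdivrMr ?normr_gt0// (le_lt_trans (FC h))//.
  rewrite -real_normK ?num_real// expr2 mulrA ltr_pM2r ?normr_gt0//.
  rewrite (@le_lt_trans _ _ ((`|C| + 1) * `|h|))//.
    by rewrite ler_wpM2r// (le_trans (ler_norm _))// lerDl.
  have C1 : 0 < `|C| + 1 by rewrite ltr_wpDl.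
  rewrite mulrC -ltr_pdivlMr// -[`|h|]/(`|h|); near: h.
  apply: dnbhs0_lt; by rewrite divr_gt0.
by split; [apply/cvg_ex; exists 0|exact/cvg_lim].
Unshelve. all: by end_near. Qed.

(** With y = 1/x one has dy/dx = - y^2, so the derivative of p(y) e^(-y) is y^2 (p - p')(y) e^(-y),
    of the same form again. *)
Lemma is_derive_flat p (x : R) : is_derive x 1 (flat p) (flat ('X^2 * (p - p^`())) x).
Proof.
have [x0|x0|->] := ltrgtP x 0.
- have -> : flat ('X^2 * (p - p^`())) x = 0 by rewrite /flat ltNge (ltW x0).
  apply: (@near_eq_is_derive _ _ _ (cst (0 : R))).
  near=> y; have : y < 0 by near: y; exact: lt_nbhsl.
  by rewrite /flat => y0; rewrite ltNge (ltW y0).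
- have -> : flat ('X^2 * (p - p^`())) x =
      ('X^2 * (p - p^`())).[x^-1] * expR (- x^-1) by rewrite /flat x0.
  have nE : \near x, p.[x^-1] * expR (- x^-1) = flat p x.
    near=> y; have : 0 < y by near: y; exact: lt_nbhsr.
    by rewrite /flat => ->.
  have xn0 : x != 0 by rewrite gt_eqF.
  have dinv : is_derive x 1 (fun y : R => y^-1) (- x ^- 2).
    have := is_deriveV xn0 (is_derive_id x 1).
    by move/is_derive_eq; apply; rewrite /GRing.scale /= mulr1.
  have dp : is_derive x 1 (horner p \o (fun y => y^-1)) (p^`().[x^-1] * (- x ^- 2)).
    exact: is_derive1_comp.
  have de : is_derive x 1 (expR \o (fun y => - y^-1)) (expR (- x^-1) * (x ^- 2)).
    apply: is_derive1_comp; rewrite -[x ^- 2]opprK; exact: is_deriveN.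
  apply: (near_eq_is_derive nE); have := is_deriveM dp de; move/is_derive_eq; apply.
  rewrite /GRing.scale /= !(hornerM, hornerX, hornerD, hornerN) /=.
  by field.
- have [C C0 pC] := flat_le_sqr p.
  have -> : flat ('X^2 * (p - p^`())) 0 = 0 by rewrite /flat ltxx.
  exact: is_derive_le_sqr pC.
Unshelve. all: by end_near. Qed.

Lemma cinfty1_flat p : cinfty1 (flat p).
Proof.
move=> n; apply: (@cdiff_comp _ _ _ _ (fun F => exists p, F = flat p) _ (flat p) id).
- move=> _ [q ->]; eexists; first by exists ('X^2 * (q - q^`())).
  exact: is_derive_flat.
- by exists p.
- by apply: cinfty_linear => // x; exact: cvg_id.
Qed.

(** Positive exactly on ]a, b[. The factor [k.+1] sharpens both edges: as k grows, the bumps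
    converge pointwise to the indicator of ]a, b[. *)
Definition bump (k : nat) (a b x : R) : R :=
  flat 1 (k.+1%:R * (x - a)) * flat 1 (k.+1%:R * (b - x)).

Lemma cinfty1_bump k a b : cinfty1 (bump k a b).
Proof.
move=> n; apply: cdiffM; apply: cinfty1_comp n; try exact: cinfty1_flat.
  rewrite (_ : (fun x => _) = (fun x => k.+1%:R * x + (- k.+1%:R * a))); first exact: cinfty1_affine.
  by apply/funext => x; ring.
rewrite (_ : (fun x => _) = (fun x => (- k.+1%:R) * x + (k.+1%:R * b))); first exact: cinfty1_affine.
by apply/funext => x; ring.
Qed.

Lemma flat1_ge0 x : 0 <= flat 1 x.
Proof. by rewrite /flat; case: ifP => // _; rewrite hornerC mul1r expR_ge0. Qed.

Lemma flat1_le1 x : flat 1 x <= 1.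
Proof.
rewrite /flat; case: ifPn => // x0; rewrite hornerC mul1r expR_le1.
by rewrite oppr_le0 invr_ge0 ltW.
Qed.

Lemma flat1_gt0 x : (0 < flat 1 x) = (0 < x).
Proof.
by rewrite /flat; case: ifPn => [_|]; rewrite ?ltxx// hornerC mul1r expR_gt0.
Qed.

Lemma bump_ge0 k a b x : 0 <= bump k a b x.
Proof. by rewrite mulr_ge0 ?flat1_ge0. Qed.

Lemma bump_le1 k a b x : bump k a b x <= 1.
Proof. by rewrite mulr_ile1 ?flat1_ge0 ?flat1_le1. Qed.

Lemma bump_gt0 k a b x : a < x < b -> 0 < bump k a b x.
Proof.
move=> /andP[ax xb]; rewrite mulr_gt0 // flat1_gt0 mulr_gt0//; lra.
Qed.

Lemma bump_out k a b x : ~~ (a < x < b) -> bump k a b x = 0.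
Proof.
have out y : ~~ (0 < y) -> flat 1 (k.+1%:R * y) = 0.
  by move=> y0; rewrite /flat pmulr_rgt0 // (negbTE y0).
rewrite negb_and => /orP[h|h]; rewrite /bump.
  by rewrite out ?mul0r// subr_gt0.
by rewrite [X in _ * X]out ?mulr0// subr_gt0.
Qed.

Lemma flat1_cvg x : flat 1 (k.+1%:R * x) @[k --> \oo] --> ((0 < x)%R%:R : R).
Proof.
have [x0|x0] := ltP 0 x; last first.
  rewrite (_ : (fun k => _) = (fun=> 0)); first exact: cvg_cst.
  by apply/funext => k; rewrite /flat pmulr_rgt0// ltNge x0.
rewrite (_ : (fun k => _) = (fun k => expR (- (k.+1%:R^-1 * x^-1)))); last first.
  by apply/funext => k; rewrite /flat pmulr_rgt0// x0 hornerC mul1r invfM.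
have lim : (- (k.+1%:R^-1 * x^-1)) @[k --> \oo] --> (- (0 * x^-1) : R).
  by apply: cvgN; apply: cvgMl; exact: cvg_harmonic.
have := continuous_cvg _ (@continuous_expR R _) lim.
by rewrite mul0r oppr0 expR0; exact.
Qed.

Lemma bump_cvg a b x : bump k a b x @[k --> \oo] --> ((a < x < b)%R%:R : R).
Proof.
rewrite -mulnb natrM -(subr_gt0 a) -(subr_gt0 x).
by apply: cvgM; exact: flat1_cvg.
Qed.

End FlatFunctions.

(** * Closure properties of test functions *)

Section TestFunctions.
Context {R : realType}.
Local Notation plane := (R * R)%type.
Implicit Types (f g : plane -> R) (Om : set plane).

Lemma closure_sub_closed (T : topologicalType) (A B : set T) :
  closed B -> A `<=` B -> closure A `<=` B.
Proof. by move=> /closure_id {2}-> AB; exact: closureS. Qed.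

Definition cbox (a b : plane) : set plane :=
  [set` `[a.1, b.1]] `*` [set` `[a.2, b.2]].

Lemma cboxP a b x : cbox a b x <->
  [/\ a.1 <= x.1, x.1 <= b.1, a.2 <= x.2 & x.2 <= b.2].
Proof.
rewrite /cbox /= !in_itv /=; split.
  by move=> [] /= /andP[? ?] /andP[].
by move=> [? ? ? ?]; split; apply/andP.
Qed.

Lemma box_cbox a b : box a b `<=` cbox a b.
Proof. by move=> x /boxP[? ? ? ?]; apply/cboxP; split; exact: ltW. Qed.

Lemma compact_cbox a b : compact (cbox a b).
Proof. by apply: compact_setX; exact: segment_compact. Qed.

Lemma closed_cbox a b : closed (cbox a b).
Proof. by apply: compact_closed; [exact: norm_hausdorff|exact: compact_cbox]. Qed.

Lemma partial_notin_supp f i x :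
  ~ closure [set y | f y != 0] x -> partial i f x = 0.
Proof.
move=> /existsNP[A /not_implyP[xA fA0]].
rewrite /partial (near_eq_derive (g := cst 0)) ?derive_cst//.
near=> y; apply/eqP/negPn/negP => fy0; apply: fA0; exists y; split => //.
by near: y.
Unshelve. all: by end_near. Qed.

Lemma test_fun_sub Om f g : test_fun Om f -> smooth g ->
  [set x | g x != 0] `<=` closure [set x | f x != 0] -> test_fun Om g.
Proof.
move=> [sf cf fOm] sg gf.
have gf' : closure [set x | g x != 0] `<=` closure [set x | f x != 0].
  by apply: closure_sub_closed => //; exact: closed_closure.
split => //; last exact: subset_trans fOm.
by apply: subclosed_compact cf gf'; exact: closed_closure.
Qed.

Lemma test_fun_smooth Om f : test_fun Om f -> smooth f.
Proof. by case. Qed.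

Lemma test_funD Om f g : test_fun Om f -> test_fun Om g ->
  test_fun Om (fun x => f x + g x).
Proof.
move=> [sf cf fOm] [sg cg gOm].
set A := closure [set x | f x != 0] in cf fOm *.
set B := closure [set x | g x != 0] in cg gOm *.
have AB : closure [set x | f x + g x != 0] `<=` A `|` B.
  apply: closure_sub_closed; first by apply: closedU; exact: closed_closure.
  move=> x /= fgx.
  have [fx0|fx0] := eqVneq (f x) 0; last by left; exact: subset_closure.
  by right; apply: subset_closure; move: fgx; rewrite /= fx0 add0r.
split; first exact: smoothD.
  by apply: subclosed_compact AB; [exact: closed_closure|exact: compactU].
by move=> x /AB[/fOm|/gOm].
Qed.

Lemma test_funM Om f g : test_fun Om f -> smooth g ->
  test_fun Om (fun x => g x * f x).
Proof.
move=> tf sg; apply: (test_fun_sub tf).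
  by apply: smoothM => //; exact: test_fun_smooth tf.
by move=> x /=; rewrite mulf_eq0 negb_or => /andP[_ ?]; exact: subset_closure.
Qed.

Lemma test_funZ Om c f : test_fun Om f -> test_fun Om (fun x => c * f x).
Proof. by move=> tf; apply: test_funM => //; exact: smooth_cst. Qed.

Lemma test_fun_comp Om (F : R -> R) f : cinfty1 F -> F 0 = 0 ->
  test_fun Om f -> test_fun Om (fun x => F (f x)).
Proof.
move=> cF F0 tf; apply: (test_fun_sub tf).
  by apply: smooth_comp => //; exact: test_fun_smooth tf.
move=> x /= Ffx; apply: subset_closure => /=.
by apply: contra_neq Ffx => ->.
Qed.

Lemma test_fun_partial Om f i : test_fun Om f -> test_fun Om (partial i f).
Proof.
move=> tf; apply: (test_fun_sub tf).
  by apply: smooth_partial; exact: test_fun_smooth tf.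
move=> x /=; apply: contraPP => nx; rewrite partial_notin_supp ?eqxx//.
Qed.

Lemma test_fun_out Om f x : test_fun Om f -> ~ Om x -> f x = 0.
Proof.
move=> [_ _ fOm] nOx; apply/eqP/negPn/negP => fx0; apply/nOx/fOm.
exact: subset_closure.
Qed.

Lemma test_fun_continuous Om f : test_fun Om f -> continuous f.
Proof. by move=> /test_fun_smooth/smooth_continuous. Qed.

Lemma test_fun_bounded Om f : test_fun Om f ->
  exists2 M, 0 <= M & forall x, `|f x| <= M.
Proof.
move=> tf; have [sf cf fOm] := tf.
have cK : compact (f @` closure [set x | f x != 0]).
  apply: continuous_compact => //; apply: continuous_subspaceT.
  exact: smooth_continuous.
have [M [_ KM]] := compact_bounded cK.
exists (`|M| + 1); first by rewrite addr_ge0.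
move=> x; have [->|fx0] := eqVneq (f x) 0; first by rewrite normr0 addr_ge0.
apply: KM; first by rewrite (le_lt_trans (ler_norm M))// ltrDl.
by exists x => //; exact: subset_closure.
Qed.

(** Tensor products serve twice: they approximate indicators of boxes, and they separate the
    variables for a function with zero weak gradient. The closed box has to lie in [Om], because the
    support is a closure. *)
Lemma test_fun_tensor Om (a b : plane) (A B : R -> R) : cbox a b `<=` Om ->
  cinfty1 A -> cinfty1 B ->
  (forall s, ~~ (a.1 < s < b.1) -> A s = 0) ->
  (forall s, ~~ (a.2 < s < b.2) -> B s = 0) ->
  test_fun Om (fun x => A x.1 * B x.2).
Proof.
move=> abOm cA cB A0 B0.
have sub : closure [set x : plane | A x.1 * B x.2 != 0] `<=` cbox a b.
  apply: closure_sub_closed; first exact: closed_cbox.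
  move=> x /=; rewrite mulf_eq0 negb_or => /andP[Ax Bx].
  apply: box_cbox; apply/boxP.
  have /andP[? ?] : a.1 < x.1 < b.1 by apply: contraNT Ax => /A0 ->.
  by have /andP[? ?] : a.2 < x.2 < b.2 by apply: contraNT Bx => /B0 ->.
split; last exact: subset_trans abOm.
  apply: smoothM; apply: smooth_comp => //; [exact: smooth_fst|exact: smooth_snd].
by apply: subclosed_compact sub; [exact: closed_closure|exact: compact_cbox].
Qed.

Lemma partial_tensor (A B : R -> R) (x : plane) : cinfty1 A -> cinfty1 B ->
  partial false (fun x => A x.1 * B x.2) x = 'D_1 A x.1 * B x.2 /\
  partial true (fun x => A x.1 * B x.2) x = A x.1 * 'D_1 B x.2.
Proof.
move=> cA cB.
have dF (F : R -> R) : cinfty1 F -> forall y : R, is_derive y 1 F ('D_1 F y).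
  by move=> cF y; apply: derivableP; exact: (@cinfty_derivable _ _ _ _ F tt y cF).
have sA : smooth (fun x : plane => A x.1) by apply: smooth_comp => //; exact: smooth_fst.
have sB : smooth (fun x : plane => B x.2) by apply: smooth_comp => //; exact: smooth_snd.
rewrite !partialM // (partial_comp _ _ (dF A cA)); last exact: smooth_fst.
rewrite (partial_comp _ _ (dF B cB)); last exact: smooth_snd.
rewrite (partial_comp _ _ (dF A cA)); last exact: smooth_fst.
rewrite (partial_comp _ _ (dF B cB)); last exact: smooth_snd.
by rewrite !partial_fst !partial_snd /=; split; ring.
Qed.

End TestFunctions.

(** * Square-integrable functions *)

Section RealIntegrals.
Context d (T : measurableType d) {R : realType}
  (mu : {measure set T -> \bar R}) (D : set T) (mD : measurable D).
Implicit Types f g h : T -> R.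
Local Notation int f := (mu.-integrable D (EFin \o (f : T -> R))).
Local Notation I f := (\int[mu]_(x in D) (f x))%R.

Lemma ae_imp (P Q : T -> Prop) : (forall x, P x -> Q x) ->
  {ae mu, forall x, P x} -> {ae mu, forall x, Q x}.
Proof. by move=> PQ; apply: filterS. Qed.

Lemma ae_imp2 (P P' Q : T -> Prop) : (forall x, P x -> P' x -> Q x) ->
  {ae mu, forall x, P x} -> {ae mu, forall x, P' x} -> {ae mu, forall x, Q x}.
Proof. by move=> PQ; apply: filterS2. Qed.

Lemma integrable_measurable_fun f : int f -> measurable_fun D f.
Proof. by move=> /measurable_int/measurable_EFinP. Qed.

Lemma eq_integrable_on f g : (forall x, D x -> f x = g x) -> int f -> int g.
Proof.
by move=> fg; apply: eq_integrable => // x /set_mem Dx /=; rewrite fg.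
Qed.

Lemma eq_Rintegral_on f g : (forall x, D x -> f x = g x) -> I f = I g.
Proof. by move=> fg; apply: eq_Rintegral => x /set_mem; exact: fg. Qed.

Lemma integrable_addr f g : int f -> int g -> int (fun x => f x + g x).
Proof. exact: integrableD. Qed.

Lemma integrable_scalel c f : int f -> int (fun x => c * f x).
Proof. exact: integrableZl. Qed.

Lemma integrable_oppr f : int f -> int (fun x => - f x).
Proof. exact: integrableN. Qed.

Lemma integrable_subr f g : int f -> int g -> int (fun x => f x - g x).
Proof. by move=> fi gi; apply: integrable_addr => //; exact: integrable_oppr. Qed.

Lemma integrable_le f g : measurable_fun D f -> (forall x, D x -> `|f x| <= g x) ->
  int g -> int f.
Proof.
move=> mf fg; apply: le_integrable => //; first exact/measurable_EFinP.
by move=> x Dx /=; rewrite lee_fin (le_trans (fg _ Dx))// ler_norm.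
Qed.

Lemma integrable_normr f : int f -> int (fun x => `|f x|).
Proof.
move=> fi; apply: integrable_norm => //.
Qed.

Lemma integrable_bounded_mul h M f : measurable_fun D h -> (forall x, D x -> `|h x| <= M) ->
  int f -> int (fun x => h x * f x).
Proof.
move=> mh hM fi; apply: (@integrable_le _ (fun x => M * `|f x|)).
- by apply: measurable_funM => //; exact: integrable_measurable_fun.
- by move=> x Dx; rewrite normrM ler_wpM2r// hM.
- by apply: integrable_scalel; exact: integrable_normr.
Qed.

Lemma Rintegral_ae_eq f g : measurable_fun D f -> measurable_fun D g ->
  {ae mu, forall x, D x -> f x = g x} -> I f = I g.
Proof.
move=> mf mg fg; congr fine; apply: ae_eq_integral => //; try exact/measurable_EFinP.
by apply: filterS fg => x fg Dx; rewrite fg.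
Qed.

Lemma ae_le_Rintegral f g : int f -> int g ->
  {ae mu, forall x, D x -> f x <= g x} -> I f <= I g.
Proof.
move=> fi gi fg; have mf := integrable_measurable_fun fi; have mg := integrable_measurable_fun gi.
(* The maximum equals g almost everywhere and dominates f at every point, which turns the comparison
   into a pointwise one. *)
have -> : I g = I (fun x => Num.max (f x) (g x)).
  apply: Rintegral_ae_eq => //; first exact: measurable_maxr.
  by apply: filterS fg => x fg Dx; rewrite max_r// fg.
apply: le_Rintegral => //; last by move=> x Dx; rewrite le_max lexx.
apply: (@integrable_le _ (fun x => `|f x| + `|g x|)); first exact: measurable_maxr.
  move=> x _; rewrite ler_norml le_max ge_max.
  have := ler_norm (f x); have := ler_norm (g x).
  have := lerNnormlW (lexx `|f x|).
  have := normr_ge0 (g x); have := normr_ge0 (f x).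
  by move=> ? ? ? ? ?; apply/andP; split; [apply/orP; left|apply/andP; split]; lra.
by apply: integrable_addr; exact: integrable_normr.
Qed.

Lemma Rintegral_eq0_ae f : int f -> (forall x, D x -> 0 <= f x) -> I f = 0 ->
  {ae mu, forall x, D x -> f x = 0}.
Proof.
move=> fi f0 If0.
have mf : measurable_fun D (EFin \o f) by apply/measurable_EFinP/integrable_measurable_fun.
have /(ae_eq_integral_abs mu mD mf) : (\int[mu]_(x in D) `|(EFin \o f) x| = 0)%E.
  transitivity (\int[mu]_(x in D) (f x)%:E)%E.
    by apply: eq_integral => x /set_mem Dx /=; rewrite ger0_norm// f0.
  by have := integrable_fin_num mD fi; rewrite fin_numE => /fineK <-; rewrite [fine _]If0.
by apply: filterS => x /[apply] -[].
Qed.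

Lemma Rintegral_dominated_cvg (f_ : nat -> T -> R) f g :
  (forall n, measurable_fun D (f_ n)) -> measurable_fun D f ->
  (forall x, D x -> f_ n x @[n --> \oo] --> f x) ->
  int g -> (forall n x, D x -> `|f_ n x| <= g x) ->
  (I (f_ n) @[n --> \oo] --> I f).
Proof.
move=> mf_ mf f_f gi f_g.
have [|||||fi _ cf] := @dominated_convergence _ _ _ mu D mD
  (fun n => EFin \o f_ n) (EFin \o f) (EFin \o g).
- by move=> n; exact/measurable_EFinP.
- exact/measurable_EFinP.
- by apply: aeW => x Dx; apply: cvg_EFin; [exact: nearW|exact: f_f].
- exact: gi.
- by apply: aeW => x n Dx; rewrite /= lee_fin; exact: f_g.
apply: fine_cvg; rewrite fineK //.
by exact: integrable_fin_num.
Qed.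

(** L^2(D) in a form where products are integrated as real functions, without extended reals;
    [Lp_sqint] identifies it with [Lp] at exponent 2. *)
Definition sqint f := measurable_fun D f /\ int (fun x => f x ^+ 2).

Lemma sqint_mul f g : sqint f -> sqint g -> int (fun x => f x * g x).
Proof.
move=> [mf fi] [mg gi]; apply: (@integrable_le _ (fun x => f x ^+ 2 + g x ^+ 2)).
- exact: measurable_funM.
- move=> x _; rewrite normrM -(real_normK (num_real (f x))) -(real_normK (num_real (g x))).
  by nra.
- exact: integrable_addr.
Qed.

Lemma sqint_add f g : sqint f -> sqint g -> sqint (fun x => f x + g x).
Proof.
move=> sf sg; have [mf fi] := sf; have [mg gi] := sg.
split; first exact: measurable_funD.
apply: (@eq_integrable_on (fun x => f x ^+ 2 + (2 * (f x * g x) + g x ^+ 2))).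
  by move=> x _; ring.
by apply: integrable_addr => //; apply: integrable_addr => //; apply: integrable_scalel; exact: sqint_mul.
Qed.

Lemma sqint_bdd h M f : measurable_fun D h -> (forall x, D x -> `|h x| <= M) ->
  sqint f -> sqint (fun x => h x * f x).
Proof.
move=> mh hM [mf fi]; split; first exact: measurable_funM.
apply: (@eq_integrable_on (fun x => h x * (h x * f x ^+ 2))); first by move=> x _; ring.
by do 2 apply: (integrable_bounded_mul mh hM).
Qed.

Lemma sqint_scale c f : sqint f -> sqint (fun x => c * f x).
Proof. by apply: (@sqint_bdd _ `|c|). Qed.

Lemma sqint_opp f : sqint f -> sqint (fun x => - f x).
Proof.
move=> /(sqint_scale (-1)); congr sqint; apply/funext => x; exact: mulN1r.
Qed.

Lemma sqint_sub f g : sqint f -> sqint g -> sqint (fun x => f x - g x).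
Proof. by move=> sf sg; apply: sqint_add => //; exact: sqint_opp. Qed.

Lemma sqint_bounded f M : (mu D < +oo)%E -> measurable_fun D f ->
  (forall x, D x -> `|f x| <= M) -> sqint f.
Proof.
move=> Dfin mf fM.
have bi (h : T -> R) (N : R) : measurable_fun D h -> (forall x, D x -> `|h x| <= N) -> int h.
  move=> mh hN; apply: measurable_bounded_integrable => //.
  exists N; split; first exact: num_real.
  by move=> y Ny x Dx; apply: le_trans (hN _ Dx) (ltW Ny).
split => //; apply: (bi _ (M ^+ 2)); first exact: measurable_funX.
move=> x Dx; rewrite normrX ler_pXn2r ?nnegrE//; first exact: fM.
exact: le_trans (fM _ Dx).
Qed.

Lemma sqint_int f : (mu D < +oo)%E -> sqint f -> int f.
Proof.
move=> Dfin sf; apply: (@eq_integrable_on (fun x => f x * 1)); first by move=> x _; rewrite mulr1.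
apply: sqint_mul => //; apply: (@sqint_bounded _ 1) => //.
by move=> x _; rewrite normr1.
Qed.

Lemma sqint_ae f g : measurable_fun D g -> {ae mu, forall x, D x -> f x = g x} ->
  sqint f -> sqint g.
Proof.
move=> mg fg [mf /integrableP[mf2 fi]]; split => //; apply/integrableP; split.
  by apply/measurable_EFinP; exact: measurable_funX.
apply: le_lt_trans fi; rewrite le_eqVlt; apply/orP; left; apply/eqP.
apply: ae_eq_integral => //.
- by apply: measurableT_comp => //; apply/measurable_EFinP; exact: measurable_funX.
- exact: measurableT_comp.
- by apply: filterS fg => x fg Dx /=; rewrite fg.
Qed.

Definition sqint2 (u : T -> R * R) := sqint (fst \o u) /\ sqint (snd \o u).

Lemma sqint2_dot u v : sqint2 u -> sqint2 v -> int (fun x => dot (u x) (v x)).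
Proof.
by move=> [u1 u2] [v1 v2]; apply: integrable_addr; exact: sqint_mul.
Qed.

Lemma sqint2_add u v : sqint2 u -> sqint2 v -> sqint2 (fun x => u x + v x).
Proof. by move=> [u1 u2] [v1 v2]; split; exact: sqint_add. Qed.

Lemma sqint2_sub u v : sqint2 u -> sqint2 v -> sqint2 (fun x => u x - v x).
Proof. by move=> [u1 u2] [v1 v2]; split; exact: sqint_sub. Qed.

Lemma sqint2_bdd h M u : measurable_fun D h -> (forall x, D x -> `|h x| <= M) ->
  sqint2 u -> sqint2 (fun x => h x *: u x).
Proof. by move=> mh hM [u1 u2]; split; exact: (sqint_bdd mh hM). Qed.

(** The L^2 norm of a field. A scalar f is measured as the field (f, 0), so that one Cauchy-Schwarz
    inequality and one triangle inequality cover both cases. *)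
Definition nrm (u : T -> R * R) : R := Num.sqrt (I (fun x => dot (u x) (u x))).

Lemma dot_ge0 (x : R * R) : 0 <= dot x x.
Proof. by rewrite /dot -!expr2 addr_ge0// sqr_ge0. Qed.

Lemma nrm_ge0 u : 0 <= nrm u. Proof. exact: sqrtr_ge0. Qed.

Lemma nrm_sqr u : nrm u ^+ 2 = I (fun x => dot (u x) (u x)).
Proof. by rewrite sqr_sqrtr//; apply: Rintegral_ge0 => x _; exact: dot_ge0. Qed.

Lemma Rintegral_dot_expand u v (s : R) : sqint2 u -> sqint2 v ->
  I (fun x => dot (u x + s *: v x) (u x + s *: v x)) =
  nrm u ^+ 2 + 2 * s * I (fun x => dot (u x) (v x)) + s ^+ 2 * nrm v ^+ 2.
Proof.
move=> su sv; rewrite !nrm_sqr.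
have uu := sqint2_dot su su; have uv := sqint2_dot su sv; have vv := sqint2_dot sv sv.
transitivity (I (fun x => (dot (u x) (u x) + (2 * s) * dot (u x) (v x)) + s ^+ 2 * dot (v x) (v x))).
  by apply: eq_Rintegral_on => x _; rewrite /dot /= /GRing.scale /=; ring.
rewrite RintegralD//; last 2 first.
  by apply: integrable_addr => //; exact: integrable_scalel.
  exact: integrable_scalel.
by rewrite RintegralD//; [rewrite !RintegralZl|exact: integrable_scalel].
Qed.

Lemma cauchy_schwarz u v : sqint2 u -> sqint2 v ->
  `|I (fun x => dot (u x) (v x))| <= nrm u * nrm v.
Proof.
move=> su sv; set b := I _.
have q (s : R) : 0 <= nrm u ^+ 2 + 2 * s * b + s ^+ 2 * nrm v ^+ 2.
  by rewrite -Rintegral_dot_expand//; apply: Rintegral_ge0 => x _; exact: dot_ge0.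
have := nrm_ge0 u; have := nrm_ge0 v; move: (nrm u) (nrm v) q => a c q c0 a0.
rewrite -[leRHS]ger0_norm ?mulr_ge0// -ler_sqr ?nnegrE// !real_normK ?num_real//.
have [c00|cn0] := eqVneq c 0.
  (* If |v| = 0 the quadratic [q] is affine in s; were b nonzero, this s would give it the value
     -1. *)
  have := q 0; have := q (- (a ^+ 2 + 1) / (2 * b)).
  have [->|bn0] := eqVneq b 0; first by rewrite expr0n sqr_ge0.
  rewrite c00 expr0n /= mulr0 addr0 => h _; exfalso; move: h.
  rewrite (_ : _ + _ = -1); first by rewrite ler0N1.
  by field.
(* The minimiser of the quadratic: its nonnegativity there is the discriminant condition. *)
have := q (- b / c ^+ 2).
have c2 : 0 < c ^+ 2 by rewrite exprn_gt0// lt0r cn0.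
rewrite (_ : _ + _ = ((a * c) ^+ 2 - b ^+ 2) / c ^+ 2); last by field.
by rewrite pmulr_lge0 ?invr_gt0// subr_ge0.
Qed.

End RealIntegrals.

(** * The fundamental lemma of the calculus of variations *)

Section FundamentalLemma.
Context {R : realType}.
Local Notation plane := (R * R)%type.
Local Notation mplane := (measurableTypeR R * measurableTypeR R)%type.
Implicit Types (Om : set plane) (a b c : plane) (f : plane -> R).
Local Notation mu := (@leb2 R).

Definition open_boxes : set (set mplane) :=
  [set A | exists a b : plane, A = box a b].

Lemma box_setI a b a' b' : box a b `&` box a' b' =
  box (Num.max a.1 a'.1, Num.max a.2 a'.2) (Num.min b.1 b'.1, Num.min b.2 b'.2).
Proof.
apply/seteqP; split => x.
  by move=> [/boxP[? ? ? ?] /boxP[? ? ? ?]]; apply/boxP; rewrite /= !gt_max !lt_min; split; apply/andP.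
by move=> /boxP[]; rewrite /= !gt_max !lt_min => /andP[? ?] /andP[? ?] /andP[? ?] /andP[? ?];
  split; apply/boxP.
Qed.

Lemma setI_closed_boxes : setI_closed open_boxes.
Proof.
by move=> _ _ [a [b ->]] [a' [b' ->]]; rewrite box_setI; do 2 eexists.
Qed.

Lemma exists_nat_gt_norm (r : R) : exists n : nat, `|r| < n%:R.
Proof.
exists (Num.bound r); have := @archi_boundP R `|r| (normr_ge0 _).
by rewrite /Num.bound normr_id.
Qed.

(** Open boxes are stable under intersection, so this generation result makes Dynkin induction
    available. Rectangles belong to the sigma-algebra of boxes because both projections are
    measurable for it: the preimage of an interval is a strip, exhausted by boxes of length 2n. *)
Lemma measurable_boxesE : @measurable _ mplane = <<s open_boxes >>.
Proof.
rewrite measurable_prod_measurableType; apply/seteqP; split; last first.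
  apply: smallest_sub; first exact: smallest_sigma_algebra.
  move=> _ [a [b ->]]; apply: sub_sigma_algebra.
  exists [set` `]a.1, b.1[]; first exact: measurable_itv.
  by exists [set` `]a.2, b.2[] => //; exact: measurable_itv.
pose T := g_sigma_algebraType open_boxes.
have mfst : measurable_fun [set: T] (fst : T -> measurableTypeR R).
  apply: (measurability _ (RGenOpens.measurableE R)) => //.
  move=> _ [_ [x [y ->]] <-].
  rewrite setTI (_ : _ @^-1` _ = \bigcup_n (box (x, - n%:R) (y, n%:R) : set T)).
    by apply: bigcupT_measurable => n; apply: sub_sigma_algebra; do 2 eexists.
  apply/seteqP; split => z; last first.
    by move=> [n _] /boxP[/= ? ? _ _]; rewrite /= in_itv /=; apply/andP.
  rewrite /= in_itv /= => /andP[? ?].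
  have [n] := exists_nat_gt_norm z.2; rewrite ltr_norml => /andP[? ?].
  by exists n => //; apply/boxP.
have msnd : measurable_fun [set: T] (snd : T -> measurableTypeR R).
  apply: (measurability _ (RGenOpens.measurableE R)) => //.
  move=> _ [_ [x [y ->]] <-].
  rewrite setTI (_ : _ @^-1` _ = \bigcup_n (box (- n%:R, x) (n%:R, y) : set T)).
    by apply: bigcupT_measurable => n; apply: sub_sigma_algebra; do 2 eexists.
  apply/seteqP; split => z; last first.
    by move=> [n _] /boxP[/= _ _ ? ?]; rewrite /= in_itv /=; apply/andP.
  rewrite /= in_itv /= => /andP[? ?].
  have [n] := exists_nat_gt_norm z.1; rewrite ltr_norml => /andP[? ?].
  by exists n => //; apply/boxP.
apply: smallest_sub; first exact: smallest_sigma_algebra.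
move=> _ [A mA] [B mB] <-.
have -> : A `*` B = (setT `&` fst @^-1` A) `&` (setT `&` snd @^-1` B) :> set T.
  by rewrite !setTI.
by apply: (@measurableI _ T); [exact: mfst|exact: msnd].
Qed.

(** Extend f by zero outside the box. The sets over which this extension has zero integral contain
    all boxes and are stable under complement and disjoint countable union, so by Dynkin they are
    all the measurable sets. *)
Lemma ae0_of_integral_boxes a b f : mu.-integrable (box a b) (EFin \o f) ->
  (forall c d, box c d `<=` box a b -> \int[mu]_(x in box c d) f x = 0) ->
  {ae mu, forall x, box a b x -> f x = 0}.
Proof.
move=> fi f0; have mab := measurable_box a b.
have Fi : mu.-integrable setT (EFin \o (f \_ (box a b))).
  by rewrite -restrict_EFin; exact: (iffLR (integrable_mkcond _ mab) fi).
have FiS (S : set mplane) : measurable S -> mu.-integrable S (EFin \o (f \_ (box a b))).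
  by move=> mS; apply: integrableS Fi.
have F0 S : measurable S -> \int[mu]_(x in S) (f \_ (box a b)) x = 0.
  move=> mS; have := mS; rewrite {1}measurable_boxesE; move: S mS.
  suff H : forall S, <<s open_boxes >> S -> \int[mu]_(x in S) (f \_ (box a b)) x = 0.
    by move=> S _; exact: H.
  apply: (@dynkin_induction _ _ open_boxes
    (fun S => \int[mu]_(x in S) (f \_ (box a b)) x = 0)).
  - exact: measurable_boxesE.
  - exact: setI_closed_boxes.
  - by rewrite -Rintegral_mkcond f0.
  - move=> _ [c [d ->]]; rewrite -Rintegral_mkcondr box_setI f0// -box_setI.
    exact: subIsetr.
  - move=> {}S mS S0; have := @Rintegral_setU _ _ _ mu S (~` S) _ mS (measurableC mS).
    rewrite setUv => /(_ _ Fi); rewrite -Rintegral_mkcond f0// S0 add0r => -> //.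
    by apply/disj_setPS => x [].
  - move=> F mF tF F0; rewrite /Rintegral integral_bigcup//; last first.
      by apply: FiS; exact: bigcupT_measurable.
    rewrite eseries0// => n _ _.
    have := F0 n; rewrite /Rintegral => h.
    by rewrite -[LHS]fineK ?h//; exact: (integrable_fin_num (mF n) (FiS _ (mF n))).
have : ae_eq mu (box a b) (EFin \o f) (cst 0%E).
  apply: integral_ae_eq => // E Eab mE; rewrite integral0.
  transitivity (\int[mu]_(x in E) (EFin \o (f \_ (box a b))) x)%E.
    by apply: eq_integral => x /set_mem Ex /=; rewrite patchE mem_set//; exact: Eab.
  rewrite -[LHS]fineK; last exact: (integrable_fin_num mE (FiS _ mE)).
  by rewrite [fine _](F0 E mE).
by apply: filterS => x /[apply] -[].
Qed.

(** From local to global: the exceptional sets of countably many rational boxes still form a null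
    set. *)
Lemma ae_bigcup_ratbox (P : set plane -> Prop) (Q : plane -> Prop) (Om : set plane) :
  (forall x, Om x -> exists2 U, nbhs x U & forall B, B `<=` U -> P B) ->
  (forall q, P (ratbox q) -> {ae mu, forall x, ratbox q x -> Q x}) ->
  {ae mu, forall x, Om x -> Q x}.
Proof.
move=> /open_ratboxes OmP PQ.
(* The boxes are enumerated through [unpickle] in order to exchange the quantifier over them with
   the almost everywhere one. *)
have : {ae mu, forall x (n : nat), if unpickle n is Some q then
    P (ratbox q) -> ratbox q x -> Q x else True}.
  apply/ae_foralln => n; case: unpickle => [q|]; last exact: aeW.
  have [Pq|nPq] := pselect (P (ratbox q)); last exact: aeW.
  by apply: ae_imp (PQ q Pq) => x.
apply: ae_imp => x Qx /OmP[q /= Pq qx]; have := Qx (pickle q).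
by rewrite pickleK; exact.
Qed.

Lemma nbhs_cbox (x : plane) (U : set plane) : nbhs x U ->
  exists a b, nbhs x (box a b) /\ cbox a b `<=` U.
Proof.
move=> /nbhs_ballP[e /= e0 eU]; exists (x.1 - e / 2, x.2 - e / 2), (x.1 + e / 2, x.2 + e / 2).
split.
  apply: open_nbhs_nbhs; split; first exact: open_box.
  by apply/boxP => /=; split; lra.
move=> y /cboxP[/= ? ? ? ?]; apply: eU; split => /=; rewrite -ball_normE /= ltr_norml; lra.
Qed.

Definition box_bump (n : nat) (a b : plane) : plane -> R :=
  fun x => bump n a.1 b.1 x.1 * bump n a.2 b.2 x.2.

Lemma test_fun_box_bump Om n a b : cbox a b `<=` Om -> test_fun Om (box_bump n a b).
Proof.
move=> abOm; apply: (test_fun_tensor abOm); try exact: cinfty1_bump.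
  exact: bump_out.
exact: bump_out.
Qed.

Lemma box_bump_out n a b x : ~ box a b x -> box_bump n a b x = 0.
Proof.
move=> nab; rewrite /box_bump.
have [h1|h1] := boolP (a.1 < x.1 < b.1); last by rewrite bump_out ?mul0r.
have [h2|h2] := boolP (a.2 < x.2 < b.2); last by rewrite [X in _ * X]bump_out ?mulr0.
by exfalso; apply: nab; move/andP: h1 => [? ?]; move/andP: h2 => [? ?]; apply/boxP.
Qed.

Lemma box_bump_norm n a b x : `|box_bump n a b x| <= 1.
Proof.
rewrite /box_bump normrM !ger0_norm ?bump_ge0//.
by rewrite mulr_ile1 ?bump_ge0 ?bump_le1.
Qed.

Lemma box_bump_cvg a b x : box a b x -> box_bump n a b x @[n --> \oo] --> (1 : R).
Proof.
move=> /boxP[? ? ? ?]; rewrite -(mulr1 1).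
apply: cvgM.
  have := @bump_cvg R a.1 b.1 x.1; rewrite (_ : (a.1 < _ < _) = true) //; exact/andP.
have := @bump_cvg R a.2 b.2 x.2; rewrite (_ : (a.2 < _ < _) = true) //; exact/andP.
Qed.

Lemma integ_out Om (D : set plane) f : D `<=` Om -> (forall x, ~ D x -> f x = 0) ->
  integ Om f = integ D f.
Proof.
move=> DOm fD; rewrite /integ Rintegral_mkcond [RHS]Rintegral_mkcond; congr (Rintegral _ _ _).
apply/funext => x; rewrite !patchE.
have [/set_mem Dx|nD] := boolP (x \in D); first by rewrite mem_set//; exact: DOm.
by case: ifP => // _; apply: fD => /mem_set; apply/negP.
Qed.

Lemma integrable_box_of_locally_integrable Om f a b : locally_integrable2 Om f ->
  cbox a b `<=` Om -> open Om -> mu.-integrable (box a b) (EFin \o f).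
Proof.
move=> [mf lf] abOm oOm.
apply: (@integrableS _ mplane _ mu (cbox a b)); last 1 first.
- apply/integrableP; split; last exact: (lf _ (@compact_cbox _ a b) abOm).
  apply/measurable_EFinP; apply: measurable_funS mf => //.
  exact: open_measurable2.
- by apply: closed_measurable2; exact: closed_cbox.
- exact: measurable_box.
- exact: box_cbox.
Qed.

(** The bumps converge to 1 on their box and are bounded by 1, so dominated convergence turns
    orthogonality to them into zero integrals over boxes. The assumption concerns nonempty boxes
    only: for these the closed box is under control too, which makes the bump a test function. *)
Lemma box_bump_ae0 a b f : mu.-integrable (box a b) (EFin \o f) ->
  (forall c d, box c d `<=` box a b -> c.1 < d.1 -> c.2 < d.2 ->
    forall n, integ (box c d) (fun x => f x * box_bump n c d x) = 0) ->
  {ae mu, forall x, box a b x -> f x = 0}.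
Proof.
move=> fi f0; apply: ae0_of_integral_boxes => // c d cdab.
have box0 : ~ (c.1 < d.1 /\ c.2 < d.2) -> box c d = set0.
  move=> cd; apply/seteqP; split => // x /boxP[? ? ? ?]; apply: cd.
  by split; lra.
have [[cd1 cd2]|/box0 ->] := pselect (c.1 < d.1 /\ c.2 < d.2); last exact: Rintegral_set0.
have mcd := measurable_box c d.
have fcd : mu.-integrable (box c d) (EFin \o f).
  by apply: integrableS fi => //; exact: measurable_box.
have mf := integrable_measurable_fun fcd.
have lim : integ (box c d) (fun x => f x * box_bump n c d x) @[n --> \oo] -->
    integ (box c d) f.
  apply: (@Rintegral_dominated_cvg _ mplane R mu (box c d) mcd
    (fun n x => f x * box_bump n c d x) f (fun x => `|f x|)) => //.
  - move=> n; apply: measurable_funM => //; apply: continuous_measurable_fun2.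
    by apply: (@test_fun_continuous _ setT); exact: test_fun_box_bump.
  - move=> x cdx; rewrite -[X in _ --> X]mulr1; apply: cvgM; first exact: cvg_cst.
    exact: box_bump_cvg.
  - exact: integrable_normr.
  - by move=> n x _; rewrite normrM ler_piMr// box_bump_norm.
rewrite (_ : (fun n => _) = (fun=> 0)) in lim; last by apply/funext => n; exact: f0.
by rewrite -[LHS](cvg_lim _ lim)// lim_cst.
Qed.

(** Points of the open diagonal of the inner box approach its corners. An empty box would say
    nothing about its corners, hence the strict inequalities. *)
Lemma box_sub_cbox a b c d : box c d `<=` box a b -> c.1 < d.1 -> c.2 < d.2 ->
  cbox c d `<=` cbox a b.
Proof.
move=> cdab cd1 cd2.
have mid (s : R) : 0 < s < 1 ->
    box a b (c.1 + s * (d.1 - c.1), c.2 + s * (d.2 - c.2)).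
  move=> /andP[s0 s1]; apply: cdab; apply/boxP => /=.
  have := mulr_gt0 s0 (_ : 0 < d.1 - c.1); have := mulr_gt0 s0 (_ : 0 < d.2 - c.2).
  rewrite !subr_gt0 => /(_ cd2) ? /(_ cd1) ?; split; nra.
suff [? ? ? ?] : [/\ a.1 <= c.1, a.2 <= c.2, d.1 <= b.1 & d.2 <= b.2].
  by move=> x /cboxP[? ? ? ?]; apply/cboxP; split; lra.
have key (p q l : R) : 0 < l -> (forall s, 0 < s < 1 -> p < q + s * l) -> p <= q.
  move=> l0 h; rewrite leNgt; apply/negP => qp.
  (* If q < p, this parameter moves q by at most half of the gap, contradicting p < q + s l; the
     value 1/2 keeps s below 1. *)
  set s := Num.min (1/2) ((p - q)/(2 * l)).
  have s0 : 0 < s by rewrite /s lt_min; apply/andP; split; [lra|apply: divr_gt0; lra].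
  have s1 : s < 1 by rewrite /s gt_min; apply/orP; left; lra.
  have sl : s * l <= (p - q) / 2.
    rewrite (_ : (p - q) / 2 = (p - q) / (2 * l) * l); last by field; lra.
    by rewrite ler_pM2r// /s ge_min lexx orbT.
  have := h s; rewrite s0 s1 => /(_ isT); lra.
split.
- apply: (key _ _ (d.1 - c.1)); first by rewrite subr_gt0.
  by move=> s /mid/boxP[].
- apply: (key _ _ (d.2 - c.2)); first by rewrite subr_gt0.
  by move=> s /mid/boxP[].
- apply: (key _ _ (d.1 - c.1)); first by rewrite subr_gt0.
  move=> s /andP[s0 s1]; have /mid/boxP[/= _ + _ _] : 0 < 1 - s < 1 by apply/andP; split; lra.
  lra.
- apply: (key _ _ (d.2 - c.2)); first by rewrite subr_gt0.
  move=> s /andP[s0 s1]; have /mid/boxP[/= _ _ _ +] : 0 < 1 - s < 1 by apply/andP; split; lra.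
  lra.
Qed.

Lemma ae0_of_test_fun Om f : open Om -> locally_integrable2 Om f ->
  (forall phi, test_fun Om phi -> integ Om (fun x => f x * phi x) = 0) ->
  {ae mu, forall x, Om x -> f x = 0}.
Proof.
move=> oOm lf f0.
apply: (@ae_bigcup_ratbox (fun B => exists a b, B `<=` box a b /\ cbox a b `<=` Om)).
  move=> x Omx; have [a [b [xab abOm]]] := nbhs_cbox (open_nbhs_nbhs (conj oOm Omx)).
  by exists (box a b) => // B Bab; exists a, b.
move=> q [a [b [qab abOm]]].
suff : {ae mu, forall x, box a b x -> f x = 0} by apply: ae_imp => x h /qab.
apply: box_bump_ae0; first exact: integrable_box_of_locally_integrable lf _ _.
move=> c d cdab cd1 cd2 n.
have cdOm : cbox c d `<=` Om := subset_trans (box_sub_cbox cdab cd1 cd2) abOm.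
rewrite -(f0 _ (test_fun_box_bump n cdOm)); apply/esym/integ_out.
  exact: subset_trans (@box_cbox _ _ _) cdOm.
by move=> x nx; rewrite box_bump_out// mulr0.
Qed.

End FundamentalLemma.

(** * Integrals of test functions and of their derivatives *)

Section TestFunctionIntegrals.
Context {R : realType}.
Local Notation plane := (R * R)%type.
Local Notation mplane := (measurableTypeR R * measurableTypeR R)%type.
Implicit Types (Om : set plane) (f phi : plane -> R).
Local Notation mu := (@leb2 R).
Local Notation lam := (@lebesgue_measure R).

Lemma integral_derive_compact_support (F F' : R -> R) (M : R) : 0 < M ->
  (forall x : R, is_derive x 1 F (F' x)) -> continuous F' ->
  (forall x, M <= `|x| -> F x = 0) -> (forall x, M <= `|x| -> F' x = 0) ->
  (\int[lam]_x (F' x)%:E = 0)%E.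
Proof.
move=> M0 dF cF' F0 F'0.
have -> : (\int[lam]_x (F' x)%:E = \int[lam]_(x in `[(- M)%R, M]) (F' x)%:E)%E.
  rewrite [RHS]integral_mkcond; apply: eq_integral => x _.
  rewrite patchE; case: ifPn => // /negP nx; rewrite F'0//.
  rewrite leNgt ltr_norml; apply/negP => /andP[? ?]; apply: nx.
  by rewrite inE /= in_itv /=; apply/andP; split; exact: ltW.
have cF x : {for x, continuous F}.
  by apply/differentiable_continuous/derivable1_diffP; have [] := dF x.
rewrite (@continuous_FTC2 _ _ F).
- by rewrite !F0 ?subee// ?normrN ger0_norm// ltW.
- lra.
- exact: continuous_subspaceT.
- split; first by move=> x _; have [] := dF x.
    exact: (cvg_at_right_filter (cF _)).
  exact: (cvg_at_left_filter (cF _)).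
- by move=> x _; rewrite derive1E; have [] := dF x.
Qed.

Lemma test_fun_box Om phi : test_fun Om phi ->
  exists2 M : R, 0 < M & forall x, ~ box (- M, - M) (M, M) x -> phi x = 0.
Proof.
move=> [_ cphi _]; have [M M0 sub] := bounded_box (compact_bounded cphi).
exists M => // x nx; apply/eqP/negPn/negP => phix; apply: nx; apply: sub.
exact: subset_closure.
Qed.

Lemma integrable_test_fun Om phi : test_fun Om phi -> mu.-integrable setT (EFin \o phi).
Proof.
move=> tphi; have [M M0 out] := test_fun_box tphi.
have [C C0 phiC] := test_fun_bounded tphi.
have mB := @measurable_box R (- M, - M) (M, M).
have -> : phi = phi \_ (box (- M, - M) (M, M)).
  apply/funext => x; rewrite patchE; case: ifPn => // /negP nx.
  by apply: out => /mem_set.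
rewrite -restrict_EFin; apply/(integrable_mkcond _ mB).
apply: measurable_bounded_integrable => //.
- by rewrite leb2_box /= ?ltry//; lra.
- by apply: continuous_measurable_fun2; exact: test_fun_continuous tphi.
- exists C; split; first exact: num_real.
  by move=> y Cy x _; apply: le_trans (phiC x) (ltW Cy).
Qed.

Lemma integ_setT_test Om phi : test_fun Om phi -> integ Om phi = integ setT phi.
Proof.
by move=> tphi; apply/esym/integ_out => // x; exact: test_fun_out tphi.
Qed.

Lemma is_derive_slice1 f (x y : R) : smooth f ->
  is_derive x 1 (fun s => f (s, y)) (partial false f (x, y)).
Proof.
move=> sf; have df : derivable f (x, y) (ebase false) by exact: smooth_derivable.
have E : (fun h : R => h^-1 *: (((fun s => f (s, y)) \o shift x) (h *: 1) - f (x, y))) =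
   (fun h : R => h^-1 *: ((f \o shift (x, y)) (h *: ebase false) - f (x, y))).
  apply/funext => h /=; congr (_ *: (f _ - _)).
  by rewrite [RHS]surjective_pairing /= scaler0 add0r.
by split; rewrite /derivable /derive E.
Qed.

Lemma is_derive_slice2 f (x y : R) : smooth f ->
  is_derive y 1 (fun s => f (x, s)) (partial true f (x, y)).
Proof.
move=> sf; have df : derivable f (x, y) (ebase true) by exact: smooth_derivable.
have E : (fun h : R => h^-1 *: (((fun s => f (x, s)) \o shift y) (h *: 1) - f (x, y))) =
   (fun h : R => h^-1 *: ((f \o shift (x, y)) (h *: ebase true) - f (x, y))).
  apply/funext => h /=; congr (_ *: (f _ - _)).
  by rewrite [RHS]surjective_pairing /= scaler0 add0r.
by split; rewrite /derivable /derive E.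
Qed.

(** Fubini, with the variable of differentiation integrated innermost: on each line the fundamental
    theorem of calculus gives 0, by compact support. *)
Lemma integ_partial Om phi i : test_fun Om phi -> integ Om (partial i phi) = 0.
Proof.
move=> tphi; have tp := test_fun_partial i tphi.
have [M1 M10 out1] := test_fun_box tphi.
have [M2 M20 out2] := test_fun_box tp.
pose M := Num.max M1 M2.
have M0 : 0 < M by rewrite lt_max M10.
have outM x : M <= `|x.1| \/ M <= `|x.2| -> phi x = 0 /\ partial i phi x = 0.
  move=> h; suff [] : ~ box (- M1, - M1) (M1, M1) x /\ ~ box (- M2, - M2) (M2, M2) x.
    by split; [exact: out1|exact: out2].
  move: h; rewrite /M !ge_max; split => /boxP[/= ? ? ? ?].
    by case: h => /andP[+ _]; rewrite leNgt ltr_norml => /negP; apply; apply/andP.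
  by case: h => /andP[_]; rewrite leNgt ltr_norml => /negP; apply; apply/andP.
have sphi := test_fun_smooth tphi.
have cp : continuous (partial i phi) := test_fun_continuous tp.
rewrite (integ_setT_test tp) /integ /Rintegral.
suff -> : (\int[mu]_x (partial i phi x)%:E = 0)%E by [].
have fi := integrable_test_fun tp.
case: i tp out2 outM cp fi => tp out2 outM cp fi.
- rewrite -(integral12_prod_meas1 fi) /=.
  rewrite integral0_eq// => x _.
  apply: (@integral_derive_compact_support (fun s => phi (x, s)) _ M) => //.
  + by move=> s; exact: is_derive_slice2.
  + move=> s; apply: (@continuous_comp _ _ _ (fun s => (x, s)) (partial true phi)).
      exact: (@cvg_pair _ _ _ _ _ _ _ _ _ (fun=> x) id (cvg_cst _) cvg_id).
    exact: cp.
  + by move=> s sM; have [] := outM (x, s) (or_intror sM).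
  + by move=> s sM; have [] := outM (x, s) (or_intror sM).
- rewrite -(integral21_prod_meas1 fi) /=.
  rewrite integral0_eq// => y _.
  apply: (@integral_derive_compact_support (fun s => phi (s, y)) _ M) => //.
  + by move=> s; exact: is_derive_slice1.
  + move=> s; apply: (@continuous_comp _ _ _ (fun s => (s, y)) (partial false phi)).
      exact: (@cvg_pair _ _ _ _ _ _ _ _ _ id (fun=> y) cvg_id (cvg_cst _)).
    exact: cp.
  + by move=> s sM; have [] := outM (s, y) (or_introl sM).
  + by move=> s sM; have [] := outM (s, y) (or_introl sM).
Qed.

Lemma integrable_compact_support1 (F : R -> R) (s t : R) :
  cinfty1 F -> (forall x, ~~ (s < x < t) -> F x = 0) ->
  lam.-integrable setT (EFin \o F).
Proof.
move=> cF F0.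
have -> : F = F \_ `[s, t].
  apply/funext => x; rewrite patchE; case: ifPn => // /negP nx; apply: F0.
  apply/negP => /andP[? ?]; apply: nx; rewrite inE /= in_itv /=.
  by apply/andP; split; exact: ltW.
rewrite -restrict_EFin.
apply: (iffLR (@integrable_mkcond _ _ _ lam `[s, t]%classic (EFin \o F) (measurable_itv _))).
apply: continuous_compact_integrable; first exact: segment_compact.
by apply: continuous_subspaceT; exact: (cdiff_continuous (cF 0%N)).
Qed.

Lemma integral_tensor (A B : R -> R) (a b : plane) :
  cinfty1 A -> cinfty1 B ->
  (forall s, ~~ (a.1 < s < b.1) -> A s = 0) ->
  (forall s, ~~ (a.2 < s < b.2) -> B s = 0) ->
  integ setT (fun x => A x.1 * B x.2) =
  (\int[lam]_s A s) * (\int[lam]_s B s).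
Proof.
move=> cA cB A0 B0.
have tAB : test_fun setT (fun x : plane => A x.1 * B x.2).
  exact: (test_fun_tensor (a := a) (b := b)).
have fi := integrable_test_fun tAB.
have Ai := integrable_compact_support1 cA A0; have Bi := integrable_compact_support1 cB B0.
rewrite /integ /Rintegral -(integral12_prod_meas1 fi) /=.
transitivity (fine (\int[lam]_x ((A x)%:E * (fine (\int[lam]_y (B y)%:E))%:E))%E).
  congr fine; apply: eq_integral => x _; rewrite /fubini_F /= fineK; last exact: (integrable_fin_num _ Bi).
  under eq_integral => y _ do rewrite EFinM.
  by rewrite integralZl.
transitivity (fine (\int[lam]_x (A x)%:E * (fine (\int[lam]_y (B y)%:E))%:E)%E).
  by congr fine; exact: (integralZr measurableT Ai).
rewrite fineM//; exact: (integrable_fin_num _ Ai).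
Qed.

(** The primitive vanishing at minus infinity is 0 to the left of a; to the right of b it equals the
    full integral of A, which is 0. *)
Lemma primitive_compact_support (A : R -> R) (a b : R) : cinfty1 A -> a < b ->
  (forall s, ~~ (a < s < b) -> A s = 0) -> \int[lam]_s A s = 0 ->
  exists P : R -> R, [/\ cinfty1 P, (forall s, ~~ (a < s < b) -> P s = 0) &
    forall s, 'D_1 P s = A s].
Proof.
move=> cA ab A0 IA.
have contA : continuous A := cdiff_continuous (cA 0%N).
have Ai (u : R) : lam.-integrable `]-oo, u] (EFin \o A).
  have AT := integrable_compact_support1 cA A0.
  exact: (integrableS (E := setT)).
pose P x := \int[lam]_(t in `]-oo, x]) A t.
have dP (x : R) : is_derive x 1 P (A x).
  have [|||dPx PE] := @continuous_FTC1 R A -oo%O x (x + 1) _ (Ai _).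
  - lra.
  - by rewrite ltNyr.
  - exact: contA.
  - by split; [exact: dPx|rewrite -derive1E; exact: PE].
exists P; split.
- move=> [|n]; last split.
  + move=> x; apply/differentiable_continuous/derivable1_diffP.
    by have [] := dP x.
  + move=> x; apply/differentiable_continuous/derivable1_diffP.
    by have [] := dP x.
  + move=> _; split; first by move=> x; have [] := dP x.
    by rewrite (_ : (fun x => _) = A)//; apply/funext => x; have [] := dP x.
- move=> s; rewrite negb_and -!leNgt => /orP[sa|bs].
    transitivity (\int[lam]_(t in `]-oo, s]) (0 : R)); last by rewrite Rintegral_cst// mul0r.
    apply: eq_Rintegral_on => t /=; rewrite in_itv /= => ts; apply: A0.
    by rewrite negb_and -leNgt (le_trans ts sa).
  rewrite -IA /P Rintegral_mkcond; congr Rintegral; apply/funext => t.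
  rewrite patchE; case: ifPn => // /negP nts; apply/esym/A0.
  rewrite negb_and -!leNgt; apply/orP; right; rewrite leNgt; apply/negP => tb.
  by apply: nts; rewrite inE /= in_itv /= ltW// (lt_le_trans tb bs).
- by move=> s; have [] := dP s.
Qed.

End TestFunctionIntegrals.

(** * Functions with zero weak gradient *)

Section LocallyConstant.
Context {R : realType}.
Local Notation plane := (R * R)%type.
Local Notation mplane := (measurableTypeR R * measurableTypeR R)%type.
Implicit Types (Om U : set plane) (f phi : plane -> R).
Local Notation mu := (@leb2 R).
Local Notation lam := (@lebesgue_measure R).

Lemma integrable_extend (D E : set mplane) f : measurable D -> measurable E -> D `<=` E ->
  (forall x, E x -> ~ D x -> f x = 0) ->
  mu.-integrable D (EFin \o f) -> mu.-integrable E (EFin \o f).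
Proof.
move=> mD mE DE f0 /(iffLR (integrable_mkcond _ mD)) fi.
apply/(integrable_mkcond _ mE); rewrite restrict_EFin.
rewrite (_ : f \_ E = f \_ D) -?restrict_EFin//.
apply/funext => x; rewrite !patchE.
have [/set_mem Dx|/negP nD] := boolP (x \in D); first by rewrite mem_set//; exact: DE.
by case: ifP => // /set_mem Ex; apply: f0 => // /mem_set.
Qed.

(** On the compact support of phi the function f is integrable and phi is bounded; elsewhere the
    product is 0. *)
Lemma integrable_mul_test Om f phi : open Om -> locally_integrable2 Om f ->
  test_fun Om phi -> mu.-integrable Om (EFin \o (fun x => f x * phi x)).
Proof.
move=> oOm [mf lf] tphi; have [_ cphi KOm] := tphi.
set K := closure _ in cphi KOm.
have mK : measurable (K : set mplane) by exact: compact_measurable2.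
have mOm := open_measurable2 oOm.
have [C C0 phiC] := test_fun_bounded tphi.
apply: (integrable_extend mK mOm KOm).
  move=> x _ nKx; have [->|phi0] := eqVneq (phi x) 0; first by rewrite mulr0.
  by exfalso; apply: nKx; exact: subset_closure.
have mfK : measurable_fun (K : set mplane) (f : mplane -> R) by exact: measurable_funS mf.
apply: (@eq_integrable_on _ mplane _ mu K mK (fun x => phi x * f x)); first by move=> x _; rewrite mulrC.
apply: (@integrable_bounded_mul _ mplane _ mu K mK phi C) => //.
  by apply: continuous_measurable_fun2; exact: test_fun_continuous tphi.
by apply/integrableP; split; [exact/measurable_EFinP|exact: lf].
Qed.

Lemma integral_bump_neq0 (a b : R) : a < b -> \int[lam]_s bump 0 a b s != 0.
Proof.
move=> ab; apply/negP => /eqP I0.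
have ib : lam.-integrable setT (EFin \o bump 0 a b).
  by apply: (@integrable_compact_support1 _ _ a b); [exact: cinfty1_bump|exact: bump_out].
have := Rintegral_eq0_ae measurableT ib (fun x _ => bump_ge0 0 a b x) I0.
move=> [N [mN N0 sub]].
have abN : `]a, b[ `<=` N.
  move=> s; rewrite /= in_itv /= => sab; apply: sub => /= /(_ I) b0.
  by have := bump_gt0 0 sab; rewrite b0 ltxx.
have : (lam `]a, b[ <= lam N)%E by apply: le_measure => //; rewrite inE.
rewrite N0 lebesgue_measure_itv /= lte_fin ab -EFinB lee_fin; lra.
Qed.

(* A one-variable test function A of integral 0 is a derivative, so that the
   integral of f(x, y) A(x) B(y) vanishes; for general A and B it is thus
   proportional to the product of the integrals of A and B. *)
Lemma ae_cst_box Om f a b : open Om -> locally_integrable2 Om f ->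
  (forall phi, test_fun Om phi -> forall i, integ Om (fun x => f x * partial i phi x) = 0) ->
  cbox a b `<=` Om -> a.1 < b.1 -> a.2 < b.2 ->
  exists c, {ae mu, forall x, box a b x -> f x = c}.
Proof.
move=> oOm lf f0 abOm ab1 ab2; have mOm := open_measurable2 oOm.
pose supp1 (A : R -> R) := cinfty1 A /\ forall s, ~~ (a.1 < s < b.1) -> A s = 0.
pose supp2 (B : R -> R) := cinfty1 B /\ forall s, ~~ (a.2 < s < b.2) -> B s = 0.
pose J (A B : R -> R) := integ Om (fun x => f x * (A x.1 * B x.2)).
have tAB A B : supp1 A -> supp2 B -> test_fun Om (fun x => A x.1 * B x.2).
  by move=> [cA A0] [cB B0]; exact: (test_fun_tensor abOm).
have Jint A B (sA : supp1 A) (sB : supp2 B) := integrable_mul_test oOm lf (tAB A B sA sB).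
have J10 A B : supp1 A -> supp2 B -> \int[lam]_s A s = 0 -> J A B = 0.
  move=> [cA A0] sB IA; have [P [cP P0 dP]] := primitive_compact_support cA ab1 A0 IA.
  rewrite /J -(f0 _ (tAB P B (conj cP P0) sB) false); apply: eq_Rintegral_on => x _.
  by have [-> _] := partial_tensor x cP sB.1; rewrite dP.
have J20 A B : supp1 A -> supp2 B -> \int[lam]_s B s = 0 -> J A B = 0.
  move=> sA [cB B0] IB; have [P [cP P0 dP]] := primitive_compact_support cB ab2 B0 IB.
  rewrite /J -(f0 _ (tAB A P sA (conj cP P0)) true); apply: eq_Rintegral_on => x _.
  by have [_ ->] := partial_tensor x sA.1 cP; rewrite dP.
pose E1 := bump 0 a.1 b.1; pose E2 := bump 0 a.2 b.2.
have sE1 : supp1 E1 by split; [exact: cinfty1_bump|exact: bump_out].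
have sE2 : supp2 E2 by split; [exact: cinfty1_bump|exact: bump_out].
have m1 : \int[lam]_s E1 s != 0 by exact: integral_bump_neq0.
have m2 : \int[lam]_s E2 s != 0 by exact: integral_bump_neq0.
set k1 := \int[lam]_s E1 s in m1; set k2 := \int[lam]_s E2 s in m2.
have cinftyBZ (A E : R -> R) (k : R) : cinfty1 A -> cinfty1 E -> cinfty1 (fun s => A s + (- k) * E s).
  by move=> cA cE n; apply: cdiffD => //; apply: cdiffZ.
have intBZ (A E : R -> R) (s t k : R) : cinfty1 A -> cinfty1 E ->
    (forall x, ~~ (s < x < t) -> A x = 0) -> (forall x, ~~ (s < x < t) -> E x = 0) ->
    \int[lam]_s (A s + (- k) * E s) = \int[lam]_s A s - k * \int[lam]_s E s.
  move=> cA cE A0 E0.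
  have Ai := integrable_compact_support1 cA A0; have Ei := integrable_compact_support1 cE E0.
  rewrite RintegralD//; last exact: integrable_scalel.
  by rewrite RintegralZl// mulNr.
(* Subtracting from A the multiple of the fixed bump [E1] with the same integral leaves a function
   of zero integral, to which [J10] applies. *)
have J1 A B : supp1 A -> supp2 B -> J A B = (\int[lam]_s A s / k1) * J E1 B.
  move=> sA sB; set k := _ / k1.
  have sA' : supp1 (fun s => A s + (- k) * E1 s).
    split; first by apply: cinftyBZ; [exact: sA.1|exact: sE1.1].
    by move=> s ns; rewrite sA.2// sE1.2// mulr0 addr0.
  have := J10 _ _ sA' sB; rewrite (intBZ _ _ a.1 b.1 _ sA.1 sE1.1 sA.2 sE1.2).
  rewrite -/k1 /k (divfK m1) subrr => /(_ erefl) J0.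
  have : J A B - k * J E1 B = 0; last by move=> /eqP; rewrite subr_eq0 => /eqP.
  rewrite -J0 /J /integ -RintegralZl//; last exact: (Jint _ _ sE1 sB).
  rewrite -RintegralB//; last 2 first.
    exact: (Jint _ _ sA sB).
    by apply: integrable_scalel => //; exact: (Jint _ _ sE1 sB).
  by apply: eq_Rintegral_on => x _; rewrite -/k; ring.
have J2 A B : supp1 A -> supp2 B -> J A B = (\int[lam]_s B s / k2) * J A E2.
  move=> sA sB; set k := _ / k2.
  have sB' : supp2 (fun s => B s + (- k) * E2 s).
    split; first by apply: cinftyBZ; [exact: sB.1|exact: sE2.1].
    by move=> s ns; rewrite sB.2// sE2.2// mulr0 addr0.
  have := J20 _ _ sA sB'; rewrite (intBZ _ _ a.2 b.2 _ sB.1 sE2.1 sB.2 sE2.2).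
  rewrite -/k2 /k (divfK m2) subrr => /(_ erefl) J0.
  have : J A B - k * J A E2 = 0; last by move=> /eqP; rewrite subr_eq0 => /eqP.
  rewrite -J0 /J /integ -RintegralZl//; last exact: (Jint _ _ sA sE2).
  rewrite -RintegralB//; last 2 first.
    exact: (Jint _ _ sA sB).
    by apply: integrable_scalel => //; exact: (Jint _ _ sA sE2).
  by apply: eq_Rintegral_on => x _; rewrite -/k; ring.
have alg (x y j p q : R) : p != 0 -> q != 0 -> x / p * (y / q * j) - j / (p * q) * (x * y) = 0.
  by move=> ? ?; field; apply/andP.
(* [J1] followed by [J2] gives J A B = c (int A)(int B), so f - c is orthogonal to all tensor
   products, in particular to the bumps of the smaller boxes. *)
pose c := J E1 E2 / (k1 * k2); exists c.
have JE A B : supp1 A -> supp2 B -> integ Om (fun x => (f x - c) * (A x.1 * B x.2)) = 0.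
  move=> sA sB; have tt := tAB _ _ sA sB.
  transitivity (J A B - c * integ Om (fun x => A x.1 * B x.2)).
    have ti : mu.-integrable Om (EFin \o (fun x : plane => A x.1 * B x.2)).
      by apply: integrableS (integrable_test_fun tt).
    rewrite /integ -RintegralZl// -RintegralB//; last 2 first.
      exact: Jint.
      by apply: integrable_scalel.
    by apply: eq_Rintegral_on => x _; ring.
  rewrite (integ_setT_test tt) (integral_tensor sA.1 sB.1 sA.2 sB.2).
  rewrite (J1 A B sA sB) (J2 E1 B sE1 sB) /c; exact: alg.
have fi : mu.-integrable (box a b) (EFin \o (fun x => f x - c)).
  apply: integrable_subr => //; first exact: measurable_box. exact: integrable_box_of_locally_integrable lf _ _.
  apply: measurable_bounded_integrable => //; first exact: measurable_box.
    by rewrite leb2_box ?ltry//; exact: ltW.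
  exists `|c|; split; first exact: num_real.
  by move=> y cy x _; exact: ltW.
have : {ae mu, forall x, box a b x -> f x - c = 0}.
  apply: box_bump_ae0 => // p q pqab pq1 pq2 n.
  have pqc := box_sub_cbox pqab pq1 pq2.
  have /cboxP[ap1 _ ap2 _] : cbox a b p by apply: pqc; apply/cboxP; split => //; exact: ltW.
  have /cboxP[_ qb1 _ qb2] : cbox a b q by apply: pqc; apply/cboxP; split => //; exact: ltW.
  have s1 : supp1 (bump n p.1 q.1).
    split; first exact: cinfty1_bump.
    move=> s ns; apply: bump_out; apply: contra ns => /andP[ps sq].
    by rewrite (le_lt_trans ap1 ps) (lt_le_trans sq qb1).
  have s2 : supp2 (bump n p.2 q.2).
    split; first exact: cinfty1_bump.
    move=> s ns; apply: bump_out; apply: contra ns => /andP[ps sq].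
    by rewrite (le_lt_trans ap2 ps) (lt_le_trans sq qb2).
  rewrite -(JE _ _ s1 s2); apply/esym/integ_out.
    by apply: subset_trans abOm; apply: subset_trans pqab _; exact: box_cbox.
  by move=> x nx; have := box_bump_out n nx; rewrite /box_bump => ->; rewrite mulr0.
by apply: ae_imp => x h /h /eqP; rewrite subr_eq0 => /eqP.
Qed.

(** A neighbourhood contains a box of positive measure, so it is not null. The proposition P does
    not depend on the point: it will be an equality of two constants, or [False]. *)
Lemma ae_open_nonempty U (P : Prop) (x : plane) : nbhs x U ->
  {ae mu, forall y, U y -> P} -> P.
Proof.
move=> xU aeP; apply: contrapT => nP.
have [a [b [xab abU]]] := nbhs_cbox xU.
have /boxP[h1 h2 h3 h4] := nbhs_singleton xab.
move: aeP => [N [mN N0 sub]].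
have abN : box a b `<=` N.
  move=> y /box_cbox/abU Uy; apply: sub => /= h; apply: nP; exact: h.
have : (mu (box a b) <= mu N)%E.
  by apply: le_measure; rewrite ?inE//; exact: measurable_box.
rewrite N0 leb2_box; [|lra..].
by rewrite lee_fin leNgt mulr_gt0// subr_gt0; lra.
Qed.

(** The sets [L c] of points near which f = c almost everywhere are open, pairwise disjoint, and
    cover [Om] by [ae_cst_box]; connectedness leaves only one of them in [Om]. *)
Lemma ae_cst_connected Om f : open Om -> connected Om -> Om !=set0 ->
  locally_integrable2 Om f ->
  (forall phi, test_fun Om phi -> forall i, integ Om (fun x => f x * partial i phi x) = 0) ->
  exists c, {ae mu, forall x, Om x -> f x = c}.
Proof.
move=> oOm cOm [x0 Omx0] lf f0.
pose L (c : R) (x : plane) := exists U : set plane, nbhs x U /\ {ae mu, forall y, U y -> f y = c}.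
have LP (x : plane) : Om x -> exists c, L c x.
  move=> Omx; have [a [b [xab abOm]]] := nbhs_cbox (open_nbhs_nbhs (conj oOm Omx)).
  have /boxP[h1 h2 h3 h4] := nbhs_singleton xab.
  have [||c fc] := ae_cst_box oOm lf f0 abOm; [lra|lra|].
  by exists c, (box a b).
have Lopen c : open (L c).
  rewrite openE => x [U [xU aeU]]; have [a [b [xab abU]]] := nbhs_cbox xU.
  rewrite /interior; apply: filterS xab => y yab; exists (box a b); split.
    by apply: open_nbhs_nbhs; split => //; exact: open_box.
  by apply: ae_imp aeU => z h /box_cbox/abU/h.
have Luniq c c' (x : plane) : L c x -> L c' x -> c = c'.
  move=> [U [xU aeU]] [V [xV aeV]]; apply: (@ae_open_nonempty (U `&` V) _ x).
    exact: filterI.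
  by apply: ae_imp2 aeU aeV => y hU hV [/hU <- /hV <-].
have [c Lc0] := LP x0 Omx0; exists c.
have OmL : Om `&` L c = Om.
  apply: cOm; first by exists x0.
    by exists (L c).
  exists (~` \bigcup_(c' in [set c' | c' != c]) L c').
    by apply: open_closedC; apply: bigcup_open => c' _.
  apply/seteqP; split => x [Omx]; last first.
    move=> nLx; split => //; have [c' Lc'] := LP x Omx.
    have [<-//|c'c] := eqVneq c' c; exfalso; apply: nLx; by exists c'.
  by move=> Lcx; split => // -[c' /= c'c Lc']; move: c'c; rewrite (Luniq _ _ _ Lc' Lcx) eqxx.
apply: (@ae_bigcup_ratbox _ (fun B => exists2 U, B `<=` U & {ae mu, forall y, U y -> f y = c})).
  rewrite -{1}OmL => x [_ [U [xU aeU]]]; exists U => // B BU; by exists U.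
by move=> q [U qU]; apply: ae_imp => x h /qU/h.
Qed.

End LocallyConstant.

(** * Lebesgue norms *)

Section LpBridge.
Context {R : realType}.
Local Notation plane := (R * R)%type.
Local Notation mplane := (measurableTypeR R * measurableTypeR R)%type.
Local Notation mu := (@leb2 R).
Variables (Om : set plane) (mOm : measurable (Om : set mplane)).
Implicit Types (f g h : plane -> R) (u v : plane -> plane).

Lemma LpnormE f (p : R) : p != 0 ->
  Lpnorm Om p%:E f = ((\int[mu]_(x in Om) (`|f x| `^ p)%:E) `^ p^-1)%E.
Proof.
move=> p0; rewrite /Lpnorm unlock; apply: (congr1 (fun X => X `^ p^-1)%E).
rewrite [RHS]integral_mkcond; apply: eq_integral => x _ /=.
rewrite !patchE; case: ifPn => _ //=.
by rewrite normr0 powR0.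
Qed.

Lemma LpP f p : Lp Om p f <-> measurable_fun Om (f : mplane -> R) /\ (Lpnorm Om p f < +oo)%E.
Proof.
rewrite /Lp inE; split.
  move=> /andP[]; rewrite !inE /= => mf nf; split => //.
  exact/(measurable_restrictT _ mOm).
move=> [mf nf]; apply/andP; split; rewrite inE //=.
exact/(measurable_restrictT _ mOm).
Qed.

Lemma Lp_sqint f : Lp Om 2%:E f <-> sqint mu Om f.
Proof.
split=> [/LpP[mf]|[mf /integrableP[_ fi]]].
  rewrite LpnormE ?pnatr_eq0// => nf; split => //; apply/integrableP; split.
    by apply/measurable_EFinP; exact: measurable_funX.
  rewrite (@lty_poweRy _ _ 2^-1)//; apply: le_lt_trans nf.
  rewrite le_eqVlt; apply/orP; left; apply/eqP; congr (_ `^ _)%E.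
  by apply: eq_integral => x _ /=; rewrite powR_mulrn// normrX.
apply/LpP; split => //; rewrite LpnormE ?pnatr_eq0//; apply: poweR_lty.
apply: le_lt_trans fi; rewrite le_eqVlt; apply/orP; left; apply/eqP.
by apply: eq_integral => x _ /=; rewrite powR_mulrn// normrX.
Qed.

Lemma Lpnorm_sqint f : sqint mu Om f ->
  Lpnorm Om 2%:E f = (Num.sqrt (integ Om (fun x => f x ^+ 2)))%:E.
Proof.
move=> [mf fi]; rewrite LpnormE ?pnatr_eq0//.
transitivity ((\int[mu]_(x in Om) (f x ^+ 2)%:E) `^ 2^-1)%E.
  congr (_ `^ _)%E; apply: eq_integral => x _ /=.
  by rewrite powR_mulrn// -normrX ger0_norm// sqr_ge0.
have If := integrable_fin_num mOm fi.
rewrite -[X in (X `^ _)%E]fineK// poweR_EFin powR12_sqrt//.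
by apply: Rintegral_ge0 => x _; exact: sqr_ge0.
Qed.

Lemma Lp2_sqint2 u : Lp2 Om 2%:E u <-> sqint2 mu Om u.
Proof. by split=> [[/Lp_sqint ? /Lp_sqint ?]|[/Lp_sqint ? /Lp_sqint ?]]. Qed.

Lemma enorm_ge0 (x : plane) : 0 <= enorm x. Proof. exact: sqrtr_ge0. Qed.

Lemma enorm_sqr (x : plane) : enorm x ^+ 2 = dot x x.
Proof. by rewrite sqr_sqrtr// dot_ge0. Qed.

Lemma measurable_dot u v : measurable_fun Om (fst \o u : mplane -> R) ->
  measurable_fun Om (snd \o u : mplane -> R) ->
  measurable_fun Om (fst \o v : mplane -> R) ->
  measurable_fun Om (snd \o v : mplane -> R) ->
  measurable_fun Om ((fun x => dot (u x) (v x)) : mplane -> R).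
Proof. by move=> *; apply: measurable_funD; apply: measurable_funM. Qed.

Lemma measurable_enorm u : measurable_fun Om (fst \o u : mplane -> R) ->
  measurable_fun Om (snd \o u : mplane -> R) ->
  measurable_fun Om (enorm \o u : mplane -> R).
Proof.
move=> m1 m2; apply: (@measurableT_comp _ _ _ _ _ _ (@Num.sqrt R)).
  by apply: continuous_measurable_fun; exact: sqrt_continuous.
exact: measurable_dot.
Qed.

Lemma sqint_enorm u : sqint2 mu Om u -> sqint mu Om (enorm \o u).
Proof.
move=> su; have [[m1 _] [m2 _]] := su; split; first exact: measurable_enorm.
apply: (eq_integrable_on mOm (f := fun x => dot (u x) (u x))) => [x _|].
  by rewrite /= enorm_sqr.
exact: sqint2_dot.
Qed.

Lemma Lpnorm2_nrm u : sqint2 mu Om u -> Lpnorm2 Om 2%:E u = (nrm mu Om u)%:E.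
Proof.
move=> su; rewrite /Lpnorm2 Lpnorm_sqint; last exact: sqint_enorm.
congr (Num.sqrt _)%:E; apply: eq_Rintegral_on => x _; exact: enorm_sqr.
Qed.

(** The L^oo norm unfolds to an essential supremum only over a space of positive measure. *)
Lemma leb2_setT_gt0 : (0 < mu setT)%E.
Proof.
apply: (@lt_le_trans _ _ (mu (box (0, 0) (1, 1)))).
  by rewrite leb2_box /= ?ler01// lte_fin subr0 mulr1.
by apply: le_measure; rewrite ?inE//; exact: measurable_box.
Qed.

Lemma Lpnorm_oo_ae f : (Lpnorm Om +oo%E f < +oo)%E ->
  {ae mu, forall x, Om x -> `|f x| <= fine (Lpnorm Om +oo%E f)}.
Proof.
move=> nf; have N0 : (0 <= Lpnorm Om +oo%E f)%E by exact: Lnorm_ge0.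
have NE : Lpnorm Om +oo%E f = (fine (Lpnorm Om +oo%E f))%:E.
  by rewrite fineK// ge0_fin_numE.
have : {ae mu, forall x, (abse \o (EFin \o (f \_ Om))) x <= Lpnorm Om +oo%E f}%E.
  apply/ess_supP; rewrite /Lpnorm unlock /Lnorm leb2_setT_gt0; exact: lexx.
apply: ae_imp => x; rewrite {1}NE /= lee_fin => fx Omx.
by move: fx; rewrite patchE mem_set.
Qed.

Lemma Lpnorm_oo_lty f M : {ae mu, forall x, Om x -> `|f x| <= M} -> 0 <= M ->
  (Lpnorm Om +oo%E f < +oo)%E.
Proof.
move=> fM M0; apply: (@le_lt_trans _ _ M%:E); last exact: ltry.
rewrite /Lpnorm unlock /Lnorm leb2_setT_gt0; apply/ess_supP.
apply: ae_imp fM => x fM /=; rewrite lee_fin patchE.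
by case: ifPn => [/set_mem/fM //|_]; rewrite normr0.
Qed.

Lemma enorm_le_sum (x : plane) : enorm x <= `|x.1| + `|x.2|.
Proof.
rewrite -[leRHS]ger0_norm ?addr_ge0// -sqrtr_sqr ler_sqrt ?sqr_ge0//.
rewrite /dot -!expr2 -[x.1 ^+ 2]real_normK ?num_real// -[x.2 ^+ 2]real_normK ?num_real//.
by have := normr_ge0 x.1; have := normr_ge0 x.2; nra.
Qed.

Lemma Lpnorm2_oo_lty u : Lp2 Om +oo%E u -> (Lpnorm2 Om +oo%E u < +oo)%E.
Proof.
move=> [/LpP[m1 n1] /LpP[m2 n2]].
apply: (@Lpnorm_oo_lty _ (fine (Lpnorm Om +oo%E (fst \o u)) + fine (Lpnorm Om +oo%E (snd \o u)))).
  apply: ae_imp2 (Lpnorm_oo_ae n1) (Lpnorm_oo_ae n2) => x h1 h2 Omx /=.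
  rewrite ger0_norm ?enorm_ge0// (le_trans (enorm_le_sum _))//.
  by apply: lerD; [exact: h1|exact: h2].
by rewrite addr_ge0// fine_ge0// Lnorm_ge0.
Qed.

Lemma Lpnorm2_lty u (r : R) : 0 < r -> Lp2 Om r%:E u -> (Lpnorm2 Om r%:E u < +oo)%E.
Proof.
move=> r0 [/LpP[m1 n1] /LpP[m2 n2]].
have rn0 : r != 0 by rewrite gt_eqF.
have pint f : measurable_fun Om (f : mplane -> R) -> (Lpnorm Om r%:E f < +oo)%E ->
    mu.-integrable Om (EFin \o (fun x => `|f x| `^ r)).
  move=> mf; rewrite LpnormE// => nf; apply/integrableP; split.
    apply/measurable_EFinP; apply: (measurableT_comp (measurable_powR _)).
    exact: measurableT_comp.
  rewrite (@lty_poweRy _ _ r^-1) ?invr_eq0//; apply: le_lt_trans nf.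
  rewrite le_eqVlt; apply/orP; left; apply/eqP; congr (_ `^ _)%E.
  by apply: eq_integral => x _ /=; rewrite ger0_norm// powR_ge0.
have me := measurable_enorm m1 m2.
have mp : measurable_fun Om ((fun x => `|enorm (u x)| `^ r) : mplane -> R).
  by apply: (measurableT_comp (measurable_powR _)); exact: measurableT_comp.
rewrite /Lpnorm2 LpnormE//; apply: poweR_lty.
have : mu.-integrable Om (EFin \o (fun x => `|enorm (u x)| `^ r)).
  apply: (integrable_le mOm (g := fun x => 2 `^ r * (`|(fst \o u) x| `^ r + `|(snd \o u) x| `^ r))) => //.
    move=> x _; rewrite ger0_norm ?powR_ge0// (ger0_norm (enorm_ge0 _)).
    (* Passing through the maximum replaces a convexity inequality for powers: the r-th power of a
       maximum is at most the sum of the r-th powers. *)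
    apply: (@le_trans _ _ ((2 * Num.max `|(u x).1| `|(u x).2|) `^ r)).
      apply: ge0_ler_powR; rewrite ?nnegrE ?enorm_ge0 ?mulr_ge0 ?le_max ?normr_ge0//.
        exact: ltW.
      rewrite (le_trans (enorm_le_sum _))// mulr2n mulrDl mul1r.
      by apply: lerD; rewrite le_max lexx ?orbT.
    rewrite powRM ?le_max ?normr_ge0// ler_wpM2l ?powR_ge0//.
    by case: (leP `|(u x).1|) => _ /=; rewrite ?lerDl ?lerDr powR_ge0.
  by apply: integrable_scalel => //; apply: integrable_addr => //; exact: pint.
move=> /integrableP[_]; apply: le_lt_trans.
rewrite le_eqVlt; apply/orP; left; apply/eqP; apply: eq_integral => x _ /=.
by rewrite [in RHS]ger0_norm// powR_ge0.
Qed.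

Lemma poweR2 (x : \bar R) : (0 <= x)%E -> (x `^ 2 = x * x)%E.
Proof.
case: x => [s| |] //; last by rewrite poweRyr// mulyy.
by rewrite lee_fin => s0; rewrite poweR_EFin powR_mulrn// expr2 EFinM.
Qed.

Lemma Lnorm_sqr (F : mplane -> R) (q : R) : 0 < q ->
  ('N[mu]_q%:E[EFin \o (fun x => F x ^+ 2)%R] =
   'N[mu]_(2 * q)%:E[EFin \o F] * 'N[mu]_(2 * q)%:E[EFin \o F])%E.
Proof.
move=> q0; rewrite -poweR2 ?Lnorm_ge0// unlock /= -poweRrM.
rewrite (_ : (2 * q)^-1 * 2 = q^-1); last by field; rewrite gt_eqF.
apply: (congr1 (fun X => X `^ q^-1)%E); apply: eq_integral => x _ /=; congr (_%:E).
by rewrite normrX -powR_mulrn// -powRrM.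
Qed.

(** Hoelder's inequality for F^2 and G^2 with the conjugate exponents p/2 and r/2, rewritten by
    [Lnorm_sqr]. *)
Lemma hoelder_sqr (F G : mplane -> R) (p r : R) :
  measurable_fun setT F -> measurable_fun setT G -> 0 < p -> 0 < r ->
  2 / p + 2 / r = 1 ->
  (\int[mu]_x (F x ^+ 2 * G x ^+ 2)%:E <=
   ('N[mu]_p%:E[EFin \o F] * 'N[mu]_p%:E[EFin \o F]) *
   ('N[mu]_r%:E[EFin \o G] * 'N[mu]_r%:E[EFin \o G]))%E.
Proof.
move=> mF mG p0 r0 pr.
have p2 : 0 < p / 2 by rewrite divr_gt0.
have r2 : 0 < r / 2 by rewrite divr_gt0.
have := @hoelder _ mplane R mu (fun x => F x ^+ 2) (fun x => G x ^+ 2) (p / 2) (r / 2)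
  (measurable_funX _ mF) (measurable_funX _ mG) p2 r2.
rewrite !invf_div pr => /(_ erefl).
rewrite !Lnorm_sqr// !(mulrC 2) !divfK// Lnorm1; apply: le_trans.
rewrite le_eqVlt; apply/orP; left; apply/eqP; apply: eq_integral => x _ /=.
by rewrite ger0_norm// mulr_ge0// sqr_ge0.
Qed.

(** Made for (nu(T1) - nu(T)) u1, with c the Lipschitz constant and f the temperature difference. P
    and U are real upper bounds of the two norms, so that the result is an inequality between
    reals. *)
Lemma nrm_hoelder h f u (p r c P U : R) : 0 <= c -> 0 <= P -> 0 <= U ->
  0 < p -> 0 < r -> 2 / p + 2 / r = 1 ->
  measurable_fun Om (f : mplane -> R) -> sqint2 mu Om (fun x => h x *: u x) ->
  measurable_fun Om (fst \o u : mplane -> R) -> measurable_fun Om (snd \o u : mplane -> R) ->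
  (forall x, Om x -> `|h x| <= c * `|f x|) ->
  (Lpnorm Om p%:E f <= P%:E)%E -> (Lpnorm2 Om r%:E u <= U%:E)%E ->
  nrm mu Om (fun x => h x *: u x) <= c * P * U.
Proof.
move=> c0 P0 U0 p0 r0 pr mf shu m1 m2 hf fP uU.
pose F : mplane -> R := f \_ Om; pose G : mplane -> R := (enorm \o u) \_ Om.
have mF : measurable_fun setT F by exact/(measurable_restrictT _ mOm).
have mG : measurable_fun setT G.
  by apply/(measurable_restrictT _ mOm); exact: measurable_enorm.
have := hoelder_sqr mF mG p0 r0 pr.
rewrite -/(Lpnorm Om p%:E f) -[X in (_ <= _ * (X * _))%E]/(Lpnorm2 Om r%:E u).
rewrite -[X in (_ <= _ * (_ * X))%E]/(Lpnorm2 Om r%:E u) => FG.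
have {}FG : (\int[mu]_x (F x ^+ 2 * G x ^+ 2)%:E <= (P ^+ 2 * U ^+ 2)%:E)%E.
  apply: le_trans FG _; rewrite EFinM !expr2 !EFinM.
  by apply: lee_pmul; rewrite ?mule_ge0 ?Lnorm_ge0//; apply: lee_pmul; rewrite ?Lnorm_ge0.
have di := sqint2_dot mOm shu shu.
have le1 : (\int[mu]_(x in Om) (dot (h x *: u x) (h x *: u x))%:E <=
    (c ^+ 2)%:E * \int[mu]_x (F x ^+ 2 * G x ^+ 2)%:E)%E.
  rewrite integral_mkcond -ge0_integralZl//; last 3 first.
  - apply/measurable_EFinP; apply: measurable_funM; exact: measurable_funX.
  - by move=> x _; rewrite lee_fin mulr_ge0 ?sqr_ge0.
  - by rewrite lee_fin sqr_ge0.
  apply: ge0_le_integral => //.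
  - by move=> x _; apply: erestrict_ge0 => y _; rewrite lee_fin dot_ge0.
  - apply/(measurable_restrictT _ mOm); exact: (measurable_int _ di).
  - apply/measurable_EFinP; apply: measurable_funM => //.
    by apply: measurable_funM; exact: measurable_funX.
  - move=> x _; rewrite /F /G !patchE; case: ifPn => [/set_mem Omx|_].
      rewrite -EFinM lee_fin /= enorm_sqr.
      have -> : dot (h x *: u x) (h x *: u x) = h x ^+ 2 * dot (u x) (u x).
        by rewrite /dot /= /GRing.scale /=; ring.
      rewrite mulrA ler_wpM2r ?dot_ge0// -exprMn.
      rewrite -[h x ^+ 2]real_normK ?num_real// -[_ ^+ 2 in leRHS]real_normK ?num_real//.
      rewrite ler_pXn2r ?nnegrE// normrM (ger0_norm c0); exact: hf.
    by rewrite lee_fin mulr_ge0 ?sqr_ge0// mulr_ge0 ?sqr_ge0.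
rewrite -(ler_pXn2r (n := 2)) ?nnegrE ?nrm_ge0 ?mulr_ge0// nrm_sqr.
rewrite -lee_fin /Rintegral fineK; last exact: (integrable_fin_num mOm di).
apply: (le_trans le1); rewrite -mulrA !exprMn [leRHS]EFinM.
by apply: lee_pmul => //; [rewrite lee_fin sqr_ge0|apply: integral_ge0 => x _; rewrite lee_fin mulr_ge0 ?sqr_ge0].
Qed.

End LpBridge.

(** * Weak derivatives and function spaces *)

Section WeakDerivatives.
Context {R : realType}.
Local Notation plane := (R * R)%type.
Local Notation mplane := (measurableTypeR R * measurableTypeR R)%type.
Local Notation mu := (@leb2 R).
Variables (Om : set plane) (oOm : open Om).
Implicit Types (f g h phi psi : plane -> R) (u v : plane -> plane).

Let mOm : measurable (Om : set mplane) := open_measurable2 oOm.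

Local Notation loc f := (locally_integrable2 Om f).

Lemma locP f : loc f <-> measurable_fun Om (f : mplane -> R) /\
  forall K : set plane, compact K -> K `<=` Om -> mu.-integrable K (EFin \o f).
Proof.
split=> [[mf lf]|[mf lf]]; split => // K cK KOm.
  apply/integrableP; split; last exact: lf.
  by apply/measurable_EFinP; apply: measurable_funS mf.
by have /integrableP[] := lf K cK KOm.
Qed.

Lemma loc_measurable f : loc f -> measurable_fun Om (f : mplane -> R).
Proof. by case. Qed.

Lemma loc_add f g : loc f -> loc g -> loc (fun x => f x + g x).
Proof.
move=> /locP[mf lf] /locP[mg lg]; apply/locP; split; first exact: measurable_funD.
move=> K cK KOm; apply: integrable_addr; [exact: compact_measurable2|exact: lf|exact: lg].
Qed.

Lemma loc_sub f g : loc f -> loc g -> loc (fun x => f x - g x).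
Proof.
move=> /locP[mf lf] /locP[mg lg]; apply/locP; split; first exact: measurable_funB.
move=> K cK KOm; apply: integrable_subr; [exact: compact_measurable2|exact: lf|exact: lg].
Qed.

Lemma loc_test_mul f phi : loc f -> test_fun Om phi -> loc (fun x => f x * phi x).
Proof.
move=> lf tphi; have fi := integrable_mul_test oOm lf tphi.
apply/locP; split; first exact: integrable_measurable_fun fi.
move=> K cK KOm; apply: integrableS fi => //; exact: compact_measurable2.
Qed.

Lemma compact_leb2_fin (K : set plane) : compact K -> (mu (K : set mplane) < +oo)%E.
Proof.
move=> cK; apply: bounded_leb2_fin; first exact: compact_bounded.
exact: compact_measurable2.
Qed.

Lemma loc_continuous f : continuous f -> loc f.
Proof.
move=> cf; apply/locP; split; first exact: continuous_measurable_fun2.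
move=> K cK KOm; apply: measurable_bounded_integrable.
- exact: compact_measurable2.
- exact: compact_leb2_fin.
- exact: continuous_measurable_fun2.
- have := compact_bounded (continuous_compact (continuous_subspaceT cf) cK).
  move=> [M [Mr MK]]; exists M; split => // y My x Kx.
  by apply: MK My _ _; exists x.
Qed.

Lemma loc_test phi : test_fun Om phi -> loc phi.
Proof. by move=> /test_fun_continuous; exact: loc_continuous. Qed.

Lemma loc_sqint f : sqint mu Om f -> loc f.
Proof.
move=> [mf fi]; apply/locP; split => // K cK KOm.
have mK : measurable (K : set mplane) by exact: compact_measurable2.
apply: (sqint_int mK (compact_leb2_fin cK)); split; first exact: measurable_funS mf.
exact: integrableS fi.
Qed.

Lemma ae_eq_of_test f g : loc f -> loc g ->
  (forall phi, test_fun Om phi ->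
    integ Om (fun x => f x * phi x) = integ Om (fun x => g x * phi x)) ->
  ae_eq_on Om f g.
Proof.
move=> lf lg fg.
have : {ae mu, forall x, Om x -> f x - g x = 0}.
  apply: ae0_of_test_fun => //; first exact: loc_sub.
  move=> phi tphi; transitivity (integ Om (fun x => f x * phi x) - integ Om (fun x => g x * phi x)).
    rewrite /integ -RintegralB//; try exact: integrable_mul_test.
    by apply: eq_Rintegral_on => x _; ring.
  by rewrite fg// subrr.
by apply: ae_imp => x h Omx; apply/eqP; rewrite -subr_eq0 h.
Qed.

Definition coord (i : bool) u : plane -> R := if i then snd \o u else fst \o u.

Lemma dot_ebase u i x : dot (u x) (ebase i) = coord i u x.
Proof. by case: i; rewrite /dot /ebase /coord /=; ring. Qed.

Lemma weak_gradP f u : is_weak_grad Om f u <->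
  [/\ loc f, forall i, loc (coord i u) & forall phi, test_fun Om phi -> forall i,
     integ Om (fun x => f x * partial i phi x) =
     - integ Om (fun x => coord i u x * phi x)].
Proof.
split=> [[lf l1 l2 fu]|[lf lu fu]].
  split => //; first by case.
  move=> phi tphi i; rewrite fu//; congr (- _); apply: eq_Rintegral_on => x _.
  by rewrite dot_ebase.
split => //; [exact: (lu false)|exact: (lu true)|].
move=> phi tphi i; rewrite fu//; congr (- _); apply: eq_Rintegral_on => x _.
by rewrite dot_ebase.
Qed.

Lemma ae_eq_comp u v : (forall i, ae_eq_on Om (coord i u) (coord i v)) -> ae_eq_on Om u v.
Proof.
move=> h; apply: ae_imp2 (h false) (h true) => x h1 h2 Omx.
by rewrite [LHS]surjective_pairing [RHS]surjective_pairing; congr pair; [exact: h1|exact: h2].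
Qed.

Lemma weak_grad_unique f u v : is_weak_grad Om f u -> is_weak_grad Om f v ->
  ae_eq_on Om u v.
Proof.
move=> /weak_gradP[lf lu fu] /weak_gradP[_ lv fv]; apply: ae_eq_comp => i.
apply: ae_eq_of_test => // phi tphi.
by apply: oppr_inj; rewrite -fu// -fv.
Qed.

Lemma wgradP f : (exists u, is_weak_grad Om f u) -> is_weak_grad Om f (wgrad Om f).
Proof. exact: xgetPex. Qed.

Lemma wgrad_ae f u : is_weak_grad Om f u -> ae_eq_on Om (wgrad Om f) u.
Proof.
by move=> fu; apply: (weak_grad_unique _ fu); apply: wgradP; exists u.
Qed.

Lemma weak_grad_sub f g u v : is_weak_grad Om f u -> is_weak_grad Om g v ->
  is_weak_grad Om (fun x => f x - g x) (fun x => u x - v x).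
Proof.
move=> /weak_gradP[lf lu fu] /weak_gradP[lg lv gv]; apply/weak_gradP; split.
- exact: loc_sub.
- by case; [exact: (loc_sub (lu true) (lv true))|exact: (loc_sub (lu false) (lv false))].
- move=> phi tphi i; have tp := test_fun_partial i tphi.
  transitivity (integ Om (fun x => f x * partial i phi x) - integ Om (fun x => g x * partial i phi x)).
    rewrite /integ -RintegralB//; try exact: integrable_mul_test.
    by apply: eq_Rintegral_on => x _; ring.
  rewrite fu// gv//.
  transitivity (- (integ Om (fun x => coord i u x * phi x) - integ Om (fun x => coord i v x * phi x))).
    by ring.
  congr (- _); rewrite /integ -RintegralB//; try exact: integrable_mul_test.
  by apply: eq_Rintegral_on => x _; case: i {tp} => /=; ring.
Qed.

Lemma partial_grad i phi : coord i (grad phi) = partial i phi.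
Proof. by case: i. Qed.

(** The product inherits the compact support of phi, so its partial derivative has zero integral;
    psi may be merely smooth. *)
Lemma integ_test_by_parts phi psi i : test_fun Om phi -> smooth psi ->
  integ Om (fun x => phi x * partial i psi x) = - integ Om (fun x => partial i phi x * psi x).
Proof.
move=> tphi spsi; have sphi := test_fun_smooth tphi.
have t1 : test_fun Om (fun x => phi x * psi x).
  have := test_funM tphi spsi; congr test_fun; apply/funext => x; exact: mulrC.
have t2 : test_fun Om (fun x => phi x * partial i psi x).
  have := test_funM tphi (smooth_partial i spsi).
  by congr test_fun; apply/funext => x; exact: mulrC.
have t3 : test_fun Om (fun x => partial i phi x * psi x).
  have := test_funM (test_fun_partial i tphi) spsi.
  by congr test_fun; apply/funext => x; exact: mulrC.
have testi chi : test_fun Om chi -> mu.-integrable Om (EFin \o chi).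
  by move=> tchi; apply: integrableS (integrable_test_fun tchi).
apply/eqP; rewrite -addr_eq0; apply/eqP; rewrite -(integ_partial i t1).
rewrite /integ -RintegralD//; [|exact: testi|exact: testi].
by apply: eq_Rintegral_on => x _; rewrite partialM//; ring.
Qed.

Lemma weak_grad_test phi : test_fun Om phi -> is_weak_grad Om phi (grad phi).
Proof.
move=> tphi; apply/weak_gradP; split; first exact: loc_test.
  by move=> i; rewrite partial_grad; apply: loc_test; exact: test_fun_partial.
move=> psi tpsi i; rewrite partial_grad; apply: integ_test_by_parts => //.
exact: test_fun_smooth tpsi.
Qed.

Lemma weak_grad_cst1 : is_weak_grad Om (fun=> 1) (fun=> (0, 0)).
Proof.
have l0 : loc (fun=> 0 : R) by apply: loc_continuous => x; exact: cvg_cst.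
apply/weak_gradP; split; first by apply: loc_continuous => x; exact: cvg_cst.
  by case.
move=> phi tphi i.
rewrite (_ : integ _ _ = integ Om (partial i phi)); last first.
  by apply: eq_Rintegral_on => x _; rewrite mul1r.
rewrite integ_partial// (_ : integ _ _ = integ Om (fun=> 0)); last first.
  by apply: eq_Rintegral_on => x _; case: i => /=; rewrite mul0r.
by rewrite /integ Rintegral_cst// mul0r oppr0.
Qed.

(** Leibniz's rule: the weak gradient of f is tested with phi psi, and the classical product rule
    isolates f phi (partial i psi). *)
Lemma weak_grad_mul_test f u phi : is_weak_grad Om f u -> test_fun Om phi ->
  is_weak_grad Om (fun x => f x * phi x)
    (fun x => phi x *: u x + f x *: grad phi x).
Proof.
move=> /weak_gradP[lf lu fu] tphi; have sphi := test_fun_smooth tphi.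
have compE i x : coord i (fun x => phi x *: u x + f x *: grad phi x) x =
    coord i u x * phi x + f x * partial i phi x.
  by case: i; rewrite /= /GRing.scale /= mulrC.
apply/weak_gradP; split; first exact: loc_test_mul.
  move=> i; rewrite (_ : coord i _ = fun x => coord i u x * phi x + f x * partial i phi x).
    by apply: loc_add; apply: loc_test_mul => //; exact: test_fun_partial.
  by apply/funext => x; exact: compE.
move=> psi tpsi i; have spsi := test_fun_smooth tpsi.
have t1 := test_funM tpsi sphi.
have t2 := test_funM tpsi (smooth_partial i sphi).
have t3 := test_funM (test_fun_partial i tpsi) sphi.
have := fu _ t1 i.
have -> : integ Om (fun x => f x * partial i (fun x => phi x * psi x) x) =
   integ Om (fun x => f x * (phi x * partial i psi x)) + integ Om (fun x => f x * (partial i phi x * psi x)).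
  rewrite /integ -RintegralD//; try exact: integrable_mul_test.
  by apply: eq_Rintegral_on => x _; rewrite partialM//; ring.
move=> /eqP; rewrite eq_sym -subr_eq => /eqP H.
transitivity (integ Om (fun x => f x * (phi x * partial i psi x))).
  by apply: eq_Rintegral_on => x _; ring.
rewrite -H -opprD; congr (- _).
rewrite /integ -RintegralD//; try exact: integrable_mul_test.
by apply: eq_Rintegral_on => x _; rewrite compE; ring.
Qed.

Lemma weak_div_unique u f g : is_weak_div Om u f -> is_weak_div Om u g ->
  ae_eq_on Om f g.
Proof.
move=> [_ _ lf uf] [_ _ lg ug]; apply: ae_eq_of_test => // phi tphi.
by apply: oppr_inj; rewrite -uf// -ug.
Qed.

Lemma wdivP u : (exists f, is_weak_div Om u f) -> is_weak_div Om u (wdiv Om u).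
Proof. exact: xgetPex. Qed.

Lemma wdiv_ae u f : is_weak_div Om u f -> ae_eq_on Om (wdiv Om u) f.
Proof.
by move=> uf; apply: (weak_div_unique _ uf); apply: wdivP; exists f.
Qed.

Lemma integrable_dot_grad_test u phi : loc (fst \o u) -> loc (snd \o u) ->
  test_fun Om phi -> mu.-integrable Om (EFin \o (fun x => dot (u x) (grad phi x))).
Proof.
move=> l1 l2 tphi; apply: integrable_addr => //.
  by apply: (integrable_mul_test oOm l1); exact: test_fun_partial.
by apply: (integrable_mul_test oOm l2); exact: test_fun_partial.
Qed.

Lemma weak_div_sub u v f g : is_weak_div Om u f -> is_weak_div Om v g ->
  is_weak_div Om (fun x => u x - v x) (fun x => f x - g x).
Proof.
move=> [u1 u2 lf uf] [v1 v2 lg vg]; split.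
- exact: (loc_sub u1 v1).
- exact: (loc_sub u2 v2).
- exact: loc_sub.
- move=> phi tphi.
  transitivity (integ Om (fun x => dot (u x) (grad phi x)) - integ Om (fun x => dot (v x) (grad phi x))).
    rewrite /integ -RintegralB//; try exact: integrable_dot_grad_test.
    by apply: eq_Rintegral_on => x _; rewrite /dot /=; ring.
  rewrite uf// vg//.
  transitivity (- (integ Om (fun x => f x * phi x) - integ Om (fun x => g x * phi x))).
    by ring.
  congr (- _); rewrite /integ -RintegralB//; try exact: integrable_mul_test.
  by apply: eq_Rintegral_on => x _; ring.
Qed.

Lemma weak_div_test phi i : test_fun Om phi ->
  is_weak_div Om (fun x => phi x *: ebase i) (partial i phi).
Proof.
move=> tphi.
split.
- rewrite (_ : _ \o _ = fun x => (ebase i).1 * phi x); last by apply/funext => x; exact: mulrC.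
  by apply: loc_test; exact: test_funZ.
- rewrite (_ : _ \o _ = fun x => (ebase i).2 * phi x); last by apply/funext => x; exact: mulrC.
  by apply: loc_test; exact: test_funZ.
- by apply: loc_test; exact: test_fun_partial.
- move=> psi tpsi; rewrite -integ_test_by_parts//; last exact: test_fun_smooth tpsi.
  apply: eq_Rintegral_on => x _; rewrite /dot /= /GRing.scale /=.
  by case: i => /=; ring.
Qed.

End WeakDerivatives.

(** * The spaces H^1, H^1_0, H(div) and V_0 *)

Section FunctionSpaces.
Context {R : realType}.
Local Notation plane := (R * R)%type.
Local Notation mplane := (measurableTypeR R * measurableTypeR R)%type.
Local Notation mu := (@leb2 R).
Variables (Om : set plane) (oOm : open Om) (finOm : (mu (Om : set mplane) < +oo)%E).
Implicit Types (f g h phi psi : plane -> R) (u v : plane -> plane).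

Let mOm : measurable (Om : set mplane) := open_measurable2 oOm.

Local Notation sq f := (sqint mu Om f).
Local Notation sq2 u := (sqint2 mu Om u).

Lemma sqint_test phi : test_fun Om phi -> sq phi.
Proof.
move=> tphi; have [C C0 phiC] := test_fun_bounded tphi.
apply: (sqint_bounded mOm (M := C)) => //.
by apply: continuous_measurable_fun2; exact: test_fun_continuous tphi.
Qed.

Lemma sqint2_grad_test phi : test_fun Om phi -> sq2 (grad phi).
Proof.
move=> tphi; split; [exact: (sqint_test (test_fun_partial false tphi))|].
exact: (sqint_test (test_fun_partial true tphi)).
Qed.

Lemma sqint2_ae u v : (forall i, measurable_fun Om (coord i v : mplane -> R)) ->
  ae_eq_on Om u v -> sq2 u -> sq2 v.
Proof.
move=> mv uv [s1 s2]; split.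
  apply: (sqint_ae mOm _ _ s1); first exact: (mv false).
  by apply: ae_imp uv => x h Omx /=; rewrite h.
apply: (sqint_ae mOm _ _ s2); first exact: (mv true).
by apply: ae_imp uv => x h Omx /=; rewrite h.
Qed.

Lemma ae_eq_sym (T : Type) (f g : plane -> T) : ae_eq_on Om f g -> ae_eq_on Om g f.
Proof. by apply: ae_imp => x h Omx; rewrite h. Qed.

Lemma H1P f : H1 Om f <->
  [/\ sq f, is_weak_grad Om f (wgrad Om f) & sq2 (wgrad Om f)].
Proof.
split=> [[/Lp_sqint sf ex /Lp2_sqint2 sg]|[sf wg sg]].
  by split => //; [exact: sf|exact: wgradP|exact: sg].
split; [exact/Lp_sqint|by exists (wgrad Om f)|exact/Lp2_sqint2].
Qed.

(** [wgrad] is a chosen representative, known to agree with u only almost everywhere; its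
    measurability comes from its being a weak gradient, its square-integrability from u. *)
Lemma H1_intro f u : sq f -> is_weak_grad Om f u -> sq2 u -> H1 Om f.
Proof.
move=> sf fu su.
have wg : is_weak_grad Om f (wgrad Om f) by apply: wgradP; exists u.
apply/H1P; split => //; apply: sqint2_ae su.
  by move=> i; have /weak_gradP[_ /(_ i) /loc_measurable] := wg.
apply: ae_eq_sym; exact: wgrad_ae.
Qed.

Lemma H1_sub f g : H1 Om f -> H1 Om g -> H1 Om (fun x => f x - g x) /\
  ae_eq_on Om (wgrad Om (fun x => f x - g x)) (fun x => wgrad Om f x - wgrad Om g x).
Proof.
move=> /H1P[sf fu su] /H1P[sg gv sv].
have w := weak_grad_sub oOm fu gv; split; last exact: wgrad_ae.
by apply: (H1_intro _ w); [exact: sqint_sub|exact: sqint2_sub].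
Qed.

Lemma H1_test phi : test_fun Om phi -> H1 Om phi.
Proof.
move=> tphi; apply: (H1_intro (sqint_test tphi) (weak_grad_test oOm tphi)).
exact: sqint2_grad_test.
Qed.

Lemma H1_mul_test f phi : H1 Om f -> test_fun Om phi ->
  H1 Om (fun x => f x * phi x) /\
  ae_eq_on Om (wgrad Om (fun x => f x * phi x))
    (fun x => phi x *: wgrad Om f x + f x *: grad phi x).
Proof.
move=> /H1P[sf fu su] tphi; have w := weak_grad_mul_test oOm fu tphi.
split; last exact: wgrad_ae.
have bd chi h : test_fun Om chi -> sq h -> sq (fun x => chi x * h x).
  move=> tchi; have [C C0 chiC] := test_fun_bounded tchi.
  apply: (sqint_bdd mOm (M := C)) => //.
  by apply: continuous_measurable_fun2; exact: test_fun_continuous tchi.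
have bd' chi h : test_fun Om chi -> sq h -> sq (fun x => h x * chi x).
  move=> tchi /(bd _ _ tchi); congr (sqint _ _ _); apply/funext => x; exact: mulrC.
apply: (H1_intro _ w); first exact: bd'.
apply: sqint2_add => //.
  by split; apply: bd => //; [exact: su.1|exact: su.2].
by split; apply: bd' => //; exact: test_fun_partial.
Qed.

Lemma H1_cst1 : H1 Om (fun=> 1).
Proof.
have s0 : sq (fun=> 0) by apply: (sqint_bounded mOm (M := 0)) => // x _; rewrite normr0.
apply: (H1_intro _ (weak_grad_cst1 oOm)); last by split.
by apply: (sqint_bounded mOm (M := 1)) => // x _; rewrite normr1.
Qed.

Lemma nrm_ae u v : sq2 u -> sq2 v -> ae_eq_on Om u v -> nrm mu Om u = nrm mu Om v.
Proof.
move=> su sv uv; congr Num.sqrt; apply: Rintegral_ae_eq => //.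
- exact: integrable_measurable_fun (sqint2_dot mOm su su).
- exact: integrable_measurable_fun (sqint2_dot mOm sv sv).
- by apply: ae_imp uv => x h Omx; rewrite h.
Qed.

Lemma integ_dot_ae u v u' v' : sq2 u -> sq2 v -> sq2 u' -> sq2 v' ->
  ae_eq_on Om u u' -> ae_eq_on Om v v' ->
  integ Om (fun x => dot (u x) (v x)) = integ Om (fun x => dot (u' x) (v' x)).
Proof.
move=> su sv su' sv' uu' vv'; apply: Rintegral_ae_eq => //.
- exact: integrable_measurable_fun (sqint2_dot mOm su sv).
- exact: integrable_measurable_fun (sqint2_dot mOm su' sv').
- by apply: ae_imp2 uu' vv' => x h h' Omx; rewrite h// h'.
Qed.

Lemma Lpnorm_nrm f : sq f -> Lpnorm Om 2%:E f = (nrm mu Om (fun x => (f x, 0)))%:E.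
Proof.
move=> sf; rewrite Lpnorm_sqint//; congr (Num.sqrt _)%:E; apply: eq_Rintegral_on => x _.
by rewrite /dot /= mul0r addr0 expr2.
Qed.

Lemma sqint2_scalar f : sq f -> sq2 (fun x => (f x, 0)).
Proof.
move=> sf; split; first exact: sf.
have s0 : sq (fun=> 0) by apply: (sqint_bounded mOm (M := 0)) => // x _; rewrite normr0.
exact: s0.
Qed.

Lemma nrm_triangle u v : sq2 u -> sq2 v ->
  nrm mu Om (fun x => u x - v x) <= nrm mu Om u + nrm mu Om v.
Proof.
move=> su sv; rewrite -(ler_pXn2r (n := 2)) ?nnegrE ?addr_ge0 ?nrm_ge0//.
have -> : nrm mu Om (fun x => u x - v x) ^+ 2 =
    nrm mu Om u ^+ 2 + 2 * (-1) * integ Om (fun x => dot (u x) (v x)) + (-1) ^+ 2 * nrm mu Om v ^+ 2.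
  rewrite -(Rintegral_dot_expand mOm)// nrm_sqr; apply: eq_Rintegral_on => x _.
  by rewrite scaleN1r.
have := cauchy_schwarz mOm su sv; rewrite ler_norml -/(integ Om _) => /andP[h _].
by rewrite sqrrD; move: h; set X := integ _ _; nra.
Qed.

Lemma H10P f : H10 Om f <-> H1 Om f /\ forall e : R, 0 < e -> exists phi,
  [/\ test_fun Om phi, nrm mu Om (fun x => (f x - phi x, 0)) < e &
      nrm mu Om (fun x => wgrad Om f x - grad phi x) < e].
Proof.
split=> -[H1f fphi]; split => // e e0; have [phi [tphi h1 h2]] := fphi e e0;
  have /H1P[sf _ sg] := H1f; exists phi; split => //;
  have s1 := sqint_sub mOm sf (sqint_test tphi);
  have s2 := sqint2_sub mOm sg (sqint2_grad_test tphi).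
- by rewrite -lte_fin -Lpnorm_nrm.
- by rewrite -lte_fin -Lpnorm2_nrm.
- by rewrite Lpnorm_nrm.
- by rewrite Lpnorm2_nrm.
Qed.

Lemma H10_sub f g : H10 Om f -> H10 Om g -> H10 Om (fun x => f x - g x).
Proof.
move=> /H10P[H1f fa] /H10P[H1g ga]; have [H1fg wE] := H1_sub H1f H1g.
have /H1P[sf _ sdf] := H1f; have /H1P[sg _ sdg] := H1g.
have /H1P[sfg _ sdfg] := H1fg.
apply/H10P; split; first exact: H1fg.
move=> e e0; have key u v : sq2 u -> sq2 v -> nrm mu Om u < e / 2 -> nrm mu Om v < e / 2 ->
    nrm mu Om (fun x => u x - v x) < e.
  move=> su sv ue ve; apply: (le_lt_trans (nrm_triangle su sv)).
  by rewrite [e]splitr; exact: ltrD.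
have e2 : 0 < e / 2 by rewrite divr_gt0.
have [phi [tphi f1 f2]] := fa _ e2; have [psi [tpsi g1 g2]] := ga _ e2.
have tpp : test_fun Om (fun x => phi x - psi x).
  have := test_funD tphi (test_funZ (-1) tpsi).
  by congr test_fun; apply/funext => x; rewrite mulN1r.
exists (fun x => phi x - psi x); split; first exact: tpp.
  have -> : (fun x => (f x - g x - (phi x - psi x), 0)) =
      (fun x => (f x - phi x, 0) - (g x - psi x, 0)) :> (plane -> plane).
    apply/funext => x; rewrite [RHS]surjective_pairing /= subrr; congr pair; ring.
  exact: (key _ _ (sqint2_scalar (sqint_sub mOm sf (sqint_test tphi)))
    (sqint2_scalar (sqint_sub mOm sg (sqint_test tpsi))) f1 g1).
have sa := sqint2_sub mOm sdf (sqint2_grad_test tphi).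
have sb := sqint2_sub mOm sdg (sqint2_grad_test tpsi).
have gE x : grad (fun x => phi x - psi x) x = grad phi x - grad psi x.
  have E i : partial i (fun x => phi x - psi x) x = partial i phi x - partial i psi x.
    have spsi := test_fun_smooth tpsi; have sphi := test_fun_smooth tphi.
    by rewrite /partial deriveB//; exact: smooth_derivable.
  by rewrite /grad !E.
rewrite (@nrm_ae _ (fun x => (wgrad Om f x - grad phi x) - (wgrad Om g x - grad psi x))).
- exact: (key _ _ sa sb f2 g2).
- by apply: sqint2_sub => //; exact: sqint2_grad_test.
- exact: sqint2_sub.
- apply: ae_imp wE => x h Omx; rewrite h// gE.
  by rewrite !opprD !opprK addrACA [- wgrad Om g x + _]addrC addrACA.
Qed.

Lemma H10_test phi : test_fun Om phi -> H10 Om phi.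
Proof.
move=> tphi; apply/H10P; have H1phi := H1_test tphi; split; first exact: H1phi.
move=> e e0; exists phi.
have nrm0 : nrm mu Om (fun=> (0, 0)) = 0.
  rewrite /nrm (_ : Rintegral _ _ _ = integ Om (fun=> 0)).
    by rewrite /integ Rintegral_cst// mul0r sqrtr0.
  by apply: eq_Rintegral_on => x _; rewrite /dot /= mul0r addr0.
have /H1P[_ _ sg] := H1phi.
split; first exact: tphi.
  rewrite (_ : (fun x => _) = (fun=> (0, 0))) ?nrm0//.
  by apply/funext => x; rewrite subrr.
rewrite (@nrm_ae _ (fun=> (0, 0))) ?nrm0//.
- by apply: sqint2_sub => //; exact: sqint2_grad_test.
- by apply: (@sqint2_scalar (fun=> 0)); apply: (sqint_bounded mOm (M := 0)) => // x _; rewrite normr0.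
- have := wgrad_ae oOm (weak_grad_test oOm tphi); apply: ae_imp => x h Omx.
  by rewrite h// subrr.
Qed.

Lemma Lp_oo_test phi : test_fun Om phi -> Lp Om +oo%E phi.
Proof.
move=> tphi; have [C C0 phiC] := test_fun_bounded tphi.
apply/(LpP mOm); split.
  by apply: continuous_measurable_fun2; exact: test_fun_continuous tphi.
by apply: (@Lpnorm_oo_lty _ _ _ C) => //; apply: aeW => x _.
Qed.

Lemma HdivP u : Hdiv Om u <->
  [/\ sq2 u, is_weak_div Om u (wdiv Om u) & sq (wdiv Om u)].
Proof.
split=> [[/Lp2_sqint2 su ex /Lp_sqint sd]|[su wd sd]].
  by split => //; [exact: su|exact: wdivP|exact: sd].
split; [exact/Lp2_sqint2|by exists (wdiv Om u)|exact/Lp_sqint].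
Qed.

Lemma Hdiv_intro u f : sq2 u -> is_weak_div Om u f -> sq f -> Hdiv Om u.
Proof.
move=> su uf sf.
have wd : is_weak_div Om u (wdiv Om u) by apply: wdivP; exists f.
apply/HdivP; split => //; apply: (sqint_ae mOm _ _ sf).
  by have [_ _ []] := wd.
apply: ae_eq_sym; exact: wdiv_ae.
Qed.

Lemma V0_sub u v : V0 Om u -> V0 Om v -> V0 Om (fun x => u x - v x) /\
  ae_eq_on Om (wdiv Om (fun x => u x - v x)) (fun x => wdiv Om u x - wdiv Om v x).
Proof.
move=> [/HdivP[su uf sf] u0] [/HdivP[sv vg sg] v0].
have w := weak_div_sub oOm uf vg; have wE := wdiv_ae oOm w.
have Hd : Hdiv Om (fun x => u x - v x).
  by apply: (Hdiv_intro _ w); [exact: sqint2_sub|exact: sqint_sub].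
split; last exact: wE.
split; first exact: Hd.
move=> phi H1phi; have /H1P[sphi _ sgphi] := H1phi.
have /HdivP[_ _ sd] := Hd.
have -> : normal_trace Om (fun x => u x - v x) phi =
    normal_trace Om u phi - normal_trace Om v phi.
  rewrite /normal_trace.
  have -> : integ Om (fun x => dot (u x - v x) (wgrad Om phi x)) =
     integ Om (fun x => dot (u x) (wgrad Om phi x)) - integ Om (fun x => dot (v x) (wgrad Om phi x)).
    rewrite /integ -RintegralB//; try exact: sqint2_dot.
    by apply: eq_Rintegral_on => x _; rewrite /dot /=; ring.
  have -> : integ Om (fun x => wdiv Om (fun x => u x - v x) x * phi x) =
     integ Om (fun x => wdiv Om u x * phi x) - integ Om (fun x => wdiv Om v x * phi x).
    rewrite /integ -RintegralB//; try exact: sqint_mul.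
    apply: Rintegral_ae_eq => //.
    - exact: integrable_measurable_fun (sqint_mul mOm sd sphi).
    - by apply: integrable_measurable_fun (integrable_subr mOm (sqint_mul mOm sf sphi) (sqint_mul mOm sg sphi)).
    - by apply: ae_imp wE => x h Omx; rewrite h// mulrBl.
  by rewrite opprD addrACA.
by rewrite u0// v0// subrr.
Qed.

(** The normal trace paired with psi is the integral of phi (partial i psi) + psi (partial i phi),
    which is 0 by the definition of the weak gradient of psi. *)
Lemma V0_test phi i : test_fun Om phi -> V0 Om (fun x => phi x *: ebase i).
Proof.
move=> tphi; have w := weak_div_test oOm i tphi; have wE := wdiv_ae oOm w.
have sphi := sqint_test tphi.
have su : sq2 (fun x => phi x *: ebase i).
  split.
    rewrite (_ : _ \o _ = fun x => (ebase i).1 * phi x); first exact: sqint_scale.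
    by apply/funext => x; exact: mulrC.
  rewrite (_ : _ \o _ = fun x => (ebase i).2 * phi x); first exact: sqint_scale.
  by apply/funext => x; exact: mulrC.
have Hd : Hdiv Om (fun x => phi x *: ebase i).
  by apply: (Hdiv_intro su w); apply: sqint_test; exact: test_fun_partial.
split; first exact: Hd.
move=> psi /H1P[spsi /weak_gradP[_ _ psig] sg]; have /HdivP[_ _ sd] := Hd.
rewrite /normal_trace.
rewrite [X in X + _](_ : _ = integ Om (fun x => coord i (wgrad Om psi) x * phi x)); last first.
  apply: eq_Rintegral_on => x _; rewrite -dot_ebase /dot /= /GRing.scale /=; ring.
rewrite [X in _ + X](_ : _ = integ Om (fun x => psi x * partial i phi x)); last first.
  apply: Rintegral_ae_eq => //.
  - exact: integrable_measurable_fun (sqint_mul mOm sd spsi).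
  - exact: integrable_measurable_fun (sqint_mul mOm spsi (sqint_test (test_fun_partial i tphi))).
  - by apply: ae_imp wE => x h Omx; rewrite h// mulrC.
by rewrite psig// subrr.
Qed.

(* The normal trace tested with 1 puts [wdiv Om u] in [L20 Om]. *)
Lemma wdiv_ae0 u : V0 Om u ->
  (forall q, L20 Om q -> integ Om (fun x => q x * wdiv Om u x) = 0) ->
  {ae mu, forall x, Om x -> wdiv Om u x = 0}.
Proof.
move=> [/HdivP[su _ sd] u0] dq; have H11 := H1_cst1; have /H1P[_ _ sg1] := H11.
have Id : integ Om (wdiv Om u) = 0.
  have := u0 _ H11; rewrite /normal_trace.
  rewrite [X in X + _](_ : _ = integ Om (fun=> 0)); last first.
    apply: Rintegral_ae_eq => //; first exact: integrable_measurable_fun (sqint2_dot mOm su sg1).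
    apply: ae_imp (wgrad_ae oOm (weak_grad_cst1 oOm)) => x h Omx.
    by rewrite h// /dot /= !mulr0 addr0.
  rewrite {1}/integ Rintegral_cst// mul0r add0r => <-.
  by apply: eq_Rintegral_on => x _; rewrite mulr1.
have [_ sd2] := sd.
have I2 : integ Om (fun x => wdiv Om u x ^+ 2) = 0.
  rewrite -(dq (wdiv Om u)); first by apply: eq_Rintegral_on => x _; rewrite expr2.
  by split => //; exact/Lp_sqint.
have := Rintegral_eq0_ae mOm sd2 (fun x _ => sqr_ge0 _) I2.
by apply: ae_imp => x h /h /eqP; rewrite sqrf_eq0 => /eqP.
Qed.

Lemma divfree_grad u phi : V0 Om u ->
  {ae mu, forall x, Om x -> wdiv Om u x = 0} -> H1 Om phi ->
  integ Om (fun x => dot (u x) (wgrad Om phi x)) = 0.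
Proof.
move=> [/HdivP[su _ sd] u0] d0 H1phi; have /H1P[sphi _ _] := H1phi.
have := u0 _ H1phi; rewrite /normal_trace.
rewrite [X in _ + X](_ : _ = integ Om (fun=> 0)); last first.
  apply: Rintegral_ae_eq => //; first exact: integrable_measurable_fun (sqint_mul mOm sd sphi).
  by apply: ae_imp d0 => x h Omx; rewrite h// mul0r.
by rewrite {2}/integ Rintegral_cst// mul0r addr0.
Qed.

Lemma divfree_grad_test u phi : V0 Om u ->
  {ae mu, forall x, Om x -> wdiv Om u x = 0} -> test_fun Om phi ->
  integ Om (fun x => dot (u x) (grad phi x)) = 0.
Proof.
move=> V0u d0 tphi; have H1phi := H1_test tphi.
rewrite -(divfree_grad V0u d0 H1phi).
have [/HdivP[su _ _] _] := V0u; have /H1P[_ _ sg] := H1phi.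
apply: integ_dot_ae => //; [exact: sqint2_grad_test|exact: aeW|].
by apply: ae_eq_sym; exact: (wgrad_ae oOm (weak_grad_test oOm tphi)).
Qed.

End FunctionSpaces.

(** * Energy estimates and uniqueness *)

Section EnergyEstimate.
Context {R : realType}.
Local Notation plane := (R * R)%type.
Local Notation mplane := (measurableTypeR R * measurableTypeR R)%type.
Local Notation mu := (@leb2 R).
Variables (Om : set plane) (oOm : open Om) (finOm : (mu (Om : set mplane) < +oo)%E).
Implicit Types (f g h phi psi S : plane -> R) (u v D : plane -> plane).

Let mOm : measurable (Om : set mplane) := open_measurable2 oOm.

Local Notation sq f := (sqint mu Om f).
Local Notation sq2 u := (sqint2 mu Om u).
Local Notation nrm := (nrm mu Om).

Lemma nrm_scale h u M : 0 <= M -> measurable_fun Om (h : mplane -> R) ->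
  (forall x, Om x -> `|h x| <= M) -> sq2 u -> nrm (fun x => h x *: u x) <= M * nrm u.
Proof.
move=> M0 mh hM su; have shu := sqint2_bdd mOm mh hM su.
rewrite -(ler_pXn2r (n := 2)) ?nnegrE ?mulr_ge0 ?nrm_ge0// exprMn !nrm_sqr.
rewrite -RintegralZl//; last exact: sqint2_dot.
apply: le_Rintegral => //; first exact: sqint2_dot.
  by apply: integrable_scalel => //; exact: sqint2_dot.
move=> x Omx; have -> : dot (h x *: u x) (h x *: u x) = h x ^+ 2 * dot (u x) (u x).
  by rewrite /dot /= /GRing.scale /=; ring.
rewrite ler_wpM2r ?dot_ge0// -real_normK ?num_real// ler_pXn2r ?nnegrE//.
exact: hM.
Qed.

Lemma one_sub_cos_ge0 (x : R) : 0 <= 1 - cos x.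
Proof. by rewrite subr_ge0; exact: cos_le1. Qed.

Lemma one_sub_cos_le2 (x : R) : 1 - cos x <= 2.
Proof. by have := cos_geN1 x; lra. Qed.

Lemma normr_sin_le (x : R) : `|sin x| <= `|x|.
Proof.
wlog x0 : x / 0 <= x.
  move=> H; have [/H //|x0] := leP 0 x.
  by rewrite -normrN -sinN -(normrN x); apply: H; lra.
have [->|xn0] := eqVneq x 0; first by rewrite sin0.
have xp : 0 < x by rewrite lt0r xn0.
have [c _] := @MVT R sin cos 0 x xp (fun y _ => is_derive_sin y)
  (continuous_subspaceT (@continuous_sin R)).
rewrite sin0 !subr0 => ->; rewrite normrM ler_piMl//.
by rewrite ler_norml cos_geN1 cos_le1.
Qed.

(** By the double angle formula 1 - cos x = 2 sin^2 (x / 2), which is at most x^2 / 2. *)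
Lemma one_sub_cos_le_sqr (x : R) : 1 - cos x <= x ^+ 2.
Proof.
have h := cos_mulr2n (x / 2).
have xE : (x / 2) *+ 2 = x by rewrite -mulr_natr divfK.
rewrite xE in h; rewrite h.
have := normr_sin_le (x / 2); rewrite -ler_sqr ?nnegrE// !real_normK ?num_real//.
have := cos2Dsin2 (x / 2); rewrite exprMn => h1 h2.
have := sqr_ge0 x; rewrite -mulr_natr; lra.
Qed.

Lemma integ_tail_cvg D : sq2 D ->
  integ Om (fun x => dot (D x) (D x) - Num.min (dot (D x) (D x)) n%:R) @[n --> \oo] --> (0 : R).
Proof.
move=> sD; have di := sqint2_dot mOm sD sD.
have mq := integrable_measurable_fun di.
rewrite (_ : 0 = integ Om (fun=> 0)); last by rewrite /integ Rintegral_cst// mul0r.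
apply: (@Rintegral_dominated_cvg _ mplane R mu Om mOm
  (fun n x => dot (D x) (D x) - Num.min (dot (D x) (D x)) n%:R) (fun=> 0)
  (fun x => dot (D x) (D x))) => //.
- by move=> n; apply: measurable_funB => //; exact: measurable_minr.
- move=> x _; apply: cvg_near_cst.
  have [m mD] := exists_nat_gt_norm (dot (D x) (D x)).
  near=> n; rewrite min_l ?subrr//.
  apply: (@le_trans _ _ m%:R).
    by apply: ltW; apply: le_lt_trans mD; exact: ler_norm.
  rewrite ler_nat; near: n; exact: nbhs_infty_ge.
- move=> n x _; have q0 := dot_ge0 (D x).
  rewrite ger0_norm ?subr_ge0 ?ge_min ?lexx// gerBl le_min q0; exact: ler0n.
Unshelve. all: by end_near. Qed.

(* [S] will be [k sin (phi / k)]: it is bounded by [k], and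
   [S grad phi = grad (k^2 (1 - cos (phi / k)))] is orthogonal to [u].  The
   defect [1 - cos] is at most [2], and at most [(phi / k)^2], which is used
   where [dot D D] is below the level [n]. *)
Lemma truncation_limit (theta kap : plane -> R) D u (K L : R) :
  sq theta -> sq2 D -> sq2 u -> 0 <= K -> 0 <= L ->
  measurable_fun Om (kap : mplane -> R) -> (forall x, Om x -> 0 <= kap x <= K) ->
  (forall e : R, 0 < e -> exists phi, [/\ test_fun Om phi,
     nrm (fun x => (theta x - phi x, 0)) < e & nrm (fun x => D x - grad phi x) < e]) ->
  (forall psi, test_fun Om psi -> integ Om (fun x => dot (u x) (grad psi x)) = 0) ->
  (forall S, test_fun Om S ->
     integ Om (fun x => kap x * dot (D x) (grad S x)) +
     integ Om (fun x => dot (u x) (D x) * S x) <= L * nrm (grad S)) ->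
  integ Om (fun x => kap x * dot (D x) (D x)) <= L * nrm D.
Proof.
move=> st sD su K0 L0 mk kK approx udiv hS.
have kK' x : Om x -> `|kap x| <= K by move=> /kK/andP[k0 k1]; rewrite ger0_norm.
have di := sqint2_dot mOm sD sD; have mq := integrable_measurable_fun di.
(* Error budget: e for all the terms proportional to the distance d, and 3 K e for the defect 1 -
   cos, namely 2 K e above the level n and K e below it. *)
apply/ler_addgt0Pr => e' e'0; pose e := e' / (1 + 3 * K).
have e0 : 0 < e by rewrite divr_gt0//; lra.
have e'E : e' = e + 3 * K * e by rewrite /e; field; lra.
have [n tailn] : exists n : nat,
    integ Om (fun x => dot (D x) (D x) - Num.min (dot (D x) (D x)) n%:R) < e.
  have /cvgrPdist_lt/(_ e e0)[n _ /(_ n (leqnn n))] := integ_tail_cvg sD.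
  by rewrite /= sub0r normrN => /ltr_normlW ?; exists n.
(* A bound for |phi|_2^2 available before phi is chosen, valid as soon as phi is within distance 1
   of theta. *)
pose B := (nrm (fun x => (theta x, 0)) + 1) ^+ 2.
have B0 : 0 <= B by exact: sqr_ge0.
(* Below the level n the defect costs at most n |phi|_2^2 / k^2; this k makes it at most e, the
   summand 1 ensuring k <= k^2. *)
pose k := 1 + n%:R * B / e.
have nBe : 0 <= n%:R * B / e by apply: divr_ge0; [exact: mulr_ge0 (ler0n _ _) B0|exact: ltW].
have k1 : 1 <= k by rewrite lerDl.
have k0 : 0 < k by lra.
have nBk : n%:R * B / k ^+ 2 <= e.
  rewrite ler_pdivrMr ?exprn_gt0// [e * _]mulrC -ler_pdivrMr//.
  by apply: (@le_trans _ _ k); [rewrite /k lerDr|rewrite expr2 ler_peMl// ltW].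
(* The total factor of d in the final estimate: L from |grad S| <= |D| + d, K |D| from the diffusion
   term, k |u| from the convection term. *)
pose c0 := L + K * nrm D + k * nrm u.
have c00 : 0 <= c0 by rewrite !addr_ge0 ?mulr_ge0 ?nrm_ge0// ltW.
(* phi comes last, since its distance to theta has to absorb the factor k contained in [c0]; the cap
   1 is what [B] relies on. *)
pose d := Num.min 1 (e / (1 + c0)).
have d0 : 0 < d by rewrite lt_min ltr01 divr_gt0//; lra.
have d1 : d <= 1 by rewrite ge_min lexx.
have dc : d * c0 <= e.
  apply: (@le_trans _ _ (e / (1 + c0) * c0)); first by rewrite ler_wpM2r// ge_min lexx orbT.
  rewrite mulrAC ler_pdivrMr; last by lra.
  by rewrite ler_wpM2l ?ltW//; lra.
have [phi [tphi pd gd]] := approx d d0.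
have sphi := test_fun_smooth tphi.
have sqphi := sqint_test oOm finOm tphi.
have sg := sqint2_grad_test oOm finOm tphi.
pose cs := fun x => cos (k^-1 * phi x).
pose S := fun x => k * sin (k^-1 * phi x).
pose Psi := fun x => k ^+ 2 * (1 - cos (k^-1 * phi x)).
have tkp : test_fun Om (fun x => k^-1 * phi x) := test_funZ _ tphi.
have skp := test_fun_smooth tkp.
have tS : test_fun Om S.
  by apply: test_funZ; apply: test_fun_comp => //; [exact: cinfty1_sin|exact: sin0].
have tPsi : test_fun Om Psi.
  apply: test_funZ; apply: (@test_fun_comp _ _ (fun s => 1 - cos s)) => //; last by rewrite cos0 subrr.
  move=> m; rewrite (_ : (fun s => _) = fun s => 1 + (-1) * cos s); last by apply/funext => s; rewrite mulN1r.
  by apply: cdiffD; [exact: cdiff_cst|apply: cdiffZ; exact: cinfty1_cos].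
have dS : forall s : R, is_derive s 1 (fun s => k * sin (k^-1 * s)) (cos (k^-1 * s)).
  move=> s; apply: is_derive_eq; rewrite /GRing.scale /=.
  field; lra.
have gS x : grad S x = cs x *: grad phi x.
  rewrite /grad /S /cs !(partial_comp _ _ dS sphi).
  by rewrite [RHS]surjective_pairing.
have dPsi : forall s : R, is_derive s 1 (fun s => k ^+ 2 * (1 - cos (k^-1 * s))) (k * sin (k^-1 * s)).
  move=> s; apply: is_derive_eq; rewrite /GRing.scale /=.
  field; lra.
have gPsi x : grad Psi x = S x *: grad phi x.
  rewrite /grad /Psi /S !(partial_comp _ _ dPsi sphi).
  by rewrite [RHS]surjective_pairing.
have mcs : measurable_fun Om (cs : mplane -> R).
  apply: continuous_measurable_fun2 => x; apply: continuous_comp; last exact: continuous_cos.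
  exact: (test_fun_continuous tkp).
have cs1 x : `|cs x| <= 1 by rewrite ler_norml cos_geN1 cos_le1.
have mS : measurable_fun Om (S : mplane -> R).
  by apply: continuous_measurable_fun2; exact: (test_fun_continuous tS).
have Sk x : `|S x| <= k.
  rewrite normrM (gtr0_norm k0); apply: ler_piMr; first exact: ltW.
  by rewrite ler_norml sin_geN1 sin_le1.
have mkc : measurable_fun Om ((fun x => kap x * cs x) : mplane -> R) by exact: measurable_funM.
have kcK x : Om x -> `|kap x * cs x| <= K.
  by move=> Omx; rewrite normrM -[K]mulr1; apply: ler_pM => //; exact: kK'.
have sdg := sqint2_sub mOm sD sg.
have skD := sqint2_bdd mOm mkc kcK sD.
have sSu : sq2 (fun x => S x *: u x) by exact: (sqint2_bdd mOm mS (fun x _ => Sk x) su).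
have t1 : nrm (grad S) <= nrm D + d.
  have -> : nrm (grad S) = nrm (fun x => cs x *: grad phi x).
    by congr Num.sqrt; apply: eq_Rintegral_on => x _; rewrite gS.
  apply: (@le_trans _ _ (1 * nrm (grad phi))); first exact: nrm_scale.
  rewrite mul1r.
  have -> : nrm (grad phi) = nrm (fun x => D x - (D x - grad phi x)).
    by congr Num.sqrt; apply: eq_Rintegral_on => x _; rewrite opprB addrC subrK.
  apply: le_trans (nrm_triangle oOm sD sdg) _.
  by rewrite lerD2l ltW.
(* Subtracting the integral of u . grad Psi = S u . grad phi, which is 0, leaves only S u . (D -
   grad phi). *)
have tu : - (k * nrm u * d) <= integ Om (fun x => dot (u x) (D x) * S x).
  have -> : integ Om (fun x => dot (u x) (D x) * S x) =
      integ Om (fun x => dot (S x *: u x) (D x - grad phi x)).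
    rewrite -[LHS]subr0 -(udiv _ tPsi) /integ -RintegralB//.
    - by apply: eq_Rintegral_on => x _; rewrite gPsi /dot /= /GRing.scale /=; ring.
    - apply: (eq_integrable_on mOm (f := fun x => dot (S x *: u x) (D x))); last exact: sqint2_dot.
      by move=> x _; rewrite /dot /= /GRing.scale /=; ring.
    - by apply: sqint2_dot => //; exact: sqint2_grad_test.
  have := cauchy_schwarz mOm sSu sdg; rewrite ler_norml => /andP[+ _].
  apply: le_trans; rewrite lerN2; apply: ler_pM; rewrite ?nrm_ge0//; last exact: ltW.
  by apply: nrm_scale => //; exact: ltW.
have tk : integ Om (fun x => (kap x * cs x) * dot (D x) (D x - grad phi x)) <= K * nrm D * d.
  have -> : integ Om (fun x => (kap x * cs x) * dot (D x) (D x - grad phi x)) =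
      integ Om (fun x => dot ((kap x * cs x) *: D x) (D x - grad phi x)).
    by apply: eq_Rintegral_on => x _; rewrite /dot /= /GRing.scale /=; ring.
  have := cauchy_schwarz mOm skD sdg; rewrite ler_norml => /andP[_].
  move=> /le_trans; apply; apply: ler_pM; rewrite ?nrm_ge0//; last exact: ltW.
  exact: nrm_scale.
pose q x := dot (D x) (D x).
have mmin : measurable_fun Om ((fun x => Num.min (q x) n%:R) : mplane -> R).
  exact: measurable_minr.
have qi : mu.-integrable Om (EFin \o (fun x => q x - Num.min (q x) n%:R)).
  apply: (integrable_le mOm (g := q)) => //; first exact: measurable_funB.
  move=> x _; have q0 := dot_ge0 (D x).
  rewrite ger0_norm ?subr_ge0 ?ge_min ?lexx// gerBl le_min q0; exact: ler0n.
have phi2 : integ Om (fun x => phi x ^+ 2) <= B.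
  have s1 := sqint2_scalar oOm finOm st.
  have s2 := sqint2_scalar oOm finOm (sqint_sub mOm st sqphi).
  have -> : integ Om (fun x => phi x ^+ 2) = nrm (fun x => (theta x, 0) - (theta x - phi x, 0)) ^+ 2.
    rewrite nrm_sqr; apply: eq_Rintegral_on => x _.
    by rewrite /dot /= subrr mulr0 addr0 opprB addrC subrK expr2.
  rewrite ler_pXn2r ?nnegrE ?addr_ge0 ?nrm_ge0//.
  apply: le_trans (nrm_triangle oOm s1 s2) _; rewrite lerD2l.
  by apply: le_trans d1; exact: ltW.
have tE : integ Om (fun x => kap x * (1 - cs x) * q x) <= K * (3 * e).
  apply: (@le_trans _ _ (integ Om (fun x => (2 * K) * (q x - Num.min (q x) n%:R) +
      (K * n%:R / k ^+ 2) * phi x ^+ 2))).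
    apply: le_Rintegral => //.
    - apply: (integrable_bounded_mul mOm (M := K * 2)) => //.
        apply: measurable_funM => //; apply: measurable_funB => //.
      move=> x Omx; rewrite normrM; apply: ler_pM => //; first exact: kK'.
      by rewrite ger0_norm ?one_sub_cos_ge0 ?one_sub_cos_le2.
    - by apply: integrable_addr => //; apply: integrable_scalel => //; exact: sqphi.2.
    move=> x Omx; have /andP[k0' k1'] := kK x Omx.
    have q0 := dot_ge0 (D x); rewrite -/(q x) in q0.
    have c1 := one_sub_cos_ge0 (k^-1 * phi x); have c2 := one_sub_cos_le2 (k^-1 * phi x).
    have c3 := one_sub_cos_le_sqr (k^-1 * phi x).
    rewrite -/(cs x) in c1 c2 c3.
    set m := Num.min (q x) n%:R.
    have mq0 : 0 <= q x - m by rewrite subr_ge0 ge_min lexx.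
    have m0 : 0 <= m by rewrite le_min q0 ler0n.
    have mn : m <= n%:R by rewrite ge_min lexx orbT.
    have h1 : (1 - cs x) * q x <= 2 * (q x - m) + n%:R * (k^-1 * phi x) ^+ 2.
      have a1 : (1 - cs x) * (q x - m) <= 2 * (q x - m) by rewrite ler_wpM2r.
      have a2 : (1 - cs x) * m <= (k^-1 * phi x) ^+ 2 * n%:R by apply: ler_pM.
      have -> : (1 - cs x) * q x = (1 - cs x) * (q x - m) + (1 - cs x) * m by ring.
      by rewrite (mulrC n%:R); exact: lerD.
    rewrite -mulrA; apply: (@le_trans _ _ (K * ((1 - cs x) * q x))).
      by rewrite ler_wpM2r// mulr_ge0.
    have -> : 2 * K * (q x - m) + K * n%:R / k ^+ 2 * phi x ^+ 2 =
        K * (2 * (q x - m) + n%:R * (k^-1 * phi x) ^+ 2).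
      by rewrite exprMn exprVn; ring.
    by rewrite ler_wpM2l.
  rewrite /integ RintegralD//; last 2 first.
    exact: integrable_scalel.
    by apply: integrable_scalel => //; exact: sqphi.2.
  rewrite !RintegralZl//; last exact: sqphi.2.
  have b1 : 2 * K * integ Om (fun x => q x - Num.min (q x) n%:R) <= 2 * K * e.
    by rewrite ler_wpM2l ?mulr_ge0// ltW.
  have b2 : K * n%:R / k ^+ 2 * integ Om (fun x => phi x ^+ 2) <= K * e.
    apply: (@le_trans _ _ (K * n%:R / k ^+ 2 * B)).
      apply: ler_wpM2l phi2; apply: divr_ge0; last exact: sqr_ge0.
      exact: mulr_ge0 K0 (ler0n _ _).
    rewrite (_ : _ * B = K * (n%:R * B / k ^+ 2)); first exact: ler_wpM2l.
    by ring.
  apply: (@le_trans _ _ (2 * K * e + K * e)); first exact: lerD.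
  by rewrite le_eqVlt; apply/orP; left; apply/eqP; ring.
have := hS S tS.
have -> : integ Om (fun x => kap x * dot (D x) (grad S x)) =
    integ Om (fun x => (kap x * cs x) * dot (D x) (grad phi x)).
  by apply: eq_Rintegral_on => x _; rewrite gS /dot /= /GRing.scale /=; ring.
(* The weight is split as cos + (1 - cos), and in the cosine part one factor D as grad phi + (D -
   grad phi): the first piece is the tested term, the other two are errors. *)
have -> : integ Om (fun x => kap x * dot (D x) (D x)) =
    integ Om (fun x => (kap x * cs x) * dot (D x) (grad phi x)) +
    integ Om (fun x => (kap x * cs x) * dot (D x) (D x - grad phi x)) +
    integ Om (fun x => kap x * (1 - cs x) * q x).
  have i1 : mu.-integrable Om (EFin \o (fun x => (kap x * cs x) * dot (D x) (grad phi x))).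
    by apply: (integrable_bounded_mul mOm mkc kcK); exact: sqint2_dot.
  have i2 : mu.-integrable Om (EFin \o (fun x => (kap x * cs x) * dot (D x) (D x - grad phi x))).
    by apply: (integrable_bounded_mul mOm mkc kcK); exact: sqint2_dot.
  have i3 : mu.-integrable Om (EFin \o (fun x => kap x * (1 - cs x) * q x)).
    apply: (integrable_bounded_mul mOm (M := K * 2)) => //.
      by apply: measurable_funM => //; apply: measurable_funB.
    move=> x Omx; rewrite normrM; apply: ler_pM => //; first exact: kK'.
    by rewrite ger0_norm ?one_sub_cos_ge0 ?one_sub_cos_le2.
  rewrite /integ -RintegralD// -RintegralD//; last exact: integrable_addr.
  by apply: eq_Rintegral_on => x _; rewrite /q /dot /=; ring.
move: tu tk tE t1 dc; rewrite /c0 e'E.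
move: (integ _ _) (integ _ _) (integ _ _) (integ _ _) (nrm (grad S)) (nrm D) (nrm u) => I1 I2 I3 I4 gs t b.
move=> h1 h2 h3 h4 h5 h6.
have h7 : L * gs <= L * (t + d) by rewrite ler_wpM2l.
nra.
Qed.

End EnergyEstimate.

(** * Comparison of two solutions *)

Section Uniqueness.
Context {R : realType}.
Local Notation plane := (R * R)%type.
Local Notation mplane := (measurableTypeR R * measurableTypeR R)%type.
Local Notation mu := (@leb2 R).
Variables (Om : set plane) (oOm : open Om) (finOm : (mu (Om : set mplane) < +oo)%E).
Implicit Types (h phi psi S : plane -> R) (v w D : plane -> plane).

Let mOm : measurable (Om : set mplane) := open_measurable2 oOm.

Local Notation sq f := (sqint mu Om f).
Local Notation sq2 u := (sqint2 mu Om u).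
Local Notation nrm := (nrm mu Om).

Lemma lipschitz_continuous_real (F : R -> R) (L : R) :
  (forall y z, `|F y - F z| <= L * `|y - z|) -> continuous F.
Proof.
move=> FL x; apply/cvgrPdist_lt => e e0; near=> y.
apply: le_lt_trans (FL x y) _.
apply: (@le_lt_trans _ _ ((`|L| + 1) * `|x - y|)).
  by rewrite ler_wpM2r// (le_trans (ler_norm _))// lerDl.
have L1 : 0 < `|L| + 1 by rewrite ltr_wpDl.
rewrite mulrC -ltr_pdivlMr//; near: y.
by apply: cvgr_dist_lt => //; rewrite divr_gt0.
Unshelve. all: by end_near. Qed.

Lemma measurable_lipschitz_comp (F : R -> R) (L : R) h :
  (forall y z, `|F y - F z| <= L * `|y - z|) ->
  measurable_fun Om (h : mplane -> R) -> measurable_fun Om ((fun x => F (h x)) : mplane -> R).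
Proof.
move=> FL mh; apply: (measurableT_comp (f := F : measurableTypeR R -> measurableTypeR R)) => //.
by apply: continuous_measurable_fun; exact: lipschitz_continuous_real FL.
Qed.

Lemma nrm_scale_ae h v (M : R) : 0 <= M -> measurable_fun Om (h : mplane -> R) ->
  {ae mu, forall x, Om x -> `|h x| <= M} -> sq2 v ->
  sq2 (fun x => h x *: v x) /\ nrm (fun x => h x *: v x) <= M * nrm v.
Proof.
move=> M0 mh hM sv.
(* Clipping h to [-M, M] changes it on a null set only and makes the bound hold everywhere, as
   [sqint2_bdd] and [nrm_scale] demand. *)
pose h' x := Num.max (- M) (Num.min (h x) M).
have mh' : measurable_fun Om (h' : mplane -> R).
  by apply: measurable_maxr => //; exact: measurable_minr.
have h'M x : Om x -> `|h' x| <= M.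
  by move=> _; rewrite ler_norml /h' le_max lexx /= ge_max ge_min lexx orbT andbT; lra.
have hh' : ae_eq_on Om (fun x => h' x *: v x) (fun x => h x *: v x).
  apply: ae_imp hM => x hx Omx; congr (_ *: _); move: (hx Omx).
  by rewrite ler_norml /h' => /andP[h1 h2]; rewrite min_l// max_r.
have sh' := sqint2_bdd mOm mh' h'M sv.
have sh : sq2 (fun x => h x *: v x).
  apply: (sqint2_ae oOm _ hh' sh').
  have [[mv1 _] [mv2 _]] := sv.
  by case; [exact: (measurable_funM mh mv2)|exact: (measurable_funM mh mv1)].
split; first exact: sh.
rewrite -(nrm_ae oOm sh' sh hh'); exact: (nrm_scale oOm M0 mh' h'M sv).
Qed.

Lemma nrm_scale_le h f v (c G : R) : 0 <= c -> 0 <= G -> sq f ->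
  sq2 (fun x => h x *: v x) ->
  (forall x, Om x -> `|h x| <= c * `|f x|) ->
  {ae mu, forall x, Om x -> enorm (v x) <= G} ->
  nrm (fun x => h x *: v x) <= c * G * nrm (fun x => (f x, 0)).
Proof.
move=> c0 G0 sf shv hf vG.
rewrite -(ler_pXn2r (n := 2)) ?nnegrE ?mulr_ge0 ?nrm_ge0// exprMn !nrm_sqr.
have sf2 := sqint2_dot mOm (sqint2_scalar oOm finOm sf) (sqint2_scalar oOm finOm sf).
rewrite -RintegralZl//; apply: ae_le_Rintegral => //.
- exact: sqint2_dot.
- exact: integrable_scalel.
apply: ae_imp vG => x vG Omx.
have -> : dot (h x *: v x) (h x *: v x) = h x ^+ 2 * enorm (v x) ^+ 2.
  by rewrite enorm_sqr /dot /= /GRing.scale /=; ring.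
have -> : dot (f x, 0) (f x, 0) = f x ^+ 2 by rewrite /dot /= mul0r addr0 expr2.
have -> : (c * G) ^+ 2 * f x ^+ 2 = (c * `|f x|) ^+ 2 * G ^+ 2.
  by rewrite -[f x ^+ 2]real_normK ?num_real//; ring.
apply: ler_pM; rewrite ?sqr_ge0//.
  by rewrite -real_normK ?num_real// ler_pXn2r ?nnegrE ?mulr_ge0//; exact: hf.
by rewrite ler_pXn2r ?nnegrE ?enorm_ge0//; exact: vG.
Qed.

Lemma nrm_eq0_ae v : sq2 v -> nrm v = 0 -> ae_eq_on Om v (fun=> (0, 0)).
Proof.
move=> sv v0; have di := sqint2_dot mOm sv sv.
have I0 : integ Om (fun x => dot (v x) (v x)) = 0.
  by rewrite /integ -nrm_sqr v0 expr0n.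
have := Rintegral_eq0_ae mOm di (fun x _ => dot_ge0 (v x)) I0.
apply: ae_imp => x h /h; rewrite /dot -!expr2 => /eqP.
rewrite paddr_eq0 ?sqr_ge0// !sqrf_eq0 => /andP[/eqP h1 /eqP h2].
by rewrite [LHS]surjective_pairing h1 h2.
Qed.

Variables (nu kappa : R -> R) (nu_min nu_max nu_lip kappa_min kappa_max kappa_lip : R).
Variables (hnu_min : 0 < nu_min) (hnu_lip : 0 < nu_lip).
Variables (hkappa_min : 0 < kappa_min) (hkappa_lip : 0 < kappa_lip).
Variables (hnu : forall x, nu_min <= nu x <= nu_max)
  (hnuL : forall y z, `|nu y - nu z| <= nu_lip * `|y - z|)
  (hkappa : forall x, kappa_min <= kappa x <= kappa_max)
  (hkappaL : forall y z, `|kappa y - kappa z| <= kappa_lip * `|y - z|).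
Variables (f : plane -> plane) (g : plane -> R).
Variables (u1 u : plane -> plane) (p1 T1 p T : plane -> R).
Variables (hsol1 : is_solution Om nu kappa f g u1 p1 T1)
          (hsol : is_solution Om nu kappa f g u p T).

Let w x := u x - u1 x.
Let th x := T x - T1 x.
Let D := wgrad Om th.

Let V0u : V0 Om u. Proof. by case: hsol => -[]. Qed.
Let V0u1 : V0 Om u1. Proof. by case: hsol1 => -[]. Qed.
Let H10T : H10 Om T. Proof. by case: hsol => -[]. Qed.
Let H10T1 : H10 Om T1. Proof. by case: hsol1 => -[]. Qed.
Let su : sq2 u. Proof. by case: V0u => /(HdivP oOm)[]. Qed.
Let su1 : sq2 u1. Proof. by case: V0u1 => /(HdivP oOm)[]. Qed.
Let sp : sq p. Proof. by case: hsol => -[_ [/(Lp_sqint mOm)]]. Qed.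
Let sp1 : sq p1. Proof. by case: hsol1 => -[_ [/(Lp_sqint mOm)]]. Qed.
Let H1T : H1 Om T. Proof. by case: H10T. Qed.
Let H1T1 : H1 Om T1. Proof. by case: H10T1. Qed.
Let sT : sq T. Proof. by case/(H1P oOm): H1T. Qed.
Let sT1 : sq T1. Proof. by case/(H1P oOm): H1T1. Qed.
Let sDT : sq2 (wgrad Om T). Proof. by case/(H1P oOm): H1T. Qed.
Let sDT1 : sq2 (wgrad Om T1). Proof. by case/(H1P oOm): H1T1. Qed.
Let H10th : H10 Om th. Proof. exact: (H10_sub oOm finOm H10T H10T1). Qed.
Let H1th : H1 Om th. Proof. by case: H10th. Qed.
Let sth : sq th. Proof. by case/(H1P oOm): H1th. Qed.
Let sD : sq2 D. Proof. by case/(H1P oOm): H1th. Qed.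
Let DE : ae_eq_on Om D (fun x => wgrad Om T x - wgrad Om T1 x).
Proof. by have [] := H1_sub oOm H1T H1T1. Qed.
Let sw : sq2 w. Proof. exact: (sqint2_sub mOm su su1). Qed.

Let divu : {ae mu, forall x, Om x -> wdiv Om u x = 0}.
Proof. by apply: (wdiv_ae0 oOm finOm V0u); case: hsol. Qed.

Let divu1 : {ae mu, forall x, Om x -> wdiv Om u1 x = 0}.
Proof. by apply: (wdiv_ae0 oOm finOm V0u1); case: hsol1. Qed.

Let V0w : V0 Om w. Proof. by have [] := V0_sub oOm V0u V0u1. Qed.

Let divw : {ae mu, forall x, Om x -> wdiv Om w x = 0}.
Proof.
have [_ wE] := V0_sub oOm V0u V0u1.
have h0 : {ae mu, forall x, Om x -> wdiv Om u x - wdiv Om u1 x = 0}.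
  by apply: ae_imp2 divu divu1 => x h h1 Omx; rewrite h// h1// subrr.
by apply: ae_imp2 wE h0 => x h h1 Omx; rewrite h// h1.
Qed.

Let mT : measurable_fun Om (T : mplane -> R) := sT.1.
Let mT1 : measurable_fun Om (T1 : mplane -> R) := sT1.1.

Let nu_bd x : `|nu x| <= nu_max.
Proof.
by have /andP[h1 h2] := hnu x; rewrite ger0_norm// (le_trans (ltW hnu_min)).
Qed.

Let kappa_bd x : `|kappa x| <= kappa_max.
Proof.
by have /andP[h1 h2] := hkappa x; rewrite ger0_norm// (le_trans (ltW hkappa_min)).
Qed.

(** Both pressure terms vanish because w is divergence free, and the viscous difference nu(T) u -
    nu(T1) u1 equals nu(T) w + (nu(T) - nu(T1)) u1. *)
Lemma momentum_tested : integ Om (fun x => nu (T x) * dot (w x) (w x)) =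
  integ Om (fun x => dot ((nu (T1 x) - nu (T x)) *: u1 x) (w x)).
Proof.
have mnu h (mh : measurable_fun Om (h : mplane -> R)) := measurable_lipschitz_comp hnuL mh.
have [_ e1 _ _] := hsol1; have [_ e2 _ _] := hsol.
have div0 q : sq q -> integ Om (fun x => q x * wdiv Om w x) = 0.
  move=> sq0; have [/(HdivP oOm)[_ _ sdw] _] := V0w.
  transitivity (integ Om (fun=> 0 : R)).
    apply: Rintegral_ae_eq => //; first exact: integrable_measurable_fun (sqint_mul mOm sq0 sdw).
    by apply: ae_imp divw => x h Omx; rewrite h// mulr0.
  by rewrite /integ Rintegral_cst// mul0r.
have := e2 w V0w; rewrite -(e1 w V0w) (div0 _ sp) (div0 _ sp1) !subr0 => E.
have i1 : mu.-integrable Om (EFin \o (fun x => nu (T x) * dot (u x) (w x))).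
  by apply: (integrable_bounded_mul mOm (mnu _ mT) (fun x _ => nu_bd (T x))); exact: sqint2_dot.
have i2 : mu.-integrable Om (EFin \o (fun x => nu (T x) * dot (u1 x) (w x))).
  by apply: (integrable_bounded_mul mOm (mnu _ mT) (fun x _ => nu_bd (T x))); exact: sqint2_dot.
have i3 : mu.-integrable Om (EFin \o (fun x => nu (T1 x) * dot (u1 x) (w x))).
  by apply: (integrable_bounded_mul mOm (mnu _ mT1) (fun x _ => nu_bd (T1 x))); exact: sqint2_dot.
transitivity (integ Om (fun x => nu (T x) * dot (u x) (w x)) -
    integ Om (fun x => nu (T x) * dot (u1 x) (w x))).
  rewrite /integ -RintegralB//; apply: eq_Rintegral_on => x _.
  by rewrite [in dot (w x) _]/w /dot /=; ring.
rewrite E /integ -RintegralB//; apply: eq_Rintegral_on => x _.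
by rewrite /dot /= /GRing.scale /=; ring.
Qed.

Lemma velocity_bound (r Cr : R) : 2 < r -> 0 < Cr -> Lp2 Om r%:E u1 ->
  embedding_constant Om (2 * r / (r - 2))%:E Cr ->
  nu_min * nrm w <= nu_lip * (Cr * nrm D) * fine (Lpnorm2 Om r%:E u1).
Proof.
move=> r2 Cr0 ur hC.
have mnu h (mh : measurable_fun Om (h : mplane -> R)) := measurable_lipschitz_comp hnuL mh.
set U := fine _.
have Ufin : (Lpnorm2 Om r%:E u1 < +oo)%E by apply: Lpnorm2_lty => //; lra.
have U0 : 0 <= U by rewrite fine_ge0// Lnorm_ge0.
have UE : (Lpnorm2 Om r%:E u1 <= U%:E)%E.
  by rewrite /U fineK// ge0_fin_numE// Lnorm_ge0.
have thC : (Lpnorm Om (2 * r / (r - 2))%:E th <= (Cr * nrm D)%:E)%E.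
  by have := hC th H10th; rewrite (Lpnorm2_nrm mOm sD).
have mh : measurable_fun Om ((fun x => nu (T1 x) - nu (T x)) : mplane -> R).
  by apply: measurable_funB; exact: mnu.
have hb x : Om x -> `|nu (T1 x) - nu (T x)| <= nu_max + nu_max.
  by move=> _; apply: le_trans (ler_normB _ _) _; apply: lerD; exact: nu_bd.
have shu := sqint2_bdd mOm mh hb su1.
have hL x : Om x -> `|nu (T1 x) - nu (T x)| <= nu_lip * `|th x|.
  by move=> _; rewrite /th distrC; exact: hnuL.
have := cauchy_schwarz mOm shu sw; rewrite ler_norml => /andP[_].
rewrite -[X in X <= _ -> _]momentum_tested => e.
have pe : 2 / (2 * r / (r - 2)) + 2 / r = 1.
  by field; apply/andP; split; lra.
have p0 : 0 < 2 * r / (r - 2) by apply: divr_gt0; lra.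
have r0 : 0 < r by lra.
have hn : nrm (fun x => (nu (T1 x) - nu (T x)) *: u1 x) <= nu_lip * (Cr * nrm D) * U.
  apply: (nrm_hoelder mOm (ltW hnu_lip) _ U0 p0 r0 pe sth.1 shu su1.1.1 su1.2.1 hL thC UE).
  by rewrite mulr_ge0 ?nrm_ge0// ltW.
have lo : nu_min * nrm w ^+ 2 <= integ Om (fun x => nu (T x) * dot (w x) (w x)).
  rewrite nrm_sqr -RintegralZl//; last exact: sqint2_dot.
  apply: le_Rintegral => //.
  - by apply: integrable_scalel => //; exact: sqint2_dot.
  - by apply: (integrable_bounded_mul mOm (mnu _ mT) (fun x _ => nu_bd (T x))); exact: sqint2_dot.
  - by move=> x _; rewrite ler_wpM2r ?dot_ge0//; have /andP[] := hnu (T x).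
(* The tested equation bounds nu_min |w|^2 by a multiple of |w|; one factor |w| is cancelled when it
   is nonzero. *)
have [->|wn0] := eqVneq (nrm w) 0.
  by rewrite mulr0 mulr_ge0// mulr_ge0 ?(ltW hnu_lip)// mulr_ge0 ?nrm_ge0// ltW.
have w0 : 0 < nrm w by rewrite lt0r wn0 nrm_ge0.
rewrite -(ler_pM2r w0) -[leLHS]mulrA -expr2.
apply: le_trans lo _; apply: le_trans e _.
by rewrite ler_pM2r.
Qed.

(** The product T1 S is in H^1, so w, divergence free with zero normal trace, is orthogonal to its
    gradient S grad T1 + T1 grad S. *)
Lemma convection_by_parts S : test_fun Om S ->
  integ Om (fun x => dot (w x) (wgrad Om T1 x) * S x) =
  - integ Om (fun x => dot (T1 x *: w x) (grad S x)).
Proof.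
move=> tS; have [H1TS TSE] := H1_mul_test oOm H1T1 tS.
have [C C0 SC] := test_fun_bounded tS.
have mS : measurable_fun Om (S : mplane -> R).
  by apply: continuous_measurable_fun2; exact: test_fun_continuous tS.
have [C' C'0 gC] : exists2 C', 0 <= C' & forall i x, `|partial i S x| <= C'.
  have [A1 A10 h1] := test_fun_bounded (test_fun_partial false tS).
  have [A2 A20 h2] := test_fun_bounded (test_fun_partial true tS).
  exists (A1 + A2); first exact: addr_ge0.
  by case=> x; [rewrite (le_trans (h2 x))// lerDr|rewrite (le_trans (h1 x))// lerDl].
have i1 : mu.-integrable Om (EFin \o (fun x => dot (w x) (wgrad Om T1 x) * S x)).
  apply: (eq_integrable_on mOm (f := fun x => S x * dot (w x) (wgrad Om T1 x))).
    by move=> x _; rewrite mulrC.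
  by apply: (integrable_bounded_mul mOm mS (fun x _ => SC x)); exact: sqint2_dot.
have i2 : mu.-integrable Om (EFin \o (fun x => dot (T1 x *: w x) (grad S x))).
  have aux i : mu.-integrable Om (EFin \o (fun x => partial i S x * (T1 x * coord i w x))).
    apply: (integrable_bounded_mul mOm (M := C')) => //.
      by apply: continuous_measurable_fun2; exact: test_fun_continuous (test_fun_partial i tS).
    by apply: sqint_mul => //; case: i; [exact: sw.2|exact: sw.1].
  apply: (eq_integrable_on mOm (f := fun x => partial false S x * (T1 x * coord false w x) +
     partial true S x * (T1 x * coord true w x))).
    by move=> x _; rewrite /dot /= /GRing.scale /=; ring.
  exact: integrable_addr.
apply/eqP; rewrite -addr_eq0; apply/eqP.
rewrite -(divfree_grad oOm V0w divw H1TS) /integ -RintegralD//.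
have /(H1P oOm)[_ _ sTS] := H1TS.
apply: Rintegral_ae_eq => //; first exact: integrable_measurable_fun (integrable_addr mOm i1 i2).
  exact: integrable_measurable_fun (sqint2_dot mOm sw sTS).
apply: ae_imp TSE => x h Omx; rewrite h// /dot /= /GRing.scale /=; ring.
Qed.

(** Difference of the two heat equations. The grouping u . grad theta + w . grad T1 leaves the
    uncontrolled gradient multiplied by a divergence-free field, and pairs w with the gradient of
    the regular temperature. *)
Lemma heat_tested S : test_fun Om S ->
  integ Om (fun x => kappa (T x) * dot (D x) (grad S x)) +
  integ Om (fun x => dot (u x) (D x) * S x) =
  - integ Om (fun x => dot ((kappa (T x) - kappa (T1 x)) *: wgrad Om T1 x) (grad S x)) -
  integ Om (fun x => dot (w x) (wgrad Om T1 x) * S x).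
Proof.
have alg (a1 b1 a2 b2 c d e : R) : a1 + b1 = e -> a2 + b2 = e ->
    a2 - a1 - c + (b2 - b1 - d) = - c - d by move=> <- /eqP; rewrite -subr_eq => /eqP <-; ring.
move=> tS; have H10S := H10_test oOm finOm tS; have LS := Lp_oo_test oOm tS.
have [_ _ _ /(_ S H10S LS) e1] := hsol1; have [_ _ _ /(_ S H10S LS) e2] := hsol.
have mka h (mh : measurable_fun Om (h : mplane -> R)) := measurable_lipschitz_comp hkappaL mh.
have [C C0 SC] := test_fun_bounded tS.
have mS : measurable_fun Om (S : mplane -> R).
  by apply: continuous_measurable_fun2; exact: test_fun_continuous tS.
have sgS := sqint2_grad_test oOm finOm tS.
have [/(H1P oOm)[_ _ sWS] _] := H10S.
have SE := wgrad_ae oOm (weak_grad_test oOm tS).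
have ik h v v' : measurable_fun Om (h : mplane -> R) -> sq2 v -> sq2 v' ->
    mu.-integrable Om (EFin \o (fun x => kappa (h x) * dot (v x) (v' x))).
  move=> mh sv sv'; apply: (integrable_bounded_mul mOm (mka _ mh) (fun x _ => kappa_bd (h x))).
  exact: sqint2_dot.
have iS v v' : sq2 v -> sq2 v' ->
    mu.-integrable Om (EFin \o (fun x => dot (v x) (v' x) * S x)).
  move=> sv sv'; apply: (eq_integrable_on mOm (f := fun x => S x * dot (v x) (v' x))).
    by move=> x _; rewrite mulrC.
  by apply: (integrable_bounded_mul mOm mS (fun x _ => SC x)); exact: sqint2_dot.
have mhk : measurable_fun Om ((fun x => kappa (T x) - kappa (T1 x)) : mplane -> R).
  by apply: measurable_funB; exact: mka.
have hkb x : Om x -> `|kappa (T x) - kappa (T1 x)| <= kappa_max + kappa_max.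
  by move=> _; apply: le_trans (ler_normB _ _) _; apply: lerD; exact: kappa_bd.
have shk := sqint2_bdd mOm mhk hkb sDT1.
have A1 : integ Om (fun x => kappa (T x) * dot (D x) (grad S x)) =
    integ Om (fun x => kappa (T x) * dot (wgrad Om T x) (wgrad Om S x)) -
    integ Om (fun x => kappa (T1 x) * dot (wgrad Om T1 x) (wgrad Om S x)) -
    integ Om (fun x => dot ((kappa (T x) - kappa (T1 x)) *: wgrad Om T1 x) (grad S x)).
  have j1 := ik _ _ _ mT sDT sWS; have j2 := ik _ _ _ mT1 sDT1 sWS.
  have j3 := sqint2_dot mOm shk sgS.
  rewrite /integ -(RintegralB mOm j1 j2) -(RintegralB mOm (integrable_subr mOm j1 j2) j3).
  apply: Rintegral_ae_eq => //; first exact: integrable_measurable_fun (ik _ _ _ mT sD sgS).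
    exact: integrable_measurable_fun (integrable_subr mOm (integrable_subr mOm j1 j2) j3).
  apply: ae_imp2 DE SE => x h h' Omx; rewrite h// h'//.
  by rewrite /dot /= /GRing.scale /=; ring.
have A2 : integ Om (fun x => dot (u x) (D x) * S x) =
    integ Om (fun x => dot (u x) (wgrad Om T x) * S x) -
    integ Om (fun x => dot (u1 x) (wgrad Om T1 x) * S x) -
    integ Om (fun x => dot (w x) (wgrad Om T1 x) * S x).
  have j1 := iS _ _ su sDT; have j2 := iS _ _ su1 sDT1; have j3 := iS _ _ sw sDT1.
  rewrite /integ -(RintegralB mOm j1 j2) -(RintegralB mOm (integrable_subr mOm j1 j2) j3).
  apply: Rintegral_ae_eq => //; first exact: integrable_measurable_fun (iS _ _ su sD).
    exact: integrable_measurable_fun (integrable_subr mOm (integrable_subr mOm j1 j2) j3).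
  apply: ae_imp DE => x h Omx; rewrite h//.
  by rewrite /w /dot /=; ring.
rewrite A1 A2; exact: alg e1 e2.
Qed.

(** [truncation_limit] with weight kappa(T), where L is the factor of |grad S| obtained by applying
    Cauchy-Schwarz to the two right-hand terms of [heat_tested]. *)
Lemma energy_bound (M G : R) : 0 <= M -> 0 <= G ->
  {ae mu, forall x, Om x -> `|T1 x| <= M} ->
  {ae mu, forall x, Om x -> enorm (wgrad Om T1 x) <= G} ->
  kappa_min * nrm D ^+ 2 <=
  (kappa_lip * G * nrm (fun x => (th x, 0)) + M * nrm w) * nrm D.
Proof.
move=> M0 G0 TM TG.
have mka h (mh : measurable_fun Om (h : mplane -> R)) := measurable_lipschitz_comp hkappaL mh.
have kmax0 : 0 <= kappa_max := le_trans (normr_ge0 _) (kappa_bd 0).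
have L0 : 0 <= kappa_lip * G * nrm (fun x => (th x, 0)) + M * nrm w.
  by rewrite addr_ge0 ?mulr_ge0 ?nrm_ge0// ltW.
have mhk : measurable_fun Om ((fun x => kappa (T x) - kappa (T1 x)) : mplane -> R).
  by apply: measurable_funB; exact: mka.
have hkb x : Om x -> `|kappa (T x) - kappa (T1 x)| <= kappa_max + kappa_max.
  by move=> _; apply: le_trans (ler_normB _ _) _; apply: lerD; exact: kappa_bd.
have shk := sqint2_bdd mOm mhk hkb sDT1.
have nk : nrm (fun x => (kappa (T x) - kappa (T1 x)) *: wgrad Om T1 x) <=
    kappa_lip * G * nrm (fun x => (th x, 0)).
  by apply: nrm_scale_le => //; exact: ltW.
have [sTw nTw] := nrm_scale_ae M0 mT1 TM sw.
have lo : kappa_min * nrm D ^+ 2 <= integ Om (fun x => kappa (T x) * dot (D x) (D x)).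
  rewrite nrm_sqr -RintegralZl//; last exact: sqint2_dot.
  apply: le_Rintegral => //.
  - by apply: integrable_scalel => //; exact: sqint2_dot.
  - by apply: (integrable_bounded_mul mOm (mka _ mT) (fun x _ => kappa_bd (T x))); exact: sqint2_dot.
  - by move=> x _; rewrite ler_wpM2r ?dot_ge0//; have /andP[] := hkappa (T x).
apply: (le_trans lo).
apply: (truncation_limit oOm finOm (theta := th) (u := u) (K := kappa_max)) => //.
- exact: mka.
- by move=> x _; have /andP[h1 ->] := hkappa (T x); rewrite (le_trans (ltW hkappa_min)).
- by case/(H10P oOm finOm): H10th.
- by move=> psi tpsi; exact: (divfree_grad_test oOm finOm V0u divu tpsi).
move=> S tS; rewrite heat_tested// convection_by_parts// opprK mulrDl.
have sgS := sqint2_grad_test oOm finOm tS.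
apply: lerD.
  have := cauchy_schwarz mOm shk sgS; rewrite ler_norml => /andP[+ _].
  rewrite lerNl => /le_trans; apply; apply: ler_wpM2r => //; exact: nrm_ge0.
have := cauchy_schwarz mOm sTw sgS; rewrite ler_norml => /andP[_].
by move=> /le_trans; apply; apply: ler_wpM2r => //; exact: nrm_ge0.
Qed.

Lemma pressure_unique : connected Om -> Om !=set0 ->
  ae_eq_on Om u u1 -> ae_eq_on Om T T1 -> ae_eq_on Om p p1.
Proof.
move=> cOm Om0 uE TE.
have mnu h (mh : measurable_fun Om (h : mplane -> R)) := measurable_lipschitz_comp hnuL mh.
have [[_ [_ Ip1] _] e1 _ _] := hsol1; have [[_ [_ Ip] _] e2 _ _] := hsol.
have spp : sq (fun x => p x - p1 x) := sqint_sub mOm sp sp1.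
have orth phi : test_fun Om phi -> forall i,
    integ Om (fun x => (p x - p1 x) * partial i phi x) = 0.
  move=> tphi i; pose v x := phi x *: @ebase R i.
  have V0v : V0 Om v := V0_test oOm finOm i tphi.
  have [/(HdivP oOm)[sv _ sdv] _] := V0v.
  have E1 : integ Om (fun x => nu (T x) * dot (u x) (v x)) =
      integ Om (fun x => nu (T1 x) * dot (u1 x) (v x)).
    apply: Rintegral_ae_eq => //.
    - by apply: measurable_funM; [exact: mnu|exact: integrable_measurable_fun (sqint2_dot mOm su sv)].
    - by apply: measurable_funM; [exact: mnu|exact: integrable_measurable_fun (sqint2_dot mOm su1 sv)].
    - by apply: ae_imp2 uE TE => x h h' Omx; rewrite h// h'.
  have := e2 v V0v; rewrite -(e1 v V0v) E1 => /addrI/oppr_inj E2.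
  have tp := sqint_test oOm finOm (test_fun_partial i tphi).
  transitivity (integ Om (fun x => p x * wdiv Om v x) - integ Om (fun x => p1 x * wdiv Om v x)).
    have i1 := sqint_mul mOm sp sdv; have i2 := sqint_mul mOm sp1 sdv.
    rewrite /integ -RintegralB//; apply: Rintegral_ae_eq => //.
    - exact: integrable_measurable_fun (sqint_mul mOm spp tp).
    - exact: integrable_measurable_fun (integrable_subr mOm i1 i2).
    - have := wdiv_ae oOm (weak_div_test oOm i tphi); apply: ae_imp => x h Omx.
      by rewrite h// mulrBl.
  by rewrite E2 subrr.
have [c cE] := ae_cst_connected oOm cOm Om0 (loc_sqint oOm spp) orth.
(* Both pressures have mean value 0, and a nonempty open set has positive measure, so the constant
   is 0. *)
have c0 : c * fine (mu Om) = 0.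
  have <- : integ Om (fun x => p x - p1 x) = c * fine (mu Om).
    transitivity (integ Om (fun=> c)); last by rewrite /integ Rintegral_cst.
    by apply: Rintegral_ae_eq => //; exact: spp.1.
  have ip := sqint_int mOm finOm sp; have ip1 := sqint_int mOm finOm sp1.
  by rewrite /integ RintegralB//; move: Ip Ip1; rewrite /integ => -> ->; rewrite subrr.
have mu0 : fine (mu Om) != 0.
  apply/eqP => m0; have [x Omx] := Om0.
  apply: (@ae_open_nonempty _ Om False x).
    by apply: open_nbhs_nbhs; split.
  exists Om; split => //; last by move=> y; apply: contrapT.
  by rewrite -[LHS]fineK ?m0// ge0_fin_numE.
have {c0} c0 : c = 0 by apply/eqP; move/eqP: c0; rewrite mulf_eq0 (negbTE mu0) orbF.
by apply: ae_imp cE => x h Omx; apply/eqP; rewrite -subr_eq0 h// c0.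
Qed.

End Uniqueness.

(** * Smallness assumption and conclusion *)

(** Here t, tau and a stand for |grad theta|_2, |theta|_2 and |w|_2. If t were positive, chaining
    the estimates would give kmin <= C2 klip G + den, while the quotient being above 1 says the
    opposite. *)
Lemma smallness_forces_zero {R : realType}
    (kmin klip nmin nlip C2 Cr G U M t tau a : R) :
  0 < klip -> 0 < nmin -> 0 < nlip -> 0 < Cr -> 0 <= G -> 0 <= U -> 0 <= M -> 0 <= t ->
  (kmin - C2 * klip * G) / (nmin^-1 * Cr * nlip * U * M) > 1 ->
  tau <= C2 * t -> nmin * a <= nlip * (Cr * t) * U ->
  kmin * t ^+ 2 <= (klip * G * tau + M * a) * t -> t = 0.
Proof.
move=> kl nm nl Cr0 G0 U0 M0 t0 small htau ha ht.
set den := nmin^-1 * Cr * nlip * U * M in small.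
have den0 : 0 <= den.
  by rewrite !mulr_ge0 ?invr_ge0//; exact: ltW.
(* Division by 0 yields 0, which is not above 1; so the smallness assumption itself excludes a zero
   denominator, and the quotient can be cleared. *)
have denp : 0 < den.
  rewrite lt0r den0 andbT; apply/negP => /eqP d0.
  by move: small; rewrite d0 invr0 mulr0 ltr10.
move: small; rewrite ltr_pdivlMr// mul1r => small.
apply/eqP/negPn/negP => tn0; have tp : 0 < t by rewrite lt0r tn0.
have {}ht : kmin * t <= klip * G * tau + M * a.
  by rewrite -(ler_pM2r tp) -[leLHS]mulrA -expr2.
have {}ha : a <= nmin^-1 * (nlip * (Cr * t) * U) by rewrite mulrC ler_pdivlMr// mulrC.
have h1 : klip * G * tau <= klip * G * (C2 * t).
  by apply: ler_wpM2l => //; apply: mulr_ge0 => //; exact: ltW.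
have h2 : M * a <= M * (nmin^-1 * (nlip * (Cr * t) * U)) by exact: ler_wpM2l.
have h3 : kmin * t <= (C2 * klip * G + den) * t.
  apply: le_trans ht _; apply: le_trans (lerD h1 h2) _.
  by rewrite le_eqVlt; apply/orP; left; apply/eqP; rewrite /den; ring.
move: h3; rewrite ler_pM2r//; lra.
Qed.

Theorem theorem3p4 (R : realType) (Om : set (R * R))
  (hOm : lipschitz_polygonal_domain Om) (hsc : simply_connected Om)
  (nu kappa : R -> R)
  (nu_min nu_max nu_lip kappa_min kappa_max kappa_lip : R)
  (hnu_min : 0 < nu_min) (hnu_max : 0 < nu_max) (hnu_lip : 0 < nu_lip)
  (hkappa_min : 0 < kappa_min) (hkappa_max : 0 < kappa_max)
  (hkappa_lip : 0 < kappa_lip)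
  (hnu : forall x, nu_min <= nu x <= nu_max)
  (hnuL : forall y z, `|nu y - nu z| <= nu_lip * `|y - z|)
  (hkappa : forall x, kappa_min <= kappa x <= kappa_max)
  (hkappaL : forall y z, `|kappa y - kappa z| <= kappa_lip * `|y - z|)
  (f : R * R -> R * R) (g : R * R -> R)
  (hf : Lp2 Om 2%:E f) (hg : Lp Om 2%:E g)
  (C2 : R) (hC2_gt0 : 0 < C2) (hC2 : embedding_constant Om 2%:E C2)
  (u1 : R * R -> R * R) (p1 T1 : R * R -> R)
  (hsol : is_solution Om nu kappa f g u1 p1 T1)
  (hT1 : W1p Om +oo%E T1)
  (r : R) (hr : 2 < r) (hu1 : Lp2 Om r%:E u1)
  (Cr : R) (hCr_gt0 : 0 < Cr)
  (hCr : best_embedding_constant Om (2 * r / (r - 2))%:E Cr)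
  (hsmall :
    (kappa_min - C2 * kappa_lip * fine (Lpnorm2 Om +oo%E (wgrad Om T1))) /
    (nu_min^-1 * Cr * nu_lip * fine (Lpnorm2 Om r%:E u1)
      * fine (Lpnorm Om +oo%E T1)) > 1) :
  forall (u : R * R -> R * R) (p T : R * R -> R),
    is_solution Om nu kappa f g u p T ->
    [/\ ae_eq_on Om u u1, ae_eq_on Om p p1 & ae_eq_on Om T T1].
Proof.
move=> u p T hsol'.
have [Om0 oOm cOm bOm _] := hOm.
have mOm := open_measurable2 oOm.
have finOm := bounded_leb2_fin bOm mOm.
have [LT1 exT1 LDT1] := hT1.
have [_ NT1] := iffLR (LpP mOm _ _) LT1.
have NDT1 := Lpnorm2_oo_lty mOm LDT1.
set M := fine (Lpnorm Om +oo%E T1) in hsmall.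
set G := fine (Lpnorm2 Om +oo%E (wgrad Om T1)) in hsmall.
have M0 : 0 <= M by rewrite fine_ge0// Lnorm_ge0.
have G0 : 0 <= G by rewrite fine_ge0// Lnorm_ge0.
have TM := Lpnorm_oo_ae NT1.
have TG : {ae leb2, forall x, Om x -> enorm (wgrad Om T1 x) <= G}.
  apply: ae_imp (Lpnorm_oo_ae NDT1) => x h Omx.
  by apply: le_trans (h Omx); exact: ler_norm.
have vb := velocity_bound oOm finOm hnu_min hnu_lip hnu hnuL hsol hsol' hr hCr_gt0 hu1 hCr.1.
have eb := energy_bound oOm finOm hkappa_min hkappa_lip hkappa hkappaL hsol hsol' M0 G0 TM TG.
have H10T : H10 Om T by case: hsol' => -[].
have H10T1 : H10 Om T1 by case: hsol => -[].
have H10th := H10_sub oOm finOm H10T H10T1.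
have [H1th _] := H10th.
have [sth _ sD] := iffLR (H1P oOm _) H1th.
have su : sqint2 leb2 Om u.
  by have [[[/(HdivP oOm)[]]]] := hsol'.
have su1 : sqint2 leb2 Om u1.
  by have [[[/(HdivP oOm)[]]]] := hsol.
have th2 : nrm leb2 Om (fun x => (T x - T1 x, 0)) <=
    C2 * nrm leb2 Om (wgrad Om (fun x => T x - T1 x)).
  have := hC2 _ H10th; rewrite (Lpnorm2_nrm mOm sD) (Lpnorm_nrm oOm sth).
  by rewrite -EFinM lee_fin.
have U0 : 0 <= fine (Lpnorm2 Om r%:E u1) by rewrite fine_ge0// Lnorm_ge0.
have D0 := smallness_forces_zero hkappa_lip hnu_min hnu_lip hCr_gt0 G0 U0 M0
  (nrm_ge0 leb2 Om _) hsmall th2 vb eb.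
have th0 : nrm leb2 Om (fun x => (T x - T1 x, 0)) = 0.
  by apply/eqP; rewrite eq_le nrm_ge0 andbT; move: th2; rewrite D0 mulr0.
have w0 : nrm leb2 Om (fun x => u x - u1 x) = 0.
  apply/eqP; rewrite eq_le nrm_ge0 andbT -(ler_pM2l hnu_min) mulr0.
  by apply: le_trans vb _; rewrite D0 !mulr0 mul0r.
have uE : ae_eq_on Om u u1.
  apply: ae_imp (nrm_eq0_ae oOm (sqint2_sub mOm su su1) w0) => x h Omx.
  by apply/eqP; rewrite -subr_eq0; apply/eqP; exact: h.
have TE : ae_eq_on Om T T1.
  apply: ae_imp (nrm_eq0_ae oOm (sqint2_scalar oOm finOm sth) th0) => x h Omx.
  by apply/eqP; rewrite -subr_eq0; have [/eqP] := h Omx.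
split; [exact: uE| |exact: TE].
exact: (pressure_unique oOm finOm hnuL hsol hsol' cOm Om0 uE TE).
Qed.
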